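(* Let $\alpha_0\in(0,2)$, $C_U>0$, $a>1$, and let $\mu=(\mu(x,\cdot))_{x\in\mathbb{R}^d}$ be a symmetric family of measures on $\mathcal{B}(\mathbb{R}^d)$. Assume that there exist measures $\nu_*$ and $\nu^*$ on $\mathcal{B}(\mathbb{R}^d)$ such that: (i) for every measurable $f:\mathbb{R}^d\times\mathbb{R}^d\to[0,\infty]$ and every $x\in\mathbb{R}^d$, $\int f(x,x+z)\,\nu_*(dz)\le\int f(x,y)\,\mu(x,dy)\le\int f(x,x+z)\,\nu^*(dz)$; (ii) $\nu_*$ and $\nu^*$ satisfy the upper bound $\int_{\mathbb{R}^d}(r\wedge|z|)^2\,\nu(dz)\le C_U r^{2-\alpha_0}$ for all $0<r\le1$; (iii) $\nu_*=\sum_{k=1}^n f_kH_{E_k}$ for some $n\in\{1,\dots,d\}$, linear subspaces $E_k\subset\mathbb{R}^d$ and densities $f_k$ with $\operatorname{lin}(\bigcup_kE_k)=\mathbb{R}^d$ and $\int_{B_1}f_k\,dH_{E_k}>0$ for $k=1,\dots,n$; (iv) each measure $\nu=f_kH_{E_k}$ satisfies $\int_{\mathbb{R}^d} g(y)\,\nu(dy)=a^{-\alpha_0}\int_{\mathbb{R}^d} g(ay)\,\nu(dy)$ for every measurable $g:\mathbb{R}^d\to[0,\infty]$ with $\operatorname{supp}g\subset B_1$. Then there are $A\ge1$, $B\ge1$ such that $\mu$ satisfies the local energy comparability condition with exponent $\alpha_0$ and constant $A$ and the cut-off condition with exponent $\alpha_0$ and constant $B$. One can choose $B=4C_U$, while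 $A$ depends also on $a$, $\nu_*$ and $\alpha_0$. Moreover, the result is robust in the following sense: there is a constant $A\ge 1$, independent of $\alpha\in[\alpha_0,2)$, such that if $\alpha\in[\alpha_0,2)$ and $\mu^\alpha=(\mu^\alpha(x,\cdot))_{x\in\mathbb{R}^d}$ is a symmetric family of measures satisfying (i) with $\mu,\nu_*,\nu^*$ replaced by $\mu^\alpha,(\nu_* )^\alpha,(\nu^* )^\alpha$, then $\mu^\alpha$ satisfies the local energy comparability condition with exponent $\alpha$ and constant $A$.
   Context: $B_r(x)$ is the open ball, $B_r=B_r(0)$. $H_E$ is the $\dim(E)$-dimensional Hausdorff measure on $\mathbb{R}^d$ supported on (restricted to) $E$. Symmetric family: for all measurable $S,T$ with $S\times T\subset (\mathbb{R}^d\times\mathbb{R}^d)\setminus\mathrm{diag}$, $\int_S\int_T\mu(x,dy)\,dx=\int_T\int_S\mu(x,dy)\,dx$ (measurability of $\mu(x,\cdot)$ in $x$ being understood). For open $D$: $\mathcal{E}^\mu_D(u,u)=\int_D\int_D(u(y)-u(x))^2\mu(x,dy)\,dx$; $\mu_\alpha(x,dy)=(2-\alpha)|x-y|^{-d-\alpha}dy$; $H^{\alpha/2}(D)=\{u\in L^2(D):\mathcal{E}^{\mu_\alpha}_D(u,u)<\infty\}$. Local energy comparability with exponent $\alpha$ and constant $A$: for every ball $B_\rho(x_0)$ with $\rho\in(0,1)$, $x_0\in B_1$ and every $v\in H^{\alpha/2}(B_\rho(x_0))$, $A^{-1}\mathcal{E}^\mu_{B_\rho(x_0)}(v,v)\le\mathcal{E}^{\mu_\alpha}_{B_\rho(x_0)}(v,v)\le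 A\,\mathcal{E}^\mu_{B_\rho(x_0)}(v,v)$. Cut-off condition with exponent $\alpha$ and constant $B$: for all $0<\rho\le R\le1$ and $x_0\in B_1$ there is a nonnegative measurable $\tau:\mathbb{R}^d\to\mathbb{R}$ with $\mathrm{supp}(\tau)\subset\overline{B_{R+\rho}(x_0)}$, $\tau\equiv1$ on $B_R(x_0)$, $\|\tau\|_\infty\le1$ and $\sup_{x\in\mathbb{R}^d}\int_{\mathbb{R}^d}(\tau(y)-\tau(x))^2\mu(x,dy)\le B\rho^{-\alpha}$. Interpolated measures: for a measure $\nu$ on $\mathcal{B}(\mathbb{R}^d)$ associated with $\alpha_0$ and $\alpha\in[\alpha_0,2)$, $\nu^\alpha(dx)=\frac{2-\alpha}{2-\alpha_0}|x|^{\alpha_0-\alpha}\nu(dx)$ for $\alpha>\alpha_0$, and $\nu^{\alpha_0}=\nu$. *)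

(* Defs.v *)
From HB Require Import structures.
From mathcomp Require Import all_boot all_order all_algebra.
From mathcomp Require Import all_classical all_reals all_analysis.
From mathcomp Require Import measurable_realfun.

Set Implicit Arguments.
Unset Strict Implicit.
Unset Printing Implicit Defensive.

Import Order.TTheory GRing.Theory Num.Theory.
Import numFieldNormedType.Exports.

Local Open Scope classical_set_scope.
Local Open Scope ring_scope.

Section borel_matrix.
Variables (R : realType) (m n : nat).

HB.instance Definition _ := @isMeasurable.Build
  (sigma_display (@open 'M[R]_(m, n))) 'M[R]_(m, n) <<s (@open 'M[R]_(m, n)) >>
  (@sigma_algebra0 _ setT _) (@sigma_algebraC _ _) (@sigma_algebra_bigcup _ setT _).

End borel_matrix.

Section euclidean.
Variables (R : realType) (d : nat).
Implicit Types (x y : 'rV[R]_d).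

(* The library norm on matrices is the sup norm; it induces the same topology. *)
Definition enorm x : R := Num.sqrt (\sum_(i < d) x ord0 i ^+ 2).

Definition eball x (r : R) : set 'rV[R]_d := [set y | enorm (y - x) < r].

End euclidean.

Definition rat_box (R : realType) d (q : 'rV[rat]_d) (k : nat) : set 'rV[R]_d :=
  [set x | forall i, `|ratr (q ord0 i) - x ord0 i| < k.+1%:R^-1].

Lemma open_bigcup_box (R : realType) d (O : set 'rV[R]_d) : open O ->
  O = \bigcup_(qk in [set qk : 'rV[rat]_d * nat | rat_box qk.1 qk.2 `<=` O])
      rat_box qk.1 qk.2.
Proof.
move=> oO; apply/seteqP; split => [x Ox|x [qk] /=]; last exact.
have /nbhs_ballP[e /= e0 xeO] : nbhs x O by rewrite openE in oO; exact: oO.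
have e20 : 0 < e / 2 by rewrite divr_gt0.
have [k ke] : exists k : nat, k.+1%:R^-1 < e / 2.
  have /= [N _ HN] := @near_infty_natSinv_lt R (PosNum e20).
  by exists N; exact: (HN N (leqnn N)).
have k0 : 0 < k.+1%:R^-1 :> R by rewrite invr_gt0.
have /choice[q Hq] : forall i, exists q : rat, `|ratr q - x ord0 i| < k.+1%:R^-1.
  move=> i; have [q] := rat_in_itvoo (ltr_pwDr k0 (lexx (x ord0 i))).
  rewrite in_itv/= => /andP[q1 q2]; exists q.
  by rewrite ger0_norm ?subr_ge0 ?(ltW q1)// ltrBlDl.
exists (\row_i q i, k) => /=; last by move=> i; rewrite mxE.
move=> y Hy; apply: xeO; split=> // i j.
rewrite (ord1 i); have := Hy j; rewrite mxE => {}Hy.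
rewrite /ball/= (splitr e) -(subrKA (ratr (q j))) (le_lt_trans (ler_normD _ _))//.
by rewrite ltrD// ?(lt_trans Hy)// distrC (lt_trans (Hq j)).
Qed.

Lemma measurable_fun_rV d1 (T : measurableType d1) (R : realType) d
    (f : T -> 'rV[R]_d) :
  (forall i, measurable_fun setT (fun x => f x ord0 i)) ->
  measurable_fun setT f.
Proof.
move=> mf; apply: (@measurability _ _ _ _ _ _ (@open 'rV[R]_d)) => //.
move=> _ [U oU <-]; rewrite setTI (open_bigcup_box oU) preimage_bigcup.
rewrite bigcup_mkcond; apply: countable_bigcupT_measurable => // -[q k].
case: ifPn => // _.
rewrite (_ : _ @^-1` _ = \bigcap_(i in [set: 'I_d])
    (fun x => f x ord0 i) @^-1` ball (ratr (q ord0 i) : R) k.+1%:R^-1).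
  apply: fin_bigcap_measurable => // i _; rewrite -[X in measurable X]setTI.
  by apply: mf => //; exact: measurable_ball.
by apply/seteqP; split => x /= Hx i; [move=> _; exact: Hx|exact: (Hx i)].
Qed.

Lemma measurable_coord (R : realType) d (i : 'I_d) :
  measurable_fun setT (fun x : 'rV[R]_d => x ord0 i).
Proof.
apply: (@measurability _ _ _ _ _ _ (@RGenOpens.G R)).
  exact: RGenOpens.measurableE.
move=> _ [_ [a [b ->]] <-]; rewrite setTI; apply: sub_sigma_algebra.
by apply: open_comp; [move=> + _; exact: coord_continuous|exact: interval_open].
Qed.

Section lebesgue_rV_step.
Variables (R : realType) (d : nat).
Variable m : {sigma_finite_measure set 'rV[R]_d -> \bar R}.

Definition rV_cons (p : measurableTypeR R * 'rV[R]_d) : 'rV[R]_d.+1 :=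
  row_mx (p.1%:M : 'rV_1) p.2.

Definition rV_uncons (x : 'rV[R]_d.+1) : measurableTypeR R * 'rV[R]_d :=
  (x ord0 ord0, @rsubmx R 1 1 d x).

Lemma rV_consK : cancel rV_cons rV_uncons.
Proof.
move=> [x y]; rewrite /rV_uncons/rV_cons/= row_mxKr; congr pair.
have -> : ord0 = lshift d (ord0 : 'I_1) :> 'I_(1 + d) by exact/val_inj.
by rewrite (@row_mxEl R 1 1 d) mxE eqxx.
Qed.

Lemma measurable_rV_cons : measurable_fun setT rV_cons.
Proof.
apply: measurable_fun_rV => i; rewrite /rV_cons.
case: (@splitP 1 d i) => j ij.
  have -> : i = lshift d j :> 'I_(1 + d) by exact/val_inj.
  rewrite [X in measurable_fun _ X](_ : _ = fst) //.
  by apply/funext => x; rewrite (@row_mxEl R 1 1 d) (ord1 j) mxE eqxx.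
have -> : i = rshift 1 j :> 'I_(1 + d) by exact/val_inj.
rewrite [X in measurable_fun _ X](_ : _ = (fun x : 'rV[R]_d => x ord0 j) \o snd).
  by apply: measurableT_comp => //; exact: measurable_coord.
by apply/funext => x; rewrite (@row_mxEr R 1 1 d).
Qed.

Lemma measurable_rV_uncons : measurable_fun setT rV_uncons.
Proof.
apply: measurable_fun_pair => /=; first exact: measurable_coord.
apply: measurable_fun_rV => i; rewrite [X in measurable_fun _ X](_ : _ =
    (fun x : 'rV[R]_d.+1 => x ord0 (rshift 1 i))); first exact: measurable_coord.
by apply/funext => x; rewrite mxE.
Qed.

Definition lebesgue_step : set 'rV[R]_d.+1 -> \bar R :=
  pushforward (lebesgue_measure \x m)%E rV_cons.

HB.instance Definition _ := Measure.copy lebesgue_step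
  (measure_function_pushforward__canonical__measure_function_Measure
    (lebesgue_measure \x m)%E measurable_rV_cons).

Let lebesgue_step_sigma_finite : sigma_finite setT lebesgue_step.
Proof.
have /sigma_finiteP[F [TF ndF Foo]] := sigma_finiteT (@lebesgue_measure R).
have /sigma_finiteP[G [TG ndG Goo]] := sigma_finiteT m.
exists (fun k => rV_uncons @^-1` (F k `*` G k)).
  apply/esym; rewrite -subTset => x _.
  have [k _ Fk] : (\bigcup_i F i) (rV_uncons x).1 by rewrite -TF.
  have [l _ Gl] : (\bigcup_i G i) (rV_uncons x).2 by rewrite -TG.
  exists (maxn k l) => //; split.
    by move: Fk; exact/subsetPset/ndF/leq_maxl.
  by move: Gl; exact/subsetPset/ndG/leq_maxr.
move=> k; have [mF Fk] := Foo k; have [mG Gk] := Goo k.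
have mFG : measurable (F k `*` G k) by exact: measurableX.
split; first by rewrite -[X in measurable X]setTI; exact: measurable_rV_uncons.
rewrite /lebesgue_step/pushforward -comp_preimage (_ : _ \o _ = id).
  by rewrite preimage_id product_measure1E// lte_mul_pinfty// ge0_fin_numE.
by apply/funext => p /=; rewrite rV_consK.
Qed.

HB.instance Definition _ := Measure_isSigmaFinite.Build _ _ _ lebesgue_step
  lebesgue_step_sigma_finite.

End lebesgue_rV_step.

(* Lebesgue measure on R^d, the d-fold product of the one-dimensional one. *)
Fixpoint lebesgue_rV (R : realType) (d : nat) :
    {sigma_finite_measure set 'rV[R]_d -> \bar R} :=
  match d return {sigma_finite_measure set 'rV[R]_d -> \bar R} with
  | 0 => @dirac _ _ (0 : 'rV[R]_0) R
  | d'.+1 => lebesgue_step (lebesgue_rV R d')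
  end.

Section hausdorff_measure.
Local Open Scope ereal_scope.
Variables (R : realType) (d : nat).
Implicit Types (A U : set 'rV[R]_d) (k : nat) (delta : R).

Definition diameter U : \bar R :=
  ereal_sup [set (enorm (p.1 - p.2))%:E | p in U `*` U].

(* The factor 2^-k * |B_1|, with |B_1| the volume of the unit ball of R^k, is
   the standard normalization of the k-dimensional Hausdorff measure.  Since
   x ^+ 0 = 1, the case k = 0 gives the counting measure. *)
Definition hausdorff_gauge k U : \bar R :=
  if U == set0 then 0
  else (2 ^- k)%:E * lebesgue_rV R k (eball 0 1) * diameter U ^+ k.

Definition hausdorff_content k delta A : \bar R :=
  ereal_inf [set \sum_(i <oo) hausdorff_gauge k (U i) |
    U in [set U : (set 'rV[R]_d)^nat |
      A `<=` \bigcup_i U i /\ forall i, diameter (U i) <= delta%:E]].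

(* As a function of all sets this is an outer measure; its restriction to the
   Borel sets, the only sets on which \int[_] evaluates it, is a measure. *)
Definition hausdorff k A : \bar R :=
  ereal_sup [set hausdorff_content k delta A | delta in [set r : R | (0 < r)%R]].

Definition hausdorff_on (E : {vspace 'rV[R]_d}) A : \bar R :=
  hausdorff (\dim E) (A `&` [set x | x \in E]).

End hausdorff_measure.

Section with_density.
Context disp (T : measurableType disp) (R : realType).

(* The measure g * m, for a measure m and a density g : T -> [0, +oo]. *)
Definition with_density (m : set T -> \bar R) (g : T -> \bar R) : set T -> \bar R :=
  fun S => (\int[m]_(x in S) g x)%E.

End with_density.

Section nonlocal_energy.
Local Open Scope ereal_scope.
Variables (R : realType) (d : nat).
Local Notation V := 'rV[R]_d.
Implicit Types (mu : R.-ker V ~> V) (nu : set V -> \bar R) (alpha : R).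

(* Measurability of x |-> mu x T is part of the kernel structure. *)
Definition symmetric_family mu : Prop :=
  forall S T : set V, measurable S -> measurable T ->
    S `*` T `<=` ~` [set p | p.1 = p.2] ->
    \int[lebesgue_rV R d]_(x in S) \int[mu x]_(y in T) 1 =
    \int[lebesgue_rV R d]_(x in T) \int[mu x]_(y in S) 1.

Definition energy (mu : V -> set V -> \bar R) (D : set V) (u : V -> R) : \bar R :=
  \int[lebesgue_rV R d]_(x in D) \int[mu x]_(y in D) ((u y - u x) ^+ 2)%:E.

(* powR is 0 at the base point 0 rather than +oo: this only concerns y = x,
   which is Lebesgue-negligible. *)
Definition mu_frac alpha (x : V) : set V -> \bar R :=
  with_density (lebesgue_rV R d)
    (fun y => ((2 - alpha) * enorm (x - y) `^ (- d%:R - alpha))%:E).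

Definition H_frac alpha (D : set V) (u : V -> R) : Prop :=
  [/\ measurable_fun D u,
      \int[lebesgue_rV R d]_(x in D) (u x ^+ 2)%:E < +oo &
      energy (mu_frac alpha) D u < +oo].

Definition local_comparability mu alpha (A : R) : Prop :=
  forall (rho : R) (x0 : V), (0 < rho < 1)%R -> eball 0 1 x0 ->
  forall v : V -> R, H_frac alpha (eball x0 rho) v ->
    A^-1%:E * energy (fun x => mu x) (eball x0 rho) v <=
      energy (mu_frac alpha) (eball x0 rho) v /\
    energy (mu_frac alpha) (eball x0 rho) v <=
      A%:E * energy (fun x => mu x) (eball x0 rho) v.

Definition cutoff mu alpha (B : R) : Prop :=
  forall (rho r : R) (x0 : V), (0 < rho)%R -> (rho <= r)%R -> (r <= 1)%R ->
  eball 0 1 x0 ->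
  exists tau : V -> R,
    [/\ measurable_fun setT tau /\ (forall x, 0 <= tau x)%R,
        closure [set x | tau x != 0%R] `<=` closure (eball x0 (r + rho)),
        (forall x, eball x0 r x -> tau x = 1%R),
        (forall x, `|tau x| <= 1)%R &
        ereal_sup [set \int[mu x]_y ((tau y - tau x) ^+ 2)%:E | x in setT] <=
          (B * rho `^ (- alpha))%:E].

Definition sandwiched (nu_lo nu_up : set V -> \bar R) mu : Prop :=
  forall f : V * V -> \bar R, measurable_fun setT f -> (forall p, 0 <= f p) ->
  forall x : V,
    \int[nu_lo]_z f (x, (x + z)%R) <= \int[mu x]_y f (x, y) /\
    \int[mu x]_y f (x, y) <= \int[nu_up]_z f (x, (x + z)%R).

Definition upper_bound alpha (C : R) nu : Prop :=
  forall r : R, (0 < r <= 1)%R ->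
    \int[nu]_z (Num.min r (enorm z) ^+ 2)%:E <= (C * r `^ (2 - alpha))%:E.

Definition scaling alpha (a : R) nu : Prop :=
  forall g : V -> \bar R, measurable_fun setT g -> (forall y, 0 <= g y) ->
    closure [set y | g y != 0] `<=` eball 0 1 ->
    \int[nu]_y g y = (a `^ (- alpha))%:E * \int[nu]_y g (a *: y)%R.

(* The exponent alpha0 - alpha is negative off the first branch, so that
   |x|^(alpha0 - alpha) is +oo at x = 0, whereas powR would give 0. *)
Definition interpolated alpha0 alpha nu : set V -> \bar R :=
  if alpha == alpha0 then nu
  else with_density nu (fun x => if x == 0%R then +oo else
    ((2 - alpha) / (2 - alpha0) * enorm x `^ (alpha0 - alpha))%:E).

End nonlocal_energy.

(* Main.v *)
(* On the ball D of radius rho, both energies are integrals of (u x - u y)^2.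
   Let Phi(z) be the integral over x of 1_D(x) 1_D(x+z) (u(x+z) - u(x))^2, so that
   the jumps with law sigma have energy "integral of Phi d sigma".

   Upper bound: averaging (u(x+z) - u(x))^2 over intermediate points p of D within
   |z| of both ends gives
     Phi(z) <= C |z|^-d * (integral of (u x - u y)^2 over |x - y| <= |z|),
   and Tonelli together with the tail bound sigma(|z| > s) <= C s^-alpha concludes.

   Lower bound: in the directions of E_k, a Steinhaus argument for the Hausdorff
   measure on E_k shows that the annulus |z| ~ a^-n contains, for every small h in
   E_k, a fixed proportion of z such that z and z - h both carry mass of
   f_k H_{E_k}; by scaling this holds for all n.  Writing a jump of length a^-n as a
   sum of jumps along the E_k and using parallelogram estimates, the increments
   at all small h in R^d are controlled on a slightly smaller ball, at distance
   eta a^-n from the boundary of D.  Pairs of points of D at distance about a^-n are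
   pushed into that ball at the cost of increments at distance <= 4 eta a^-n inside
   D; after summation over n the latter contribute C eta^alpha times the fractional
   energy itself, which is absorbed for eta small.  All constants depend on alpha
   only through the factor 2 - alpha common to both energies. *)
From HB Require Import structures.
Require Import Defs.
From mathcomp Require Import all_boot all_order all_algebra.
From mathcomp Require Import all_classical all_reals all_analysis.
From mathcomp Require Import measurable_realfun.
From mathcomp Require Import ring lra.

Set Implicit Arguments.
Unset Strict Implicit.
Unset Printing Implicit Defensive.

Import Order.TTheory GRing.Theory Num.Theory.
Import numFieldNormedType.Exports.

Local Open Scope classical_set_scope.
Local Open Scope ring_scope.

(** * Lebesgue measure on R^d *)

(** The boundary of D is the obstacle in the lower bound: a broken path of jumps along the [E_k] may
    leave D although both ends lie in it, so increments are controlled only at a depth proportional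
    to the jump length. Working at the finer scale n + j0 makes that depth a small fraction of a^-n,
    and convexity of the ball allows a displacement of size a^-n to be halved j times until it fits
    the finer scale. Pushing a pair inwards costs eta^-d in volume, while summing the kernel over
    the scales that see a given short increment gives eta^(d + alpha): hence the surviving power
    eta^alpha. Absorption is a subtraction, legitimate because membership in H^(alpha/2) makes the
    fractional energy finite. Uniformity in alpha rests on two facts: the geometric sums have ratio
    a^(d + alpha) >= a, and the interpolation weight is radially decreasing, so it is compared with
    its value at the edge of a tail or of an annulus. Tonelli requires sigma-finite jump measures;
    these are obtained by giving the origin weight 0, which is harmless because the increment at z =
    0 vanishes. *)

Section lebesgue_line.
Variable R : realType.
Local Notation mu := (@lebesgue_measure R).

Let affine (r s : R) : measurableTypeR R -> measurableTypeR R :=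
  fun t => r * t + s.

Let measurable_affine r s : measurable_fun setT (affine r s).
Proof. by apply: measurable_funD => //; exact: mulrl_measurable. Qed.

Lemma ge0_integral_affine (r s : R) (f : R -> \bar R) :
  0 < r -> measurable_fun setT f -> (forall t, (0 <= f t)%E) ->
  (\int[mu]_t f t = r%:E * \int[mu]_t f (r * t + s)%R)%E.
Proof.
move=> r0 mf f0.
pose k : {nonneg R} := NngNum (ltW r0).
pose nu : {measure set (measurableTypeR R) -> \bar R} :=
  mscale k (measure_function_pushforward__canonical__measure_function_Measure
    mu (measurable_affine r s)).
(* The rescaled pushforward agrees with Lebesgue measure on half-open intervals, hence on all Borel
   sets. *)
transitivity (\int[nu]_t f t)%E.
  apply: eq_measure_integral => A mA _.
  apply: lebesgue_measure_unique => // _ [[a b]] _ <-.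
  rewrite [RHS](_ : _ = r%:E * mu (affine r s @^-1` `]a, b]))%E//.
  have -> : affine r s @^-1` `]a, b] = `](a - s) / r, (b - s) / r]%classic.
    apply/seteqP; split => t /=; rewrite !in_itv /affine /=
      ltr_pdivrMr// ler_pdivlMr// ltrBlDr lerBrDr mulrC//.
  rewrite !lebesgue_measure_itv/= !lte_fin ltr_pM2r ?invr_gt0// ltrD2r.
  case: ifPn => _; last by rewrite mule0.
  rewrite -!EFinD -EFinM; congr EFin; field; exact: lt0r_neq0.
rewrite ge0_integral_mscale//= ge0_integral_pushforward//.
Qed.

End lebesgue_line.

Section lebesgue_space.
Variable R : realType.
Local Notation lam d := (lebesgue_rV R d).
Local Open Scope ereal_scope.

Lemma measurable_affine_rV d (r : R) (h : 'rV[R]_d) :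
  measurable_fun setT (fun x : 'rV[R]_d => r *: x + h)%R.
Proof.
apply: measurable_fun_rV => i.
rewrite [X in measurable_fun _ X](_ : _ =
   (fun x : 'rV[R]_d => r * x ord0 i + h ord0 i)%R); last first.
  by apply/funext => x; rewrite !mxE.
apply: measurable_funD => //; apply: measurable_funM => //.
exact: measurable_coord.
Qed.

Lemma ge0_integral_lebesgue_recl d (f : 'rV[R]_d.+1 -> \bar R) :
  measurable_fun setT f -> (forall x, 0 <= f x) ->
  \int[lam d.+1]_x f x =
  \int[lebesgue_measure]_t \int[lam d]_y f (rV_cons (t, y)).
Proof.
move=> mf f0; rewrite [LHS]ge0_integral_pushforward//=; last first.
  exact: measurable_rV_cons.
by rewrite fubini_tonelli1//; apply: measurableT_comp => //;
  exact: measurable_rV_cons.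
Qed.

Lemma ge0_integral_affine_rV d (r : R) (h : 'rV[R]_d) (f : 'rV[R]_d -> \bar R) :
  (0 < r)%R -> measurable_fun setT f -> (forall x, 0 <= f x) ->
  \int[lam d]_x f x = (r ^+ d)%:E * \int[lam d]_x f (r *: x + h)%R.
Proof.
move=> r0; elim: d => [|d ih] in h f * => mf f0.
  rewrite expr0 mul1e; apply: eq_integral => x _; congr f.
  by apply/rowP => -[].
have mg (g : 'rV[R]_d.+1 -> \bar R) : measurable_fun setT g ->
    measurable_fun setT (g \o @rV_cons R d).
  by move=> mg; apply: measurableT_comp => //; exact: measurable_rV_cons.
rewrite ge0_integral_lebesgue_recl// ge0_integral_lebesgue_recl//; last first.
  by apply: (measurableT_comp mf); exact: measurable_affine_rV.
pose F (t : R) := \int[lam d]_y f (rV_cons (t, y)).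
have mF : measurable_fun setT F.
  by apply: (measurable_fun_fubini_tonelli_F (f \o @rV_cons R d)) => //;
    [exact: (mg _ mf)|move=> ?; exact: f0].
have F0 t : 0 <= F t by exact: integral_ge0.
rewrite -/F; have -> := ge0_integral_affine (h ord0 ord0) r0 mF F0.
pose h' : 'rV[R]_d := \row_i h ord0 (lift ord0 i).
have rdE t y : (r *: rV_cons (t, y) + h = rV_cons (r * t + h ord0 ord0, r *: y + h'))%R.
  apply/rowP => i; rewrite /rV_cons !mxE.
  case: (@splitP 1 d i) => j ij /=.
    have -> : i = ord0 by apply/val_inj; rewrite /= ij (ord1 j).
    by rewrite (ord1 j) !mxE eqxx.
  rewrite !mxE; congr (_ + h _ _)%R; apply/val_inj => /=.
  by rewrite ij /bump leq0n.
have mfc t : measurable_fun setT (fun y : 'rV[R]_d => f (rV_cons (t, y))).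
  by apply: (measurableT_comp (mg _ mf)); exact: pair1_measurable.
have -> : \int[lebesgue_measure]_t F (r * t + h ord0 ord0)%R =
    \int[lebesgue_measure]_t ((r ^+ d)%:E *
      \int[lam d]_y f (r *: rV_cons (t, y) + h)%R).
  apply: eq_integral => t _; rewrite /F (ih h')//.
  by congr (_ * _); apply: eq_integral => y _; rewrite rdE.
rewrite ge0_integralZl//.
- by rewrite muleA -EFinM -exprS.
- apply: (measurable_fun_fubini_tonelli_F
    ((fun x => f (r *: x + h)%R) \o @rV_cons R d)) => //; last first.
    by move=> ?; exact: f0.
  by apply: mg; apply: (measurableT_comp mf); exact: measurable_affine_rV.
- by move=> t _; apply: integral_ge0.
- by rewrite lee_fin exprn_ge0// ltW.
Qed.

Lemma ge0_integral_translate d (h : 'rV[R]_d) (f : 'rV[R]_d -> \bar R) :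
  measurable_fun setT f -> (forall x, 0 <= f x) ->
  \int[lam d]_x f (x + h)%R = \int[lam d]_x f x.
Proof.
move=> mf f0; rewrite [RHS](@ge0_integral_affine_rV _ 1 h)// expr1n mul1e.
by apply: eq_integral => x _; rewrite scale1r.
Qed.

(** Boxes have an explicit product volume; one lies inside the Euclidean unit ball and one contains
    it, so the volume of the ball is positive and finite. *)
Definition sup_box d (e : R) : set 'rV[R]_d :=
  [set x | forall i, (`|x ord0 i| < e)%R].

Lemma measurable_sup_box d (e : R) : measurable (@sup_box d e).
Proof.
rewrite (_ : sup_box e = \bigcap_(i in [set: 'I_d])
    (fun x : 'rV[R]_d => x ord0 i) @^-1` [set t | (`|t| < e)%R]); last first.
  by apply/seteqP; split => x /= H i; [move=> _; exact: H|exact: (H i)].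
apply: fin_bigcap_measurable => // i _; rewrite -[X in measurable X]setTI.
apply: measurable_coord => //.
rewrite (_ : [set t | _] = ball (0%R : R) e); first exact: measurable_ball.
by apply/seteqP; split => t; rewrite /ball/= sub0r normrN.
Qed.

Lemma lebesgue_sup_box d (e : R) : (0 < e)%R ->
  lam d (@sup_box d e) = ((e *+ 2) ^+ d)%:E.
Proof.
move=> e0; elim: d => [|d ih].
  by rewrite expr0 /= /dirac indicE mem_set// => -[].
rewrite [LHS](_ : _ = (lebesgue_measure \x lam d) (@rV_cons R d @^-1` (@sup_box d.+1 e)))//.
have -> : @rV_cons R d @^-1` (@sup_box d.+1 e) =
    [set t | (`|t| < e)%R] `*` @sup_box d e.
  apply/seteqP; split=> [[t y] /= H|[t y] [/= H1 H2] i].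
    split=> [|i].
      have := H (lshift d (ord0 : 'I_1)).
      by rewrite (@row_mxEl R 1 1 d) mxE eqxx.
    by have := H (rshift 1 i); rewrite (@row_mxEr R 1 1 d).
  rewrite /rV_cons mxE; case: (@splitP 1 d i) => j ij; last exact: H2.
  by rewrite (ord1 j) mxE eqxx.
have E : [set t : R | (`|t| < e)%R] = `]-e, e[%classic%R.
  by apply/seteqP; split => t /=; rewrite in_itv/= ltr_norml.
rewrite product_measure1E ?ih//; last 2 first.
- by rewrite E.
- exact: measurable_sup_box.
rewrite E [X in X * _](_ : _ = lebesgue_measure `](- e)%R, e[%classic)// lebesgue_measure_itv/= lte_fin; rewrite ifT; last first.
  by rewrite -subr_gt0 opprK addr_gt0.
by rewrite -EFinB -EFinM opprK exprS mulr2n.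
Qed.

End lebesgue_space.

(** * Euclidean norm, and its equivalence with the sup norm *)

Section euclidean_norm.
Variables (R : realType) (d : nat).
Implicit Types x y z : 'rV[R]_d.

Lemma enorm_sqr x : enorm x ^+ 2 = \sum_(i < d) x ord0 i ^+ 2.
Proof. by rewrite /enorm sqr_sqrtr// sumr_ge0// => i _; exact: sqr_ge0. Qed.

Lemma enorm_ge0 x : 0 <= enorm x.
Proof. exact: sqrtr_ge0. Qed.

Lemma enorm0 : enorm (0 : 'rV[R]_d) = 0.
Proof.
rewrite /enorm big1 ?sqrtr0// => i _; by rewrite mxE expr0n.
Qed.

Lemma enormZ (c : R) x : enorm (c *: x) = `|c| * enorm x.
Proof.
rewrite /enorm -sqrtr_sqr -sqrtrM ?sqr_ge0//; congr Num.sqrt.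
by rewrite mulr_sumr; apply: eq_bigr => i _; rewrite mxE exprMn.
Qed.

Lemma enormN x : enorm (- x) = enorm x.
Proof. by rewrite -scaleN1r enormZ normrN1 mul1r. Qed.

Lemma enormC x y : enorm (x - y) = enorm (y - x).
Proof. by rewrite -enormN opprB. Qed.

Lemma coord_le_enorm x i : `|x ord0 i| <= enorm x.
Proof.
rewrite -(@ler_pXn2r _ 2)// ?nnegrE ?enorm_ge0// enorm_sqr -normrX.
rewrite ger0_norm ?sqr_ge0// (bigD1 i)//= lerDl sumr_ge0// => j _.
exact: sqr_ge0.
Qed.

Lemma enorm_eq0 x : (enorm x == 0) = (x == 0).
Proof.
apply/eqP/eqP => [x0|->]; last exact: enorm0.
apply/rowP => i; rewrite mxE; apply/eqP.
by rewrite -normr_le0 -x0 coord_le_enorm.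
Qed.

Lemma enorm_gt0 x : (0 < enorm x) = (x != 0).
Proof. by rewrite lt_def enorm_ge0 andbT enorm_eq0. Qed.

Lemma enormD x y : enorm (x + y) <= enorm x + enorm y.
Proof.
have [->|x0] := eqVneq x 0; first by rewrite enorm0 !add0r.
have [->|y0] := eqVneq y 0; first by rewrite enorm0 !addr0.
have a0 : 0 < enorm x by rewrite enorm_gt0.
have b0 : 0 < enorm y by rewrite enorm_gt0.
rewrite -(@ler_pXn2r _ 2)// ?nnegrE ?addr_ge0 ?enorm_ge0// enorm_sqr.
set a := enorm x in a0 *; set b := enorm y in b0 *.
(* Young's inequality with weights b/a and a/b takes the place of Cauchy-Schwarz: summed over i, the
   right-hand side is exactly (a + b)^2. *)
have H i : (x + y) ord0 i ^+ 2 <=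
    (1 + b / a) * x ord0 i ^+ 2 + (1 + a / b) * y ord0 i ^+ 2.
  rewrite mxE; set s := x _ _; set t := y _ _.
  rewrite -subr_ge0 (_ : _ - _ = (a * b)^-1 * (b * s - a * t) ^+ 2).
    by rewrite mulr_ge0// ?sqr_ge0// invr_ge0 mulr_ge0// ltW.
  by field; rewrite !lt0r_neq0.
apply: (le_trans (ler_sum _ (fun i _ => H i))).
rewrite big_split/= -!mulr_sumr -!enorm_sqr -/a -/b le_eqVlt; apply/orP; left.
apply/eqP; field; by rewrite !lt0r_neq0.
Qed.

Lemma enorm_triangle y x z : enorm (x - z) <= enorm (x - y) + enorm (y - z).
Proof. by rewrite -(subrKA y); exact: enormD. Qed.

Lemma enorm_distB x y : `|enorm x - enorm y| <= enorm (x - y).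
Proof.
have H (u v : 'rV[R]_d) : enorm u - enorm v <= enorm (u - v).
  by rewrite lerBlDr -{1}(subrK v u); exact: enormD.
by rewrite ler_norml H andbT lerNl opprB enormC H.
Qed.

Lemma enorm_le_sum x : enorm x <= \sum_(i < d) `|x ord0 i|.
Proof.
rewrite {1}(row_sum_delta x).
apply: (@big_ind2 _ _ (fun (u : 'rV[R]_d) (t : R) => enorm u <= t)).
- by rewrite enorm0.
- by move=> u1 t1 u2 t2 h1 h2; rewrite (le_trans (enormD _ _))// lerD.
move=> i _; rewrite enormZ ler_piMr// /enorm (bigD1 i)//= big1 ?addr0.
  by rewrite mxE !eqxx expr1n sqrtr1.
by move=> j /negbTE ji; rewrite mxE ji andbF expr0n.
Qed.

Lemma enorm_le_mx_norm x : enorm x <= d%:R * `|x|.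
Proof.
apply: (le_trans (enorm_le_sum x)).
rewrite mulr_natl -[X in _ *+ X](card_ord d) -sumr_const ler_sum// => i _.
by rewrite [`|x|]/Num.norm/= mx_normrE (le_bigmax _ _ (ord0, i)).
Qed.

Lemma mx_norm_le_enorm x : `|x| <= enorm x.
Proof.
rewrite [`|x|]/Num.norm/= mx_normrE; apply: bigmax_le; first exact: enorm_ge0.
by move=> [i j] _ /=; rewrite (ord1 i) coord_le_enorm.
Qed.

Lemma continuous_enormB x0 : continuous (fun x => enorm (x - x0)).
Proof.
move=> x A /nbhs_ballP[e /= e0 eA].
apply/nbhs_ballP; exists (e / d.+1%:R); first by rewrite /= divr_gt0.
move=> y; rewrite mx_norm_ball /ball_ /= => xy; apply: eA; rewrite /ball/=.
apply: (le_lt_trans (enorm_distB _ _)); rewrite opprB addrA subrK.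
apply: (le_lt_trans (enorm_le_mx_norm _)).
apply: (@le_lt_trans _ _ (d.+1%:R * `|x - y|)); first by rewrite ler_wpM2r// ler_nat.
by rewrite mulrC -ltr_pdivlMr.
Qed.

Lemma continuous_enorm : continuous (@enorm R d).
Proof.
rewrite (_ : @enorm R d = fun x => enorm (x - 0)); first exact: continuous_enormB.
by apply/funext => x; rewrite subr0.
Qed.

Lemma measurable_open_rV (A : set 'rV[R]_d) : open A -> measurable A.
Proof. by move=> oA; exact: sub_sigma_algebra. Qed.

Lemma measurable_closed_rV (A : set 'rV[R]_d) : closed A -> measurable A.
Proof.
move=> cA; rewrite -(setCK A); apply: measurableC; apply: measurable_open_rV.
exact: closed_openC.
Qed.

Lemma measurable_enorm : measurable_fun setT (@enorm R d).
Proof.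
apply: (@measurability _ _ _ _ _ _ (@RGenOpens.G R)).
  exact: RGenOpens.measurableE.
move=> _ [_ [a [b ->]] <-]; rewrite setTI; apply: measurable_open_rV.
apply: open_comp; last exact: interval_open.
move=> x _; exact: continuous_enorm.
Qed.

Lemma open_eball x r : open (eball x r).
Proof.
rewrite (_ : eball x r = (fun y => enorm (y - x)) @^-1` `]-oo, r[).
  by apply: open_comp => // y _; exact: continuous_enormB.
by apply/seteqP; split => y /=; rewrite in_itv.
Qed.

Lemma measurable_eball x r : measurable (eball x r).
Proof. by apply: measurable_open_rV; exact: open_eball. Qed.

Lemma closed_eball_sep (K : set 'rV[R]_d) x : closed K -> ~ K x ->
  exists2 e : R, 0 < e & forall y, K y -> e <= enorm (y - x).
Proof.
move=> cK Kx; have /nbhs_ballP[e /= e0 xeK] : nbhs x (~` K).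
  by have oK := closed_openC cK; rewrite openE in oK; exact: oK.
exists e => // y Ky; rewrite leNgt; apply/negP => yx.
suff : (~` K) y by [].
apply: xeK.
rewrite mx_norm_ball /ball_ /=.
by rewrite (le_lt_trans (mx_norm_le_enorm _))// enormC.
Qed.

End euclidean_norm.

(** * Volume of Euclidean balls *)

Section ball_volume.
Variables (R : realType).
Local Notation lam d := (lebesgue_rV R d).

Definition ball_volume d : R := fine (lam d (eball 0 1)).

Lemma ball_volume_bounds d :
  (((2 / d.+1%:R) ^+ d)%:E <= lam d (eball 0 1) < +oo)%E.
Proof.
have e0 : 0 < d.+1%:R^-1 :> R by rewrite invr_gt0.
apply/andP; split.
  have -> : (2 / d.+1%:R) ^+ d = ((d.+1%:R^-1) *+ 2) ^+ d :> R.
    by congr (_ ^+ _); rewrite mulr_natl.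
  rewrite -lebesgue_sup_box//; apply: le_measure; rewrite ?inE//.
  - exact: measurable_sup_box.
  - exact: measurable_eball.
  - move=> x /= Hx; rewrite /eball /= subr0 (le_lt_trans (enorm_le_sum x))//.
    (* Half-side 1/(d+1) instead of 1/d keeps d = 0 meaningful and makes the final bound d/(d+1) < 1
       strict. *)
    apply: (@le_lt_trans _ _ (\sum_(i < d) d.+1%:R^-1)).
      by apply: ler_sum => i _; exact: ltW.
    rewrite sumr_const card_ord -[X in X < _]mulr_natr mulrC.
    by rewrite ltr_pdivrMr// mul1r ltr_nat.
apply: (@le_lt_trans _ _ (lam d (@sup_box R d 1))).
  apply: le_measure; rewrite ?inE//.
  - exact: measurable_eball.
  - exact: measurable_sup_box.
  - move=> x; rewrite /eball /= subr0 => x1 i.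
    exact: le_lt_trans (coord_le_enorm _ _) x1.
by rewrite lebesgue_sup_box// ltry.
Qed.

Lemma ball_volumeE d : lam d (eball 0 1) = (ball_volume d)%:E.
Proof.
have /andP[_ h] := ball_volume_bounds d.
by rewrite /ball_volume fineK// ge0_fin_numE.
Qed.

Lemma ball_volume_gt0 d : 0 < ball_volume d.
Proof.
rewrite -lte_fin -ball_volumeE; have /andP[+ _] := ball_volume_bounds d.
by apply: lt_le_trans; rewrite lte_fin exprn_gt0// divr_gt0.
Qed.

Lemma lebesgue_eball d (x : 'rV[R]_d) r : 0 < r ->
  lam d (eball x r) = (ball_volume d * r ^+ d)%:E.
Proof.
move=> r0; have mB y s : measurable (@eball R d y s) by exact: measurable_eball.
rewrite -[eball x r]setIT -(integral_indic _ measurableT)//.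
rewrite (@ge0_integral_affine_rV _ _ r x)//; last first.
  by apply/measurable_EFinP; exact: measurable_indic.
rewrite mulrC EFinM -ball_volumeE; congr (_ * _)%E.
rewrite -[eball 0 1]setIT -(integral_indic _ measurableT)//.
apply: eq_integral => y _; congr (_%:E); rewrite !indicE; congr (nat_of_bool _)%:R.
have E : eball x r (r *: y + x) = eball 0 1 y.
  apply/propext; rewrite /eball/= addrK subr0 enormZ gtr0_norm//.
  by rewrite -[X in _ < X <-> _]mulr1 ltr_pM2l.
by apply/idP/idP => /set_mem => [|]; [rewrite E|rewrite -E] => /mem_set.
Qed.

End ball_volume.

(** * Integrals against densities *)

(** For y = +oo both sides are +oo as soon as some [u n] is positive, and both are 0 otherwise. This
    case occurs because densities may take the value +oo. *)
Lemma ereal_limMl_nondecreasing (R : realType) (y : \bar R) (u : (\bar R)^nat) :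
  (0 <= y)%E -> (forall n, 0 <= u n)%E -> nondecreasing_seq u ->
  (limn (fun n => y * u n) = y * limn u)%E.
Proof.
move=> y0 u0 ndu; have [yfin|] := boolP (y \is a fin_num).
  by rewrite limeMl//; exact: ereal_nondecreasing_is_cvgn.
case: y y0 => // _ _.
have ndyu : nondecreasing_seq (fun n => +oo * u n)%E.
  by move=> i j ij; rewrite lee_wpmul2l//; exact: ndu.
rewrite (cvg_lim _ (ereal_nondecreasing_cvgn ndyu))//.
rewrite (cvg_lim _ (ereal_nondecreasing_cvgn ndu))//.
have [[n un]|/forallNP un] := pselect (exists n, 0 < u n)%E.
  rewrite gt0_mulye; last first.
    by apply: (lt_le_trans un); apply: ereal_sup_ubound; exists n.
  apply/eqP; rewrite -leye_eq -[leLHS](gt0_mulye un).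
  by apply: ereal_sup_ubound; exists n.
have {}un n : u n = 0%E.
  by apply/eqP; rewrite eq_le u0 andbT leNgt; apply/negP/un.
have E (v : (\bar R)^nat) : (forall n, v n = 0%E) -> ereal_sup (range v) = 0%E.
  move=> v0; rewrite (_ : range v = [set 0%E]) ?ereal_sup1//.
  by apply/seteqP; split => [_ [n _ <-]|_ ->]; [rewrite v0|exists 0%N].
by rewrite !E ?mule0// => n; rewrite un mule0.
Qed.

Section integral_complements.
Context d (T : measurableType d) (R : realType).
Variable m : {measure set T -> \bar R}.
Local Open Scope ereal_scope.
Import HBNNSimple.

(* Unlike [ge0_le_integral], no measurability is required: the integral of a
   nonnegative function is a supremum over the simple functions below it. *)
Lemma ge0_le_integral_pointwise (D : set T) (f g : T -> \bar R) :
  (forall x, D x -> 0 <= f x) -> (forall x, D x -> f x <= g x) ->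
  \int[m]_(x in D) f x <= \int[m]_(x in D) g x.
Proof.
move=> f0 fg; rewrite !ge0_integralE//; last first.
  by move=> x Dx; apply: le_trans (fg _ Dx); exact: f0.
apply: le_ereal_sup => _ [h hf <-]; exists h => // x.
by apply: (le_trans (hf x)); exact: lee_restrict.
Qed.

(** The proofs [mg] and [g0] are carried as arguments so that a measure structure can be attached to
    [with_density m g]. *)
Definition density_measure (g : T -> \bar R) (mg : measurable_fun setT g)
  (g0 : forall x, 0 <= g x) : set T -> \bar R := with_density m g.

Section density.
Variables (g : T -> \bar R) (mg : measurable_fun setT g).
Hypothesis g0 : forall x, 0 <= g x.
Local Notation gm := (density_measure mg g0).

Let density0 : gm set0 = 0.
Proof. by rewrite /density_measure/with_density integral_set0. Qed.

Let density_ge0 A : 0 <= gm A.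
Proof. exact: integral_ge0. Qed.

Let density_sigma_additive : semi_sigma_additive gm.
Proof.
move=> F mF tF mUF; rewrite /density_measure/with_density.
rewrite ge0_integral_bigcup//; last exact: measurable_funTS.
by apply: is_cvg_ereal_nneg_natsum_cond => n _ _; exact: integral_ge0.
Qed.

HB.instance Definition _ := isMeasure.Build _ _ _ gm
  density0 density_ge0 density_sigma_additive.

(** Both sides are monotone limits along simple functions; for these, linearity reduces the identity
    to indicators, where it is the definition of the density. *)
Lemma ge0_integral_density_measure (f : T -> \bar R) :
  measurable_fun setT f -> (forall x, 0 <= f x) ->
  \int[gm]_x f x = \int[m]_x (g x * f x).
Proof.
move=> mf f0; pose f_ := nnsfun_approx measurableT mf.
have Ef x : f x = limn (fun n => (f_ n x)%:E).
  by apply/esym/cvg_lim => //; exact: cvg_nnsfun_approx.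
have ndf x (i j : nat) : (i <= j)%N -> (f_ i x)%:E <= (f_ j x)%:E.
  by move=> ij; rewrite lee_fin; exact/lefP/nd_nnsfun_approx.
have mf_ n : measurable_fun setT (fun x => (f_ n x)%:E).
  exact/measurable_EFinP/measurable_funTS.
transitivity (limn (fun n => \int[gm]_x (f_ n x)%:E)).
  rewrite -monotone_convergence//.
  - by apply: eq_integral => x _; rewrite Ef.
  - by move=> n x _; rewrite lee_fin.
  - by move=> x _ i j; exact: ndf.
transitivity (limn (fun n => \int[m]_x (g x * (f_ n x)%:E))); last first.
  rewrite -monotone_convergence//.
  - apply: eq_integral => x _; rewrite ereal_limMl_nondecreasing// -?Ef//.
    by move=> n; rewrite lee_fin.
    by move=> i j; exact: ndf.
  - by move=> n; exact: emeasurable_funM.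
  - by move=> n x _; rewrite mule_ge0// lee_fin.
  - by move=> x _ i j ij; rewrite lee_wpmul2l// ndf.
congr (limn _); apply/funext => n.
under [LHS]eq_integral do rewrite fimfunE -fsumEFin//.
rewrite ge0_integral_fsum//; last 2 first.
- by move=> r; exact/measurable_EFinP/measurable_funM.
- by move=> r x _; rewrite EFinM nnfun_muleindic_ge0.
under [RHS]eq_integral.
  move=> x _; rewrite fimfunE -fsumEFin// ge0_mule_fsumr; last first.
    by move=> r; rewrite EFinM nnfun_muleindic_ge0.
  over.
rewrite ge0_integral_fsum//; last 2 first.
- move=> r; apply: emeasurable_funM => //.
  exact/measurable_EFinP/measurable_funM.
- by move=> r x _; rewrite mule_ge0// EFinM nnfun_muleindic_ge0.
apply: eq_fsbigr => r _; rewrite integralZl_indic_nnsfun//.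
have [r0|r0] := ltP r 0%R.
  rewrite preimage_nnfun0//.
  rewrite integral0_eq ?mule0; last by move=> x _; rewrite indicE in_set0.
  by rewrite integral0_eq// => x _; rewrite indicE in_set0 mulr0 mule0.
rewrite integral_indic// setIT.
under [RHS]eq_integral do rewrite EFinM muleCA.
rewrite ge0_integralZl//; last 2 first.
- by apply: emeasurable_funM => //; exact/measurable_EFinP.
- by move=> x _; rewrite mule_ge0// lee_fin.
congr (_ * _); rewrite /density_measure/with_density [LHS]integral_mkcond.
apply: eq_integral => x _; rewrite /patch indicE.
by case: ifPn => _; rewrite ?mule1 ?mule0.
Qed.

End density.

Lemma ge0_integral_with_density (g f : T -> \bar R) (D : set T) :
  measurable_fun setT g -> (forall x, 0 <= g x) -> measurable D ->
  measurable_fun D f -> (forall x, D x -> 0 <= f x) ->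
  \int[with_density m g]_(x in D) f x = \int[m]_(x in D) (g x * f x).
Proof.
move=> mg g0 mD mf f0.
pose gm : {measure set T -> \bar R} := density_measure mg g0.
rewrite -[LHS]/(\int[gm]_(x in D) f x) integral_mkcond.
rewrite /gm ge0_integral_density_measure//; last 2 first.
- exact/(measurable_restrictT _ mD).1.
- by move=> x; exact: erestrict_ge0.
rewrite [RHS]integral_mkcond; apply: eq_integral => x _; rewrite /patch.
by case: ifPn; rewrite ?mule0.
Qed.

End integral_complements.

Section sigma_finite_pack.
Context d (T : measurableType d) (R : realType).
Variables (m : {measure set T -> \bar R}) (sm : sigma_finite setT m).

(** A copy of [m] indexed by the proof of its sigma-finiteness, on which the corresponding structure
    can be declared. *)
Definition sigma_finite_copy of sigma_finite setT m : set T -> \bar R := m.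

HB.instance Definition _ := Measure.copy (sigma_finite_copy sm) m.
HB.instance Definition _ := Measure_isSigmaFinite.Build _ _ _
  (sigma_finite_copy sm) sm.

Definition sigma_finite_pack : {sigma_finite_measure set T -> \bar R} :=
  sigma_finite_copy sm.

End sigma_finite_pack.

(** * Hausdorff measure *)

Section borel_induction.
Variables (R : realType) (d : nat) (G : set (set 'rV[R]_d)).
Hypothesis sG : sigma_algebra setT G.
Hypothesis halfG : forall i c, G [set x | x ord0 i < c].

(** An open set is a countable union of rational boxes, and a box is a finite intersection of
    half-spaces; those of the form c < x_i are countable unions of complements of the given ones. *)
Lemma borel_rV_ind A : measurable A -> G A.
Proof.
rewrite [X in X A -> _](_ : _ = <<s (@open 'rV[R]_d) >>)//.
apply: smallest_sub => // O oO; rewrite -(sigma_algebra_id sG).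
pose T := g_sigma_algebraType G.
have mhalf i c : measurable ([set x | x ord0 i < c] : set T).
  exact: sub_sigma_algebra.
have mhalf' i c : measurable ([set x | c < x ord0 i] : set T).
  rewrite (_ : [set x | _] = \bigcup_n ~` [set x | x ord0 i < c + n.+1%:R^-1]).
    by apply: bigcupT_measurable => n; exact: measurableC.
  apply/seteqP; split => [x /= cx|x [n _ /= /negP]]; last first.
    by rewrite -leNgt; apply: lt_le_trans; rewrite ltrDl invr_gt0.
  have xc0 : 0 < x ord0 i - c by rewrite subr_gt0.
  have /= [N _ HN] := @near_infty_natSinv_lt R (PosNum xc0).
  exists N => //=; apply/negP; rewrite -leNgt -lerBrDl.
  exact/ltW/(HN N (leqnn N)).
suff : measurable (O : set T) by [].
rewrite (open_bigcup_box oO).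
rewrite bigcup_mkcond; apply: countable_bigcupT_measurable => // -[q k].
case: ifPn => // _.
rewrite (_ : rat_box _ _ = \bigcap_(i in [set: 'I_d])
  ([set x | x ord0 i < ratr (q ord0 i) + k.+1%:R^-1] `&`
   [set x | ratr (q ord0 i) - k.+1%:R^-1 < x ord0 i])); last first.
  apply/seteqP; split => x /= Hx i.
    move=> _; have := Hx i; rewrite ltr_norml => /andP[h1 h2].
    split => /=; last by rewrite ltrBlDr addrC -ltrBlDr.
    by move: h1; rewrite ltrBrDr addrC ltrBlDr.
  have [/= h1 h2] := Hx i Logic.I; rewrite ltr_norml.
  by rewrite ltrBrDr addrC ltrBlDr h1 ltrBlDr addrC -ltrBlDr h2.
by apply: fin_bigcap_measurable => // i _; exact: measurableI.
Qed.

End borel_induction.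

(* The power set as sigma-algebra turns the Hausdorff content into an instance
   of the library's outer extension [mu_ext] of a set function. *)
Definition powerset_rV (R : realType) (d : nat) : Type := 'rV[R]_d.
HB.instance Definition _ R d := Pointed.on (@powerset_rV R d).
HB.instance Definition _ R d := @isMeasurable.Build default_measure_display
  (@powerset_rV R d) setT Logic.I (fun _ _ => Logic.I) (fun _ _ => Logic.I).

Section hausdorff_outer.
Local Open Scope ereal_scope.
Variables (R : realType) (d : nat).
Local Notation V := 'rV[R]_d.
Implicit Types (A B U : set V) (k : nat) (delta : R).

Lemma enorm_le_diameter U x y : U x -> U y -> (enorm (x - y))%:E <= diameter U.
Proof. by move=> Ux Uy; apply: ereal_sup_ubound; exists (x, y). Qed.

Lemma diameter_ge0 U : U !=set0 -> 0 <= diameter U.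
Proof.
by move=> [x Ux]; rewrite (le_trans _ (enorm_le_diameter Ux Ux))// lee_fin enorm_ge0.
Qed.

Lemma diameter0 : diameter (set0 : set V) = -oo.
Proof.
rewrite /diameter [X in ereal_sup X](_ : _ = set0) ?ereal_sup0//.
by apply/seteqP; split => // _ [[x y] [[]]].
Qed.

Lemma hausdorff_gauge0 k : hausdorff_gauge k (set0 : set V) = 0.
Proof. by rewrite /hausdorff_gauge eqxx. Qed.

Lemma hausdorff_gauge_ge0 k U : 0 <= hausdorff_gauge k U.
Proof.
rewrite /hausdorff_gauge; case: ifPn => // /set0P U0.
by rewrite !mule_ge0// ?lee_fin ?invr_ge0 ?exprn_ge0// expe_ge0// diameter_ge0.
Qed.

(** The constraint on diameters becomes the value +oo on sets that are too large, so that the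
    infimum ranges over all coverings, as in [mu_ext]. *)
Let trunc_gauge k delta (U : set (powerset_rV R d)) : \bar R :=
  if diameter (U : set V) <= delta%:E then hausdorff_gauge k (U : set V) else +oo.

Let trunc_gauge_ge0 k delta U : 0 <= trunc_gauge k delta U.
Proof. by rewrite /trunc_gauge; case: ifP => // _; exact: hausdorff_gauge_ge0. Qed.

Let hausdorff_contentE k delta A :
  hausdorff_content k delta A = mu_ext (trunc_gauge k delta) A.
Proof.
apply/eqP; rewrite eq_le; apply/andP; split; last first.
  apply: ereal_inf_le_tmp => _ [U [AU dU] <-]; exists U; first by split.
  by apply: eq_eseriesr => i _; rewrite /trunc_gauge dU.
apply: le_ereal_inf_tmp => _ [U [_ AU] <-].
have [dU|/existsNP[i /negP dUi]] := pselect (forall i, diameter (U i) <= delta%:E).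
  apply: ereal_inf_lbound; exists U; first by split.
  by apply: eq_eseriesr => i _; rewrite /trunc_gauge dU.
rewrite (_ : \sum_(_ <oo) _ = +oo) ?leey//.
apply: (@eseries_pinfty _ _ xpredT i) => //.
- by move=> n _; rewrite gt_eqF// (lt_le_trans _ (trunc_gauge_ge0 _ _ _)).
- by rewrite /trunc_gauge (negbTE dUi).
Qed.

Lemma hausdorff_content_ge0 k delta A : 0 <= hausdorff_content k delta A.
Proof. by rewrite hausdorff_contentE; apply: mu_ext_ge0. Qed.

Lemma le_hausdorff_content k delta A B :
  A `<=` B -> hausdorff_content k delta A <= hausdorff_content k delta B.
Proof. by move=> AB; rewrite !hausdorff_contentE; exact: le_mu_ext. Qed.

Lemma hausdorff_content0 k delta : hausdorff_content k delta (set0 : set V) = 0.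
Proof.
rewrite hausdorff_contentE; apply: mu_ext0 => //.
by rewrite /trunc_gauge diameter0 leNye hausdorff_gauge0.
Qed.

Lemma hausdorff_content_sigma_subadditive k delta :
  sigma_subadditive (@hausdorff_content R d k delta).
Proof.
move=> F; rewrite hausdorff_contentE.
under eq_eseriesr do rewrite hausdorff_contentE.
by apply: mu_ext_sigma_subadditive.
Qed.

HB.instance Definition _ k delta := isOuterMeasure.Build R V
  (@hausdorff_content R d k delta) (hausdorff_content0 k delta)
  (hausdorff_content_ge0 k delta) (@le_hausdorff_content k delta)
  (@hausdorff_content_sigma_subadditive k delta).

Lemma hausdorff_content_le_gauge k delta U :
  diameter U <= delta%:E -> hausdorff_content k delta U <= hausdorff_gauge k U.
Proof.
move=> dU; apply: ereal_inf_lbound.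
exists (fun n => if n == 0%N then U else set0).
  by split => [x Ux|[]//]; [exists 0%N|move=> ?; rewrite diameter0 leNye].
rewrite nneseries_recl//; last by move=> *; exact: hausdorff_gauge_ge0.
by rewrite eseries_cond/= eseries0 ?adde0// => -[|]//= n _ _; rewrite hausdorff_gauge0.
Qed.

Lemma hausdorff_content_antitone k (d1 d2 : R) A : (d1 <= d2)%R ->
  hausdorff_content k d2 A <= hausdorff_content k d1 A.
Proof.
move=> d12; apply: ereal_inf_le_tmp => _ [U [AU dU] <-]; exists U => //.
by split => // i; rewrite (le_trans (dU i))// lee_fin.
Qed.

Lemma hausdorff_content_le k delta A : (0 < delta)%R ->
  hausdorff_content k delta A <= hausdorff k A.
Proof. by move=> d0; apply: ereal_sup_ubound; exists delta. Qed.

Lemma hausdorff_le k A (M : \bar R) :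
  (forall delta, (0 < delta)%R -> hausdorff_content k delta A <= M) ->
  hausdorff k A <= M.
Proof. by move=> H; apply: ge_ereal_sup => _ [delta d0 <-]; exact: H. Qed.

Lemma hausdorff_ge0 k A : 0 <= hausdorff k A.
Proof.
exact: le_trans (hausdorff_content_ge0 k 1 A) (hausdorff_content_le _ _ _).
Qed.

Lemma le_hausdorff k A B : A `<=` B -> hausdorff k A <= hausdorff k B.
Proof.
move=> AB; apply: hausdorff_le => e e0.
exact: le_trans (le_hausdorff_content _ _ AB) (hausdorff_content_le _ _ e0).
Qed.

Lemma hausdorff0 k : hausdorff k (set0 : set V) = 0.
Proof.
apply/eqP; rewrite eq_le hausdorff_ge0 andbT.
by apply: hausdorff_le => e _; rewrite hausdorff_content0.
Qed.

Lemma hausdorff_sigma_subadditive k : sigma_subadditive (@hausdorff R d k).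
Proof.
move=> F; apply: hausdorff_le => e e0.
apply: (le_trans (hausdorff_content_sigma_subadditive _ _ _)).
apply: lee_nneseries => [n _ _|n _]; first exact: hausdorff_content_ge0.
exact: hausdorff_content_le.
Qed.

HB.instance Definition _ k := isOuterMeasure.Build R V (@hausdorff R d k)
  (hausdorff0 k) (hausdorff_ge0 k) (@le_hausdorff k)
  (@hausdorff_sigma_subadditive k).

Lemma hausdorff_separated k (e : R) A B : (0 < e)%R ->
  (forall x y, A x -> B y -> (e <= enorm (x - y))%R) ->
  hausdorff k A + hausdorff k B <= hausdorff k (A `|` B).
Proof.
move=> e0 sepAB.
have H (delta : R) : (0 < delta < e)%R ->
  hausdorff_content k delta A + hausdorff_content k delta B <=
  hausdorff_content k delta (A `|` B).
  move=> /andP[de0 dee]; apply: le_ereal_inf_tmp => _ [U [ABU dU] <-].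
  (* Keep only the sets of the covering that meet C: a set of diameter at most delta < e is never
     kept for both A and B. *)
  pose W (C : set V) n := if pselect ((U n `&` C) !=set0) then U n else set0.
  have HW C : C `<=` A `|` B ->
      hausdorff_content k delta C <= \sum_(i <oo) hausdorff_gauge k (W C i).
    move=> CAB; apply: ereal_inf_lbound; exists (W C) => //; split => [x Cx|i].
      have [n _ Unx] := ABU _ (CAB _ Cx); exists n => //.
      by rewrite /W; case: pselect => // -[]; exists x.
    by rewrite /W; case: pselect => ?; [exact: dU|rewrite diameter0 leNye].
  apply: (le_trans (leeD (HW A _) (HW B _))); [exact: subsetUl|exact: subsetUr|].
  rewrite -nneseriesD; [|by move=> *; exact: hausdorff_gauge_ge0..].
  apply: lee_nneseries => [n _ _|n _].
    by rewrite adde_ge0// hausdorff_gauge_ge0.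
  rewrite /W; case: pselect => /= [[x [Unx Ax]]|_]; case: pselect => /= [[y [Uny By]]|_];
    rewrite ?hausdorff_gauge0 ?adde0 ?add0e// ?hausdorff_gauge_ge0//.
  have := le_trans (enorm_le_diameter Unx Uny) (dU n).
  by rewrite lee_fin leNgt (lt_le_trans dee)// sepAB.
(* Independent scales for A and B, so that the two suprema can be taken one after the other. *)
have {}H (d1 d2 : R) : (0 < d1)%R -> (0 < d2)%R ->
  hausdorff_content k d1 A + hausdorff_content k d2 B <= hausdorff k (A `|` B).
  move=> d10 d20; pose delta := (Num.min (e / 2) (Num.min d1 d2))%R.
  have dl0 : (0 < delta)%R by rewrite !lt_min d10 d20 divr_gt0.
  have dle : (delta < e)%R.
    by rewrite gt_min ltr_pdivrMr// mulr_natr mulr2n ltrDl e0.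
  apply: le_trans (hausdorff_content_le _ _ dl0).
  apply: le_trans (H delta _); last by rewrite dl0.
  apply: leeD; apply: hausdorff_content_antitone.
    by rewrite /delta !ge_min lexx orbT.
  by rewrite /delta !ge_min lexx !orbT.
have [->|ABoo] := eqVneq (hausdorff k (A `|` B)) +oo; first by rewrite leey.
have fin C : C `<=` A `|` B -> hausdorff k C \is a fin_num.
  move=> CAB; rewrite ge0_fin_numE ?hausdorff_ge0//.
  by rewrite (le_lt_trans (le_hausdorff _ CAB))// ltey.
have fB := fin B (@subsetUr _ _ _).
rewrite -leeBrDr//; apply: hausdorff_le => d1 d10.
have f1 : hausdorff_content k d1 A \is a fin_num.
  rewrite ge0_fin_numE ?hausdorff_content_ge0//.
  rewrite (le_lt_trans (hausdorff_content_le _ _ d10))//.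
  by rewrite -ge0_fin_numE ?hausdorff_ge0// fin//; exact: subsetUl.
rewrite leeBrDr// addeC -leeBrDr//; apply: hausdorff_le => d2 d20.
by rewrite leeBrDr// addeC H.
Qed.

End hausdorff_outer.

Lemma sume_parity (R : realType) (h : nat -> \bar R) N :
  (\sum_(0 <= j < N.*2) h j =
   \sum_(j < N) h (j.*2 + 0)%N + \sum_(j < N) h (j.*2 + 1)%N)%E.
Proof.
elim: N => [|N ih]; first by rewrite big_nil !big_ord0 adde0.
rewrite doubleS !big_nat_recr//= ih !big_ord_recr/= addn0 addn1.
by rewrite -!addeA; congr (_ + _)%E; rewrite addeCA.
Qed.

Section hausdorff_borel.
Local Open Scope ereal_scope.
Variables (R : realType) (d : nat).
Local Notation V := 'rV[R]_d.
Implicit Types (A B X : set V) (k : nat).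

Lemma hausdorff_separated_coord k (i : 'I_d) (s t : R) A B : (s < t)%R ->
  (forall x, A x -> x ord0 i < s)%R -> (forall x, B x -> t <= x ord0 i)%R ->
  hausdorff k A + hausdorff k B <= hausdorff k (A `|` B).
Proof.
move=> st As tB; apply: (@hausdorff_separated _ _ _ (t - s)).
  by rewrite subr_gt0.
move=> x y Ax By; rewrite enormC (le_trans _ (coord_le_enorm _ i))//.
rewrite !mxE (le_trans _ (ler_norm _))//; apply: lerB; first exact: tB.
exact/ltW/As.
Qed.

(** Carathéodory's argument for metric outer measures. The set x_i < c is exhausted by sets at
    positive distance from its complement; what is left is a tail of thin slabs [B n], whose
    measures are summable because slabs of equal parity are separated. *)
Lemma caratheodory_halfspace k (i : 'I_d) (c : R) :
  (@hausdorff R d k).-caratheodory [set x | (x ord0 i < c)%R].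
Proof.
apply: le_caratheodory_measurable => X.
suff : hausdorff k (X `&` [set x | (x ord0 i < c)%R]) +
  hausdorff k (X `&` ~` [set x | (x ord0 i < c)%R]) <= hausdorff k X by [].
have [->|Xoo] := eqVneq (hausdorff k X) +oo; first by rewrite leey.
have Hfin : hausdorff k X \is a fin_num.
  by rewrite ge0_fin_numE ?hausdorff_ge0// ltey.
pose lev n : R := (c - n.+1%:R^-1)%R.
have ltlev n : (lev n < lev n.+1)%R.
  by rewrite /lev ltrD2l ltrN2 ltf_pV2 ?posrE// ltr_nat.
pose A n := X `&` [set x | (x ord0 i < lev n)%R].
pose B n := X `&` [set x | (lev n <= x ord0 i < lev n.+1)%R].
(* The slab skipped between two consecutive ones of equal parity gives the positive distance that
   superadditivity requires. *)
have parity p N : \sum_(j < N) hausdorff k (B (j.*2 + p).+1) <=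
    hausdorff k (A (N.*2 + p)%N).
  elim: N => [|N ih]; first by rewrite big_ord0 hausdorff_ge0.
  rewrite big_ord_recr/=; apply: (le_trans (leeD2r _ ih)).
  apply: (le_trans (@hausdorff_separated_coord _ i _ _ _ _ (ltlev (N.*2 + p)%N) _ _)).
  - by move=> x [].
  - by move=> x [_ /andP[]].
  apply: le_hausdorff => x [[Xx /= xl]|[Xx /= /andP[xl1 xl2]]]; split => //=.
  by rewrite doubleS !addSn (lt_trans xl)// (lt_trans (ltlev _) (ltlev _)).
have sumB N : \sum_(0 <= j < N) hausdorff k (B j.+1) <= hausdorff k X + hausdorff k X.
  apply: (@le_trans _ _ (\sum_(0 <= j < N.*2) hausdorff k (B j.+1))).
    rewrite -addnn [leRHS](big_cat_nat (n := N))//= ?leq_addr// leeDl//.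
    by apply: sume_ge0 => *; exact: hausdorff_ge0.
  have -> : \sum_(0 <= j < N.*2) hausdorff k (B j.+1) =
      \sum_(j < N) hausdorff k (B (j.*2 + 0).+1) +
      \sum_(j < N) hausdorff k (B (j.*2 + 1).+1).
    exact: (sume_parity (fun j => hausdorff k (B j.+1))).
  by apply: leeD; apply: (le_trans (parity _ _)); apply: le_hausdorff => x [].
have tail0 : \sum_(N <= j <oo) hausdorff k (B j.+1) @[N --> \oo] --> 0.
  apply: nneseries_tail_cvg => [|j _]; last exact: hausdorff_ge0.
  apply: (@le_lt_trans _ _ (hausdorff k X + hausdorff k X)).
    apply: lime_le; first by apply: is_cvg_nneseries => *; exact: hausdorff_ge0.
    by apply: nearW => N; exact: sumB.
  by rewrite -ge0_fin_numE ?adde_ge0 ?hausdorff_ge0// fin_numD Hfin.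
have key N : hausdorff k (X `&` [set x | (x ord0 i < c)%R]) +
    hausdorff k (X `&` ~` [set x | (x ord0 i < c)%R]) <=
    hausdorff k X + \sum_(N <= j <oo) hausdorff k (B j.+1).
  have h1 : hausdorff k (X `&` [set x | (x ord0 i < c)%R]) <=
      hausdorff k (A N.+1) + \sum_(N <= j <oo) hausdorff k (B j.+1).
    apply: (@le_trans _ _ (hausdorff k (A N.+1 `|` \bigcup_(n in ~` `I_N) B n.+1))).
      apply: le_hausdorff => x [Xx /= xc].
      have [xl|xl] := ltP (x ord0 i) (lev N.+1); first by left.
      right; have xc0 : (0 < c - x ord0 i)%R by rewrite subr_gt0.
      have exm : exists m, (x ord0 i < lev m)%R.
        have /= [m _ Hm] := @near_infty_natSinv_lt R (PosNum xc0).
        by exists m; rewrite /lev ltrBrDl -ltrBrDr; exact: (Hm m (leqnn m)).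
      (* The point x lies in the slab just below the first level exceeding its coordinate, that is
         [B m.-1]; the index is [m.-2] because the tail enumerates [B n.+1]. *)
      pose m := ex_minn exm; have Nm : (N.+1 < m)%N.
        rewrite /m; case: ex_minnP => m' xm' _; rewrite ltnNge; apply/negP => m'N.
        suff : (lev m' <= lev N.+1)%R by rewrite leNgt (le_lt_trans xl xm').
        by rewrite /lev lerD2l lerN2 lef_pV2 ?posrE// ler_nat ltnS.
      exists m.-2; first by apply/negP; rewrite -leqNgt; move: Nm; case: (m) => [|[]].
      split => //=; have -> : m.-2.+1 = m.-1 by move: Nm; case: (m) => [|[]].
      have -> : m.-1.+1 = m by move: Nm; case: (m).
      move: Nm; rewrite /m; case: ex_minnP => -[//|m'] xm' min _ /=; rewrite xm' andbT.
      by rewrite leNgt; apply/negP => /min; rewrite ltnn.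
    apply: (le_trans (outer_measureU2 _ _ _)); apply: leeD2l.
    exact: (outer_measure_sigma_subadditive_tail _ N (fun n => B n.+1)).
  apply: (le_trans (leeD2r _ h1)); rewrite addeAC leeD2r//.
  have cl : (lev N.+1 < c)%R by rewrite /lev ltrBlDr ltrDl invr_gt0.
  apply: (le_trans (@hausdorff_separated_coord _ i _ _ _ _ cl _ _)).
  - by move=> x [].
  - by move=> x [_ /negP]; rewrite -leNgt.
  - by apply: le_hausdorff => x [[]|[]].
rewrite -[leRHS]adde0.
have cvgr : hausdorff k X + \sum_(N <= j <oo) hausdorff k (B j.+1)
    @[N --> \oo] --> hausdorff k X + 0.
  by apply: cvgeD => //; [rewrite fin_num_adde_defr|exact: cvg_cst].
rewrite -(cvg_lim _ cvgr)//; apply: lime_ge; first by apply/cvg_ex; eexists; exact: cvgr.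
by apply: nearW => N; exact: key.
Qed.

Lemma borel_caratheodory k A : measurable A -> (@hausdorff R d k).-caratheodory A.
Proof.
move: A; apply: borel_rV_ind; last by move=> i c; exact: caratheodory_halfspace.
split.
- exact: caratheodory_measurable_set0.
- by move=> A cA; rewrite setTD; exact: caratheodory_measurable_setC.
- by move=> F cF; exact: caratheodory_measurable_bigcup.
Qed.

Section hausdorff_on_measure.
Variable E : {vspace V}.

Let hausdorff_on0 : hausdorff_on E set0 = 0.
Proof. by rewrite /hausdorff_on set0I hausdorff0. Qed.

Let hausdorff_on_ge0 A : 0 <= hausdorff_on E A.
Proof. exact: hausdorff_ge0. Qed.

Let hausdorff_on_sigma_additive : semi_sigma_additive (hausdorff_on E).
Proof.
move=> F mF tF mUF; rewrite /hausdorff_on.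
set e : set V := [set x | x \in E].
have -> : hausdorff (\dim E) (\bigcup_n F n `&` e) =
    \sum_(n <oo) hausdorff (\dim E) (F n `&` e).
  apply/eqP; rewrite eq_le; apply/andP; split.
    rewrite setIC (le_trans (outer_measure_bigcup_lim _ _ _))//.
    by apply: lee_nneseries => [n _ _|n _]; [exact: hausdorff_ge0|rewrite setIC].
  have cF n : (@hausdorff R d (\dim E)).-caratheodory (F n).
    by apply: borel_caratheodory; exact: mF.
  (* Carathéodory additivity for the Borel sets [F n], tested on the part of their union lying in
     E. *)
  apply: le_trans (caratheodory_lime_le cF tF _).
  rewrite -[leLHS]adde0; apply: leeD; last exact: hausdorff_ge0.
  apply: lee_nneseries => [n _ _|n _]; first exact: hausdorff_ge0.
  by apply: le_hausdorff => x [Fx ex]; split=> //; split => //; exists n.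
by apply: is_cvg_nneseries => n _ _; exact: hausdorff_ge0.
Qed.

HB.instance Definition _ := isMeasure.Build _ V R (hausdorff_on E)
  hausdorff_on0 hausdorff_on_ge0 hausdorff_on_sigma_additive.

End hausdorff_on_measure.

Lemma diameter_translate A (h : V) : diameter [set x | A (x + h)%R] = diameter A.
Proof.
rewrite /diameter; congr ereal_sup; apply/seteqP; split => _ [[x y] [/= Ax Ay] <-].
  by exists (x + h, y + h)%R => //=; rewrite opprD addrACA subrr addr0.
exists (x - h, y - h)%R; first by split => /=; rewrite subrK.
by rewrite /= opprB addrA subrK.
Qed.

Lemma hausdorff_gauge_translate k A (h : V) :
  hausdorff_gauge k [set x | A (x + h)%R] = hausdorff_gauge k A.
Proof.
rewrite /hausdorff_gauge diameter_translate.
suff -> : ([set x | A (x + h)%R] == set0) = (A == set0) by [].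
apply/eqP/eqP => [A0|->]; last by apply/seteqP; split.
rewrite -subset0 => x Ax; suff : [set x | A (x + h)%R] (x - h)%R by rewrite A0.
by rewrite /= subrK.
Qed.

Lemma hausdorff_translate k A (h : V) :
  hausdorff k [set x | A (x + h)%R] = hausdorff k A.
Proof.
have H B (g : V) : hausdorff k [set x | B (x + g)%R] <= hausdorff k B.
  apply: hausdorff_le => e e0; apply: le_trans (hausdorff_content_le _ _ e0).
  apply: le_ereal_inf_tmp => _ [U [BU dU] <-].
  rewrite (eq_eseriesr (fun n _ => esym (hausdorff_gauge_translate k (U n) g))).
  apply: ereal_inf_lbound; exists (fun n => [set x | U n (x + g)%R]) => //.
  split => [x /= /BU[n _ Un]|n]; [by exists n|by rewrite diameter_translate].
apply/eqP; rewrite eq_le H/=.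
have := H [set x | A (x + h)%R] (- h)%R; congr (hausdorff _ _ <= _).
by apply/funext => x /=; rewrite subrK.
Qed.

Lemma hausdorff_on_translate (E : {vspace V}) A (h : V) : h \in E ->
  hausdorff_on E [set x | A (x + h)%R] = hausdorff_on E A.
Proof.
move=> hE; rewrite /hausdorff_on -(hausdorff_translate _ (A `&` _) h).
congr hausdorff; apply/seteqP; split => x [Ax xE]; split => //=.
  exact: memvD.
by rewrite -(addrK h x) memvB.
Qed.

Lemma ge0_integral_hausdorff_translate (E : {vspace V}) (h : V) (f : V -> \bar R) :
  h \in E -> measurable_fun setT f -> (forall x, 0 <= f x) ->
  \int[hausdorff_on E]_x f (x + h)%R = \int[hausdorff_on E]_x f x.
Proof.
move=> hE mf f0; pose t (x : V) := (1 *: x + h)%R.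
have mt : measurable_fun setT t by exact: measurable_affine_rV.
have tE x : t x = (x + h)%R by rewrite /t scale1r.
transitivity (\int[pushforward (hausdorff_on E) t]_x f x).
  rewrite ge0_integral_pushforward//=.
  by apply: eq_integral => x _ /=; rewrite tE.
apply: eq_measure_integral => A mA _.
apply: etrans (hausdorff_on_translate A hE); congr (hausdorff_on E _).
by apply/funext => x; rewrite /preimage/= tE.
Qed.

End hausdorff_borel.

Section linear_bounds.
Variables (R : realType) (d : nat).
Local Notation V := 'rV[R]_d.

Lemma scalar_bounded (f : {scalar V}) :
  exists2 C : R, 0 <= C & forall x, `|f x| <= C * enorm x.
Proof.
exists (\sum_j `|f (delta_mx ord0 j)|); first by rewrite sumr_ge0.
move=> x; rewrite {1}(row_sum_delta x) linear_sum mulr_suml.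
apply: (le_trans (ler_norm_sum _ _ _)); apply: ler_sum => j _.
by rewrite linearZ/= normrM mulrC ler_wpM2l// coord_le_enorm.
Qed.

Lemma endo_bounded (f : {linear V -> V}) :
  exists2 C : R, 0 <= C & forall x, enorm (f x) <= C * enorm x.
Proof.
exists (\sum_j enorm (f (delta_mx ord0 j))).
  by rewrite sumr_ge0// => j _; exact: enorm_ge0.
move=> x; rewrite {1}(row_sum_delta x) linear_sum mulr_suml.
apply: (@big_ind2 _ _ (fun (u : V) (t : R) => enorm u <= t)).
- by rewrite enorm0.
- by move=> u1 t1 u2 t2 h1 h2; rewrite (le_trans (enormD _ _))// lerD.
- by move=> j _; rewrite linearZ/= enormZ mulrC ler_wpM2l ?enorm_ge0 ?coord_le_enorm.
Qed.

End linear_bounds.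

(** * Local finiteness of the Hausdorff measure on a subspace *)

Section hausdorff_finite.
Variables (R : realType) (d : nat).
Local Notation V := 'rV[R]_d.

Lemma exists_unit_cell (N : nat) (t : R) : 0 <= t <= N.+1%:R ->
  exists m : 'I_N.+1, m%:R <= t <= m.+1%:R.
Proof.
elim: N => [|N ih] /andP[t0 tN]; first by exists ord0; rewrite t0 tN.
have [tN1|tN1] := leP t N.+1%:R; last by exists ord_max; rewrite /= tN (ltW tN1).
have [|m Hm] := ih; first by rewrite t0.
by exists (widen_ord (leqnSn _) m).
Qed.

Local Open Scope ereal_scope.

Lemma hausdorff_gauge_le k (U : set V) (t : R) : (0 <= t)%R ->
  diameter U <= t%:E ->
  hausdorff_gauge k U <= (2 ^- k * ball_volume R k * t ^+ k)%:E.
Proof.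
move=> t0 Ut; have c0 : (0 <= 2 ^- k * ball_volume R k)%R.
  by rewrite mulr_ge0 ?invr_ge0 ?exprn_ge0// ltW// ball_volume_gt0.
rewrite /hausdorff_gauge; case: ifPn => [_|/set0P U0].
  by rewrite lee_fin mulr_ge0// exprn_ge0.
rewrite ball_volumeE; have := diameter_ge0 U0.
case: (diameter U) Ut => [r||]//; rewrite !lee_fin => rt r0.
by rewrite -EFin_expe -!EFinM lee_fin ler_wpM2l// lerXn2r.
Qed.

Lemma outer_measure_fin_cover (I : finType) (mu : {outer_measure set V -> \bar R})
    (A : set V) (U : I -> set V) (c : \bar R) :
  (forall x, A x -> exists i, U i x) -> (forall i, mu (U i) <= c) ->
  mu A <= c *+ #|I|.
Proof.
move=> AU Uc; have [I0|I0] := posnP #|I|.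
  rewrite I0 (_ : A = set0) ?outer_measure0//.
  rewrite -subset0 => x /AU[i _]; have := fintype0 i; exact.
have [i0 _] : exists i : I, i \in I by apply/card_gt0P.
pose F n := U (nth i0 (enum I) n).
apply: (@le_trans _ _ (mu (\big[setU/set0]_(n < #|I|) F n))).
  apply: le_outer_measure => x /AU[i Uix]; rewrite -bigcup_mkord.
  exists (enum_rank i); first exact: ltn_ord.
  by rewrite /F -(enum_val_nth i0) enum_rankK.
apply: (le_trans (outer_measure_subadditive _ _ _)).
apply: (le_trans (lee_sum _ (fun i _ => Uc _))).
by rewrite sumr_const card_ord.
Qed.

(** In coordinates of a basis of E, the ball is covered by (N+1)^k cells of diameter at most
    D/(N+1): the total gauge does not depend on N, so it stays bounded as the grid is refined. *)
Lemma hausdorff_on_bounded (E : {vspace V}) (r : R) :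
  hausdorff_on E (eball 0 r) < +oo.
Proof.
rewrite /hausdorff_on; set k := \dim E; pose b := vbasis E.
have /choice[C HC] : forall i : 'I_k, exists C : R, forall x : V,
    (`|coord b i x| <= C * enorm x)%R.
  by move=> i; have [C _ HC] := scalar_bounded (coord b i); exists C.
pose M : R := (1 + \sum_i `|C i| * `|r|)%R.
have M0 : (0 < M)%R.
  by rewrite ltr_pwDl// sumr_ge0// => i _; rewrite mulr_ge0.
have coordM x i : (enorm x < r -> `|coord b i x| <= M)%R.
  move=> xr; apply: (le_trans (HC i x)).
  apply: (@le_trans _ _ (`|C i| * `|r|)%R).
    apply: (@le_trans _ _ (`|C i| * enorm x)%R).
      by rewrite ler_wpM2r ?enorm_ge0// ler_norm.
    by rewrite ler_wpM2l// (le_trans (ltW xr))// ler_norm.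
  by rewrite /M (bigD1 i)//= addrCA lerDl addr_ge0// sumr_ge0.
pose D : R := (M *+ 2 * \sum_(i < k) enorm b`_i)%R.
have D0 : (0 <= D)%R.
  rewrite mulr_ge0 ?mulrn_wge0 ?(ltW M0)// sumr_ge0// => i _; exact: enorm_ge0.
pose c := (2 ^- k * ball_volume R k * D ^+ k)%R.
apply: (@le_lt_trans _ _ c%:E); last exact: ltry.
apply: hausdorff_le => delta delta0.
have [N HN] : exists N : nat, (D / delta < N.+1%:R)%R.
  exists (Num.truncn (D / delta)); exact: truncnS_gt.
have N0 : (0 < N.+1%:R :> R)%R by [].
have DN : (D / N.+1%:R <= delta)%R.
  by rewrite ler_pdivrMr// mulrC -ler_pdivrMr// ltW.
(* Rescales the coordinate range from -M to M onto the interval from 0 to N+1, so that cells have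
   integer corners. *)
pose tt x i : R := ((coord b i x + M) * N.+1%:R / (M *+ 2))%R.
have M20 : (0 < M *+ 2)%R by rewrite pmulrn_lgt0.
pose U (g : {ffun 'I_k -> 'I_N.+1}) : set V :=
  [set x | x \in E /\ forall i, ((g i)%:R <= tt x i <= (g i).+1%:R)%R].
have diamU g : diameter (U g) <= (D / N.+1%:R)%:E.
  apply: ge_ereal_sup => _ [[x y] [/= [xE Hx] [yE Hy]] <-]; rewrite lee_fin.
  have -> : (x - y = \sum_(i < k) (coord b i x - coord b i y) *: b`_i)%R.
    rewrite {1}(coord_vbasis xE) {1}(coord_vbasis yE) -sumrB.
    by apply: eq_bigr => i _; rewrite scalerBl.
  rewrite /D mulrAC mulr_sumr.
  apply: (@big_ind2 _ _ (fun (u : V) (t : R) => enorm u <= t)%R).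
  - by rewrite enorm0.
  - by move=> u1 t1 u2 t2 h1 h2; rewrite (le_trans (enormD _ _))// lerD.
  move=> i _; rewrite enormZ ler_wpM2r ?enorm_ge0//.
  have xE' z : (coord b i z = tt z i * (M *+ 2 / N.+1%:R) - M)%R.
    rewrite /tt; field; rewrite !lt0r_neq0//=.
  rewrite (xE' x) (xE' y) opprB addrA subrK -mulrBl normrM.
  rewrite [X in (_ * X <= _)%R]ger0_norm ?divr_ge0 ?(ltW M20)//.
  rewrite -[leRHS]mul1r ler_wpM2r ?divr_ge0 ?(ltW M20)//.
  have /andP[x1 x2] := Hx i; have /andP[y1 y2] := Hy i.
  rewrite ler_norml; move: x2 y2; rewrite -natr1 => x2 y2.
  by apply/andP; split; lra.
have contU g : hausdorff_content k delta (U g) <=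
    (2 ^- k * ball_volume R k * (D / N.+1%:R) ^+ k)%:E.
  apply: (le_trans (@hausdorff_content_le_gauge _ _ _ _ _ _)).
    by rewrite (le_trans (diamU g))// lee_fin.
  by apply: hausdorff_gauge_le => //; rewrite divr_ge0.
have cover x : (eball 0 r `&` [set x | x \in E]) x -> exists g, U g x.
  move=> [/=]; rewrite /eball/= subr0 => xr xE.
  have /choice[g Hg] : forall i, exists m : 'I_N.+1, (m%:R <= tt x i <= m.+1%:R)%R.
    move=> i; apply: exists_unit_cell; have := coordM x i xr.
    rewrite ler_norml => /andP[h1 h2]; rewrite /tt; apply/andP; split.
      by rewrite divr_ge0 ?(ltW M20)// mulr_ge0// -lerBlDr sub0r.
    by rewrite ler_pdivrMr// mulrC ler_wpM2l// mulr2n lerD2r.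
  by exists [ffun i => g i]; split => // i; rewrite ffunE.
apply: (le_trans (outer_measure_fin_cover cover contU)).
rewrite -EFin_natmul lee_fin card_ffun !card_ord /c expr_div_n.
by rewrite -[leLHS]mulr_natr natrX -!mulrA mulVf ?mulr1.
Qed.

(** A point has diameter 0, and 0^k = 0 for k > 0; in dimension 0 the counting measure gives it mass
    1. *)
Lemma hausdorff_on_set1 (E : {vspace V}) : (0 < \dim E)%N ->
  hausdorff_on E [set 0%R] = 0.
Proof.
move=> dE; apply/eqP; rewrite eq_le hausdorff_ge0 andbT.
apply: (@le_trans _ _ (hausdorff (\dim E) [set (0%R : V)])).
  by apply: le_hausdorff => x [].
have d0 : diameter [set (0%R : V)] <= 0%:E.
  by apply: ge_ereal_sup => _ [[x y] [/= -> ->] <-]; rewrite subrr enorm0.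
apply: hausdorff_le => e e0.
apply: (le_trans (hausdorff_content_le_gauge _ _)).
  by rewrite (le_trans d0)// lee_fin ltW.
apply: (le_trans (hausdorff_gauge_le _ (lexx _) d0)).
by rewrite expr0n gtn_eqF// mulr0.
Qed.

End hausdorff_finite.

Lemma cvge_lt_exists (R : realType) (u : (\bar R)^nat) (l : \bar R) :
  u @ \oo --> l -> forall M, (l < M)%E -> exists n, (u n < M)%E.
Proof.
move=> cvul M lM; apply: contrapT => /forallNP uM.
move: lM; rewrite ltNge => /negP; apply; apply: (cvge_ge _ cvul).
by apply: nearW => n; rewrite leNgt; apply/negP/uM.
Qed.

(** * Inner regularity of finite Borel measures *)

Section inner_regularity.
Local Open Scope ereal_scope.
Variables (R : realType) (d : nat).
Local Notation V := 'rV[R]_d.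
Variable P : {measure set V -> \bar R}.
Hypothesis Pfin : P setT < +oo.

Let Plt A : measurable A -> P A < +oo.
Proof. by move=> mA; apply: le_lt_trans Pfin; apply: le_measure; rewrite ?inE. Qed.

(** Approximation from inside by closed and from outside by open sets at once: this symmetric form
    is stable under complements, so the approximable sets form a sigma-algebra. *)
Let sandwich (A : set V) := forall e : R, (0 < e)%R -> exists C O : set V,
  [/\ closed C, open O, C `<=` A, A `<=` O & P (O `\` C) <= e%:E].

Let sandwich_halfspace i (c : R) : sandwich [set x : V | (x ord0 i < c)%R].
Proof.
move=> e e0.
pose C n := [set x : V | (x ord0 i <= c - n.+1%:R^-1)%R].
have cC n : closed (C n).
  rewrite (_ : C n = (fun x : V => x ord0 i) @^-1` `]-oo, (c - n.+1%:R^-1)%R]%classic).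
    by apply: preimage_closed; [move=> x _; exact: coord_continuous|exact: interval_closed].
  by apply/seteqP; split => x /=; rewrite in_itv.
have oO : open [set x : V | (x ord0 i < c)%R].
  rewrite (_ : [set x | _] = (fun x : V => x ord0 i) @^-1` `]-oo, c[%classic).
    by apply: open_comp; [move=> x _; exact: coord_continuous|exact: interval_open].
  by apply/seteqP; split => x /=; rewrite in_itv.
set O := [set x | _] in oO *.
have mF n : measurable (O `\` C n).
  by apply: measurableD; [exact: measurable_open_rV|exact: measurable_closed_rV].
have F0 : \bigcap_n (O `\` C n) = set0.
  rewrite -subset0 => x Fx; have [/= xc _] := Fx 0%N Logic.I.
  have xc0 : (0 < c - x ord0 i)%R by rewrite subr_gt0.
  have /= [m _ Hm] := @near_infty_natSinv_lt R (PosNum xc0).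
  have [_ /=] := Fx m Logic.I; apply.
  by rewrite /C/= lerBrDl -lerBrDr; exact/ltW/(Hm m (leqnn m)).
have : P (O `\` C n) @[n --> \oo] --> P (\bigcap_n (O `\` C n)).
  apply: nonincreasing_cvg_mu => //; first exact: Plt.
    by rewrite F0.
  apply/nonincreasing_seqP => n; apply/subsetPset => x [Ox nCx]; split => // Cx.
  apply: nCx; rewrite /C/= (le_trans Cx)// lerD2l lerN2 lef_pV2 ?posrE//.
  by rewrite ler_nat.
rewrite F0 measure0 => /cvge_lt_exists /(_ (e%:E : \bar R))[|n /ltW Hn].
  by rewrite lte_fin.
exists (C n), O; split => //.
by move=> x /= /le_lt_trans; apply; rewrite ltrBlDr ltrDl invr_gt0.
Qed.

Let sandwich_setC A : sandwich A -> sandwich (~` A).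
Proof.
move=> sA e e0; have [C [U [cC oU CA AU PUC]]] := sA e e0.
exists (~` U), (~` C); split => //.
- exact: open_closedC.
- exact: closed_openC.
- exact: subsetC.
- exact: subsetC.
- by rewrite setDE setCK setIC -setDE.
Qed.

Let sandwich_bigcup (F : (set V)^nat) : (forall n, sandwich (F n)) ->
  sandwich (\bigcup_n F n).
Proof.
move=> sF e e0; have e20 : (0 < e / 2)%R by rewrite divr_gt0.
have /choice[f Hf] : forall n, exists CO : set V * set V,
    [/\ closed CO.1, open CO.2, CO.1 `<=` F n, F n `<=` CO.2 &
        P (CO.2 `\` CO.1) <= (e / 2 / (2 ^ n.+1)%:R)%:E].
  move=> n; have [|C [U H]] := sF n (e / 2 / (2 ^ n.+1)%:R)%R.
    by rewrite divr_gt0// ltr0n expn_gt0.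
  by exists (C, U).
pose C n := (f n).1; pose O := \bigcup_n (f n).2.
have mC n : measurable (C n) by apply: measurable_closed_rV; have [] := Hf n.
have mf2 n : measurable (f n).2 by apply: measurable_open_rV; have [] := Hf n.
have oO : open O by apply: bigcup_open => n _; have [] := Hf n.
pose D N := \big[setU/set0]_(n < N) C n.
have mD N : measurable (D N) by exact: bigsetU_measurable.
have cD N : closed (D N).
  by rewrite /D -bigcup_mkord; apply: closed_bigcup => // n _; have [] := Hf n.
have mO : measurable O by exact: bigcupT_measurable.
have capE : \bigcap_N (O `\` D N) = O `\` \bigcup_n C n.
  apply/seteqP; split => [x H|x [Ox nC] N _].
    split; first by have [] := H 0%N Logic.I.
    move=> [n _ Cx]; have [_] := H n.+1 Logic.I; apply.
    by rewrite /D -bigcup_mkord; exists n => //=.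
  by split => //; rewrite /D -bigcup_mkord => -[n _ Cx]; apply: nC; exists n.
(* Half of e pays for the union of all the [C n], which may fail to be closed; the other half pays
   for truncating it to the closed finite union [D N]. *)
have Pcap : P (O `\` \bigcup_n C n) <= (e / 2)%:E.
  apply: (@le_trans _ _ (\sum_(n <oo) P ((f n).2 `\` C n))).
    apply: measure_sigma_subadditive.
    - by move=> n; exact: measurableD.
    - by apply: measurableD => //; exact: bigcupT_measurable.
    - by move=> x [[n _ fx] nC]; exists n => //; split => // Cx; apply: nC; exists n.
  apply: le_trans (epsilon_trick0 xpredT (ltW e20)).
  by apply: lee_nneseries => // n _; have [] := Hf n.
have : P (O `\` D N) @[N --> \oo] --> P (\bigcap_N (O `\` D N)).
  apply: nonincreasing_cvg_mu => //.
  - by apply: Plt; exact: measurableD.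
  - by move=> N; exact: measurableD.
  - by rewrite capE; apply: measurableD => //; exact: bigcupT_measurable.
  - apply/nonincreasing_seqP => N; apply/subsetPset; apply: setDS.
    by rewrite /D big_ord_recr/=; exact: subsetUl.
rewrite capE => /cvge_lt_exists/(_ (e%:E))[|N /ltW HN].
  by rewrite (le_lt_trans Pcap)// lte_fin ltr_pdivrMr// mulr_natr mulr2n ltrDl.
exists (D N), O; split => //.
- rewrite /D -bigcup_mkord => x [n _ Cx]; exists n => //.
  by have [_ _ CF _ _] := Hf n; exact: CF.
- move=> x [n _ Fx]; exists n => //.
  by have [_ _ _ FO _] := Hf n; exact: FO.
Qed.

Lemma finite_measure_inner_closed (A : set V) (e : R) : measurable A -> (0 < e)%R ->
  exists C : set V, [/\ closed C, C `<=` A & P (A `\` C) <= e%:E].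
Proof.
move=> mA e0; suff /(_ e e0)[C [U [cC oU CA AU PUC]]] : sandwich A.
  exists C; split => //; apply: le_trans PUC; apply: le_measure; rewrite ?inE.
  - by apply: measurableD => //; exact: measurable_closed_rV.
  - by apply: measurableD; [exact: measurable_open_rV|exact: measurable_closed_rV].
  - exact: setSD.
move: A mA; apply: borel_rV_ind; last exact: sandwich_halfspace.
split.
- move=> r r0; exists set0, set0.
  split => //; first exact: closed0.
  by rewrite setD0 measure0 lee_fin ltW.
- by move=> A sA; rewrite setTD; exact: sandwich_setC.
- exact: sandwich_bigcup.
Qed.

End inner_regularity.

(** * A Steinhaus theorem for Hausdorff measure on a subspace *)

Section steinhaus.
Local Open Scope ereal_scope.
Variables (R : realType) (d : nat).
Local Notation V := 'rV[R]_d.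

(** Since K is closed, its neighbourhoods [U n] decrease to K, so one of them has measure below 3/2
    of that of K. It contains both K and K + h, of equal measure as h is in E, so these overlap in
    at least half the measure of K. *)
Lemma hausdorff_on_steinhaus (E : {vspace V}) (F : set V) (r : R) :
  measurable F -> F `<=` eball 0 r -> 0 < hausdorff_on E F ->
  exists (K : set V) (s c : R), [/\ closed K, K `<=` F, (0 < s)%R, (0 < c)%R &
    forall h : V, h \in E -> (enorm h < s)%R ->
      c%:E <= hausdorff_on E (K `&` [set x | K (x - h)%R])].
Proof.
move=> mF Fr F0.
have mB x t : measurable (@eball R d x t) by exact: measurable_eball.
pose H : {measure set V -> \bar R} := hausdorff_on E.
have Hbd A t : A `<=` eball 0 t -> H A < +oo.
  move=> At; apply: le_lt_trans (hausdorff_on_bounded E t).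
  by apply: le_hausdorff => x [Ax xE]; split => //; exact: At.
have HF : H F \is a fin_num by rewrite ge0_fin_numE//; exact: (Hbd _ r).
have F0' : (0 < fine (H F))%R by rewrite -lte_fin fineK.
have Pfin : mrestr H mF setT < +oo by rewrite /mrestr setTI ltey_eq HF.
(* Inner regularity is applied to the finite measure H restricted to F; leaving out at most half of
   the mass of F guarantees that K is not null. *)
have [|K [cK KF PK]] := @finite_measure_inner_closed _ _ (mrestr H mF) Pfin
  F (fine (H F) / 2)%R mF; first by rewrite divr_gt0.
have mK := measurable_closed_rV cK.
have HK : H K \is a fin_num.
  by rewrite ge0_fin_numE//; apply: (Hbd _ r); exact: subset_trans Fr.
pose kap := fine (H K).
have kap0 : (0 < kap)%R.
  rewrite -lte_fin /kap fineK//.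
  have : H F = H (F `\` K) + H K.
    by rewrite (measureDI _ mF mK) (setIidr KF).
  move=> HFE; have {}PK : H (F `\` K) <= (fine (H F) / 2)%:E.
    apply: le_trans PK; rewrite le_eqVlt; apply/orP; left; apply/eqP.
    by rewrite -[RHS]/(H ((F `\` K) `&` F)) setIidl//; exact: subDsetl.
  rewrite lt_neqAle measure_ge0 andbT; apply/eqP => HK0.
  move: HFE PK; rewrite -HK0 adde0 => <-; rewrite -[leLHS](fineK HF) lee_fin.
  by rewrite leNgt ltr_pdivrMr// mulr_natr mulr2n ltrDl F0'.
pose U n := [set x : V | exists2 y, K y & (enorm (x - y) < n.+1%:R^-1)%R].
have mU n : measurable (U n).
  apply: measurable_open_rV.
  rewrite (_ : U n = \bigcup_(y in K) eball y n.+1%:R^-1).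
    by apply: bigcup_open => y _; exact: open_eball.
  by apply/seteqP; split => x [y Ky xy]; exists y.
have capU : \bigcap_n U n = K.
  apply/seteqP; split => [x Ux|x Kx n _]; last first.
    by exists x => //; rewrite subrr enorm0 invr_gt0.
  apply: contrapT => /(closed_eball_sep cK)[e e0 He].
  have /= [m _ Hm] := @near_infty_natSinv_lt R (PosNum e0).
  have [y Ky xy] := Ux m Logic.I.
  have := He _ Ky; rewrite enormC leNgt (lt_trans xy)//.
  exact: (Hm m (leqnn m)).
have KU n : K `<=` U n by rewrite -capU; exact: bigcap_inf.
have Ubd n : U n `<=` eball 0 (r + 1).
  move=> x [y Ky xy]; rewrite /eball/= subr0 -(subrK y x).
  rewrite (le_lt_trans (enormD _ _))// addrC ltrD//.
    by have := Fr _ (KF _ Ky); rewrite /eball/= subr0.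
  by rewrite (lt_le_trans xy)// invf_le1// ler1n.
have : H (U n) @[n --> \oo] --> H (\bigcap_n U n).
  apply: nonincreasing_cvg_mu => //; first exact: (Hbd _ (r + 1)%R).
    by rewrite capU.
  apply/nonincreasing_seqP => n; apply/subsetPset => x [y Ky xy]; exists y => //.
  by rewrite (lt_trans xy)// ltf_pV2 ?posrE// ltr_nat.
rewrite capU -(fineK HK) -/kap => /cvge_lt_exists/(_ (kap * (3 / 2))%:E)[|n /ltW Hn].
  by rewrite lte_fin ltr_pMr//; lra.
exists K, (n.+1%:R^-1)%R, (kap / 2)%R; split => //.
  by rewrite divr_gt0.
move=> h hE hn; pose Kh := [set x : V | K (x - h)%R].
have mKh : measurable Kh.
  rewrite (_ : Kh = (fun x => 1 *: x + (- h))%R @^-1` K); last first.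
    by apply/funext => x; rewrite /preimage/= scale1r.
  by rewrite -[X in measurable X]setTI; exact: measurable_affine_rV.
have HKh : H Kh = kap%:E.
  rewrite /kap fineK// /Kh; apply: (@hausdorff_on_translate _ _ E K (- h)%R).
  by rewrite memvN.
have KhU : Kh `<=` U n.
  by move=> x Kx; exists (x - h)%R => //; rewrite opprB addrC subrK.
have Hcap : H (K `&` Kh) \is a fin_num.
  rewrite ge0_fin_numE//; apply: (Hbd _ r); apply: subset_trans Fr.
  by apply: subset_trans KF; exact: subIsetl.
have HUn : H (K `|` Kh) <= (kap * (3 / 2))%:E.
  apply: le_trans Hn.
  apply: le_measure; rewrite ?inE//; first exact: measurableU.
  by move=> x [/KU|/KhU].
move: HUn; rewrite measureUfinl//; last by rewrite ltey_eq HK.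
rewrite HKh -(fineK HK) -/kap -[hausdorff_on _ _]/(H (K `&` Kh)) -(fineK Hcap).
by rewrite -!EFinD !lee_fin; lra.
Qed.

End steinhaus.

(** * Mass of the measures f_k H_{E_k} in annuli *)

Section geometric_scales.
Variables (R : realType) (a : R).
Hypothesis a1 : 1 < a.

Lemma exists_expr_gt (x : R) : exists n : nat, x < a ^+ n.
Proof.
have H n : 1 + n%:R * (a - 1) <= a ^+ n.
  elim: n => [|n ih]; first by rewrite mul0r addr0 expr0.
  have a0 : 0 <= a by rewrite ltW// (lt_trans _ a1).
  rewrite exprS (le_trans _ (ler_wpM2l a0 ih))//.
  rewrite -natr1 -subr_ge0.
  rewrite (_ : _ - _ = n%:R * (a - 1) ^+ 2); last by ring.
  by rewrite mulr_ge0// sqr_ge0.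
exists (Num.truncn (`|x| / (a - 1))).+1; apply: lt_le_trans (H _).
have a10 : 0 < a - 1 by rewrite subr_gt0.
rewrite (le_lt_trans (ler_norm x))// ltr_wpDl// -ltr_pdivrMr//.
exact: truncnS_gt.
Qed.

Lemma exists_shell (t : R) : 0 < t < 1 -> exists n : nat, a ^- n.+1 <= t < a ^- n.
Proof.
move=> /andP[t0 t1].
have ex : exists n : nat, a ^- n <= t.
  have [n Hn] := exists_expr_gt t^-1; exists n.
  by rewrite invf_ple ?posrE ?exprn_gt0 ?(lt_trans _ a1)// ltW.
case: (ex_minnP ex) => -[|n]; first by rewrite expr0 invr1 leNgt t1.
move=> nt nmin; exists n; rewrite nt ltNge; apply/negP => /nmin.
by rewrite ltnn.
Qed.

End geometric_scales.

Section directional_bound.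
Local Open Scope ereal_scope.
Variables (R : realType) (d : nat) (alpha0 a : R).
Local Notation V := 'rV[R]_d.
Hypothesis a1 : (1 < a)%R.

Let a0 : (0 < a)%R. Proof. exact: lt_trans a1. Qed.
Let an0 n : (0 < a ^+ n)%R. Proof. exact: exprn_gt0. Qed.
Let ian0 n : (0 < a ^- n)%R. Proof. by rewrite invr_gt0. Qed.

Definition shell (s : R) n : set V :=
  [set z | (s * a ^- n.+1 <= enorm z < s * a ^- n)%R].

Lemma measurable_shell s n : measurable (shell s n).
Proof.
rewrite (_ : shell s n = @enorm R d @^-1` `[s * a ^- n.+1, s * a ^- n[%classic)%R.
  by rewrite -[X in measurable X]setTI; exact: measurable_enorm.
by apply/seteqP; split => z; rewrite /shell/= in_itv.
Qed.

Lemma closure_sub_closed (A C : set V) : closed C -> A `<=` C -> closure A `<=` C.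
Proof. by move=> cC AC; rewrite [X in _ `<=` X](closure_id C).1//; exact: closureS. Qed.

Lemma closed_enorm_le (r : R) : closed [set z : V | (enorm z <= r)%R].
Proof.
rewrite (_ : [set z | _] = @enorm R d @^-1` `]-oo, r]%classic).
  by apply: preimage_closed; [move=> x _; exact: continuous_enorm|exact: interval_closed].
by apply/seteqP; split => x /=; rewrite in_itv.
Qed.

Lemma measurable_scale (r : R) : measurable_fun setT (fun z : V => r *: z)%R.
Proof.
rewrite (_ : (fun z => _) = (fun z : V => r *: z + 0)%R).
  exact: measurable_affine_rV.
by apply/funext => z; rewrite addr0.
Qed.

(** The strict bound r < 1 puts the closed support inside the open unit ball, as [scaling] demands;
    since g (a z) has an even smaller support, the relation iterates. *)
Lemma scaling_iter (m : set V -> \bar R) (r : R) (g : V -> \bar R) n :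
  scaling alpha0 a m -> (r < 1)%R -> measurable_fun setT g ->
  (forall z, 0 <= g z) -> (forall z, g z != 0 -> (enorm z <= r)%R) ->
  \int[m]_z g z = ((a `^ (- alpha0)) ^+ n)%:E * \int[m]_z g (a ^+ n *: z)%R.
Proof.
move=> sm r1; elim: n g => [|n ih] g mg g0 gr.
  by rewrite expr0 mul1e; congr integral; apply/funext => z; rewrite expr0 scale1r.
rewrite sm//; last first.
  move=> z; rewrite /eball/= subr0 => gz; apply: le_lt_trans r1.
  exact: (closure_sub_closed (@closed_enorm_le r) gr).
rewrite ih//.
- rewrite muleA -EFinM -exprS; congr (_ * _); congr integral.
  by apply/funext => z; rewrite scalerA -exprS.
- by apply: (measurableT_comp mg); exact: measurable_scale.
- move=> z /gr; rewrite enormZ gtr0_norm// => zr.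
  by apply: le_trans zr; rewrite ler_peMl ?enorm_ge0 ?(ltW a1).
Qed.

Variables (E : {vspace V}) (f : V -> \bar R) (nu : {measure set V -> \bar R}).
Hypotheses (mf : measurable_fun setT f) (f0 : forall x, 0 <= f x).
Local Notation H := (hausdorff_on E).
Hypothesis fnu : forall S, measurable S -> with_density H f S <= nu S.
Hypothesis sf : scaling alpha0 a (with_density H f).
Hypothesis f1 : 0 < \int[H]_(x in eball 0 1) f x.
Hypothesis dE : (0 < \dim E)%N.

(** Countably many pieces exhaust the points of the unit ball off the origin where f > 0. On each of
    them f is bounded below, and the distance to the unit sphere is positive, as iterating the
    scaling relation requires. *)
Let piece n m : set V := shell 1 n `&`
  ([set z | (m.+1%:R^-1)%:E <= f z] `&` [set z | (enorm z <= 1 - m.+1%:R^-1)%R]).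

Let measurable_piece n m : measurable (piece n m).
Proof.
apply: measurableI; first exact: measurable_shell.
apply: measurableI.
  rewrite -[X in measurable X]setTI.
  exact: (emeasurable_fun_c_infty measurableT mf).
by apply: measurable_closed_rV; exact: closed_enorm_le.
Qed.

Let positive_piece : exists n m, 0 < H (piece n m).
Proof.
apply: contrapT => /forallNP nH.
have H0 n m : H (piece n m) = 0.
  apply/eqP; rewrite eq_le measure_ge0 andbT leNgt; apply/negP => Hnm.
  by apply: (nH n); exists m.
have mB : measurable (eball (0 : V) 1) by exact: measurable_eball.
(* If all pieces were null, f would vanish on the ball off the null set N, contradicting [f1]. The
   origin is null because [\dim E] is positive. *)
pose N : set V := [set 0%R] `|` \bigcup_n \bigcup_m piece n m.
have mN1 : measurable [set (0%R : V)].
  rewrite (_ : [set 0%R] = [set z : V | (enorm z <= 0)%R]).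
    by apply: measurable_closed_rV; exact: closed_enorm_le.
  apply/seteqP; split => [z ->|z /=]; first by rewrite /= enorm0.
  by rewrite le_eqVlt ltNge enorm_ge0 orbF enorm_eq0 => /eqP.
have mN2 : measurable (\bigcup_n \bigcup_m piece n m).
  by apply: bigcupT_measurable => n; exact: bigcupT_measurable.
have mN : measurable N by exact: measurableU.
have HN : H N = 0.
  apply: null_set_setU => //; first exact: hausdorff_on_set1.
  apply/eqP; rewrite eq_le measure_ge0 andbT.
  apply: (@le_trans _ _ (\sum_(n <oo) \sum_(m <oo) H (piece n m))).
    apply: (@le_trans _ _ (\sum_(n <oo) H (\bigcup_m piece n m))).
      by apply: measure_sigma_subadditive => // n; exact: bigcupT_measurable.
    apply: lee_nneseries => // n _.
    by apply: measure_sigma_subadditive => //; exact: bigcupT_measurable.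
  by rewrite eseries0// => n _ _; rewrite eseries0.
move: f1; rewrite (@ge0_negligible_integral _ _ _ _ _ N)//; last exact: measurable_funTS.
rewrite integral0_eq ?ltxx// => z [zB zN].
apply/eqP; rewrite eq_le f0 andbT leNgt; apply/negP => fz; apply: zN.
have [->|z0] := eqVneq z 0%R; first by left.
right; move: zB; rewrite /eball/= subr0 => z1.
have [n /andP[zn1 zn2]] : exists n : nat, (a ^- n.+1 <= enorm z < a ^- n)%R.
  by apply: exists_shell => //; rewrite enorm_gt0 z0.
have [m1 Hm1] : exists m : nat, (m.+1%:R^-1)%:E <= f z.
  case: (f z) fz => [r||]//; last by exists 0%N; rewrite leey.
  rewrite lte_fin => r0; have /= [m _ Hm] := @near_infty_natSinv_lt R (PosNum r0).
  by exists m; rewrite lee_fin; exact/ltW/(Hm m (leqnn m)).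
have [m2 Hm2] : exists m : nat, (enorm z <= 1 - m.+1%:R^-1)%R.
  have r0 : (0 < 1 - enorm z)%R by rewrite subr_gt0.
  have /= [m _ Hm] := @near_infty_natSinv_lt R (PosNum r0).
  by exists m; rewrite lerBrDl -lerBrDr; exact/ltW/(Hm m (leqnn m)).
exists n => //; exists (maxn m1 m2) => //; split => /=.
  by rewrite /shell/= !mul1r zn1.
split => /=.
  rewrite (le_trans _ Hm1)// lee_fin lef_pV2 ?posrE// ler_nat ltnS leq_maxl//.
rewrite (le_trans Hm2)// lerD2l lerN2 lef_pV2 ?posrE// ler_nat ltnS leq_maxr//.
Qed.

(* Steinhaus: a closed set K of positive measure on which f is bounded below
   meets its translates K + h, h in E small, in a set of measure at least c. *)
Lemma directional_lower_bound : exists s r c : R,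
  [/\ (0 < s <= 1)%R, (0 < r)%R, (0 < c)%R &
  forall n (h : V) (k : \bar R) (g : V -> \bar R),
    h \in E -> (enorm h < r * a ^- n)%R -> 0 <= k ->
    measurable_fun setT g -> (forall z, 0 <= g z) ->
    (forall z, (enorm z < s * a ^- n)%R -> (enorm (z - h)%R < s * a ^- n)%R ->
      k <= g z + g (z - h)%R) ->
    (c * (a `^ alpha0) ^+ n)%:E * k <= \int[nu]_(z in shell s n) g z].
Proof.
have [n0 [m0 Hp]] := positive_piece.
have pB : piece n0 m0 `<=` eball 0 1.
  by move=> z [_ [_ /= zm]]; rewrite /eball/= subr0 (le_lt_trans zm).
have [K [r [c [cK Kp r0 c0 HK]]]] :=
  hausdorff_on_steinhaus (@measurable_piece n0 m0) pB Hp.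
have mK := measurable_closed_rV cK.
pose s := (a ^- n0)%R.
pose v : R := (m0.+1%:R^-1)%R.
have v0 : (0 < v)%R by rewrite invr_gt0.
exists s, r, (v * c / 2)%R; split => //.
- by rewrite ian0 invf_le1// exprn_ege1// ltW.
- by rewrite divr_gt0// mulr_gt0.
move=> n h k g hE hr k0 mg g0 Hk.
(* The function g seen at scale a^-n and cut off to K: one Steinhaus set K then serves all scales
   through the scaling relation. *)
pose G y := (\1_K y)%:E * g (a ^- n *: y)%R.
have G0 y : 0 <= G y by rewrite mule_ge0// lee_fin.
have mG : measurable_fun setT G.
  apply: emeasurable_funM; first exact/measurable_EFinP.
  by apply: (measurableT_comp mg); exact: measurable_scale.
pose h' := (a ^+ n *: h)%R.
have h'E : h' \in E by exact: memvZ.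
have h'r : (enorm h' < r)%R.
  by rewrite enormZ gtr0_norm// mulrC -ltr_pdivlMr.
have scaleK (z : V) : (a ^- n *: (a ^+ n *: z) = z)%R.
  by rewrite scalerA mulVf ?scale1r// lt0r_neq0.
have Ks z : K z -> (enorm z < s)%R.
  by move=> /Kp[]; rewrite /shell/= !mul1r => /andP[].
(* On the overlap of K and K + h' both indicators equal 1, so k is at most G y + G (y - h');
   translation invariance along E makes the two integrals equal, whence the factor 2. *)
have K2 : c%:E * k <= 2%:E * \int[H]_y G y.
  pose B := K `&` [set x | K (x - h')%R].
  have mB : measurable B.
    apply: measurableI => //; rewrite -[X in measurable X]setTI.
    rewrite (_ : [set x | K (x - h')%R] = (fun x => 1 *: x + (- h'))%R @^-1` K).
      exact: measurable_affine_rV.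
    by apply/funext => x; rewrite /preimage/= scale1r.
  apply: (@le_trans _ _ (\int[H]_y (k * (\1_B y)%:E))).
    rewrite ge0_integralZl//; last exact/measurable_EFinP.
    rewrite integral_indic// setIT muleC; apply: lee_wpmul2l => //.
    exact: HK.
  apply: (@le_trans _ _ (\int[H]_(y in [set: V]) (G y + G (y - h')%R))).
    apply: ge0_le_integral_pointwise => y _; first by rewrite mule_ge0// lee_fin.
    rewrite indicE; have [/set_mem[Ky /= Kyh]|_] := boolP (y \in B); last first.
      by rewrite mule0 adde_ge0.
    rewrite mule1 /G !indicE !mem_set// !mul1e scalerBr scaleK.
    apply: Hk; first by rewrite enormZ gtr0_norm// mulrC ltr_pM2r// Ks.
    rewrite -{1}(scaleK h) -scalerBr enormZ.
    by rewrite gtr0_norm// mulrC ltr_pM2r// Ks.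
  have mGh : measurable_fun setT (fun y : V => G (y - h')%R).
    apply: (measurableT_comp mG).
    rewrite (_ : (fun y => _) = (fun x : V => 1 *: x + (- h'))%R).
      exact: measurable_affine_rV.
    by apply/funext => x; rewrite scale1r.
  rewrite ge0_integralD//= ge0_integral_hausdorff_translate ?memvN//.
  by rewrite -mule2n mule_natl.
have vG : v%:E * \int[H]_y G y <= \int[with_density H f]_y G y.
  rewrite ge0_integral_with_density// -ge0_integralZl//; last by rewrite lee_fin ltW.
  apply: ge0_le_integral_pointwise => y _.
    by rewrite mule_ge0// lee_fin ltW.
  rewrite /G indicE; have [/set_mem/Kp[_ [/= vf _]]|_] := boolP (y \in K).
    by rewrite lee_wpmul2r// mule_ge0.
  by rewrite mul0e !mule0.
have GG : \int[with_density H f]_y G y =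
    ((a `^ (- alpha0)) ^+ n)%:E * \int[with_density H f]_y G (a ^+ n *: y)%R.
  apply: (@scaling_iter _ (1 - m0.+1%:R^-1)%R) => //.
  move=> z; rewrite /G indicE; have [/set_mem/Kp[_ [_ /= zm]] //|_] := boolP (z \in K).
  by rewrite mul0e eqxx.
(* K lies in the annulus of index n0, so its image under multiplication by a^-n lies in [shell s n]
   with s = a^-n0; there the density measure is dominated by nu. *)
have GA : \int[with_density H f]_y G (a ^+ n *: y)%R <= \int[nu]_(z in shell s n) g z.
  have mS : measurable (shell s n) by exact: measurable_shell.
  pose Hf : {measure set V -> \bar R} := density_measure (hausdorff_on E) mf f0.
  apply: (@le_trans _ _ (\int[with_density H f]_(z in shell s n) g z)).
    rewrite -[leRHS]/(\int[Hf]_(z in shell s n) g z) [leRHS]integral_mkcond.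
    apply: (@ge0_le_integral_pointwise _ _ _ Hf) => y _.
      exact: G0.
    rewrite /G indicE scaleK /patch.
    have [/set_mem Ky|_] := boolP (_ \in K); last by rewrite mul0e; case: ifP.
    rewrite mul1e ifT// mem_set// /shell/=.
    have [+ _] := Kp _ Ky; rewrite /shell/= !mul1r enormZ gtr0_norm//.
    move=> /andP[y1 y2]; apply/andP; split; last by rewrite ltr_pdivlMr// mulrC.
    have sE : s = (a * a ^- n0.+1)%R.
      by rewrite /s exprS invfM mulrA mulfV ?mul1r// lt0r_neq0.
    rewrite ler_pdivrMr// sE [in leRHS]exprS mulrCA ler_pM2l// [leRHS]mulrC.
    exact: y1.
  rewrite -[X in X <= _]/(\int[Hf]_(z in shell s n) g z).
  exact: ge0_le_measure_integral.
have b0 : (0 < (a `^ alpha0) ^+ n)%R by rewrite exprn_gt0// powR_gt0.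
apply: le_trans GA.
have <- : ((a `^ alpha0) ^+ n)%:E * \int[with_density H f]_y G y =
    \int[with_density H f]_y G (a ^+ n *: y)%R.
  by rewrite GG muleA -EFinM -exprMn powRN mulfV ?expr1n ?mul1e// lt0r_neq0// powR_gt0.
have -> : (v * c / 2 * (a `^ alpha0) ^+ n)%:E * k =
    ((a `^ alpha0) ^+ n)%:E * ((v / 2)%:E * (c%:E * k)).
  by rewrite !muleA -!EFinM; congr (_%:E * _); ring.
apply: lee_wpmul2l; first by rewrite lee_fin ltW.
apply: le_trans vG; have -> : v%:E * \int[H]_y G y =
    (v / 2)%:E * (2%:E * \int[H]_y G y).
  by rewrite !muleA -!EFinM; congr (_%:E * _); field.
by apply: lee_wpmul2l => //; rewrite lee_fin divr_ge0// ltW.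
Qed.

End directional_bound.

(** * Averages over balls *)

Section measurability_rV.
Context dT (T : measurableType dT) (R : realType) (d : nat).
Implicit Types f g : T -> 'rV[R]_d.

Lemma measurable_addrV f g : measurable_fun setT f -> measurable_fun setT g ->
  measurable_fun setT (fun t => f t + g t).
Proof.
move=> mf mg; apply: measurable_fun_rV => i.
rewrite (_ : (fun t => _) = (fun t => f t ord0 i + g t ord0 i)); last first.
  by apply/funext => t; rewrite mxE.
by apply: measurable_funD; apply: (measurableT_comp (measurable_coord i)).
Qed.

Lemma measurable_opprV f : measurable_fun setT f ->
  measurable_fun setT (fun t => - f t).
Proof.
move=> mf; rewrite (_ : (fun t => _) = (fun t => (-1) *: f t)).
  exact: (measurableT_comp (measurable_scale (-1))).
by apply/funext => t; rewrite scaleN1r.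
Qed.

Lemma measurable_enorm_comp f : measurable_fun setT f ->
  measurable_fun setT (fun t => enorm (f t)).
Proof. by move=> mf; apply: (measurableT_comp (@measurable_enorm R d)). Qed.

Lemma measurable_natr_bool (b : T -> bool) : measurable_fun setT b ->
  measurable_fun setT (fun t => (b t)%:R : R).
Proof. by move=> mb; apply: (measurableT_comp (f := fun b : bool => b%:R : R)). Qed.

Lemma measurable_ltr_ind (f g : T -> R) : measurable_fun setT f ->
  measurable_fun setT g -> measurable_fun setT (fun t => (f t < g t)%R%:R : R).
Proof. by move=> mf mg; apply: measurable_natr_bool; exact: measurable_fun_ltr. Qed.

Lemma measurable_ler_ind (f g : T -> R) : measurable_fun setT f ->
  measurable_fun setT g -> measurable_fun setT (fun t => (f t <= g t)%R%:R : R).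
Proof. by move=> mf mg; apply: measurable_natr_bool; exact: measurable_fun_ler. Qed.

Lemma measurable_comp_rV (u : 'rV[R]_d -> R) f : measurable_fun setT u ->
  measurable_fun setT f -> measurable_fun setT (fun t => u (f t)).
Proof. by move=> mu mf; apply: measurableT_comp. Qed.

Lemma measurable_funXn (f : T -> R) n : measurable_fun setT f ->
  measurable_fun setT (fun t => f t ^+ n).
Proof. exact: measurable_funX. Qed.

Lemma measurable_powR_comp (f : T -> R) p : measurable_fun setT f ->
  measurable_fun setT (fun t => f t `^ p).
Proof. by move=> mf; apply: (measurableT_comp (measurable_powR p)). Qed.

Lemma measurable_mulr (f g : T -> R) : measurable_fun setT f ->
  measurable_fun setT g -> measurable_fun setT (fun t => f t * g t).
Proof. exact: measurable_funM. Qed.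

Lemma measurable_addr (f g : T -> R) : measurable_fun setT f ->
  measurable_fun setT g -> measurable_fun setT (fun t => f t + g t).
Proof. exact: measurable_funD. Qed.

Lemma measurable_subr (f g : T -> R) : measurable_fun setT f ->
  measurable_fun setT g -> measurable_fun setT (fun t => f t - g t).
Proof. exact: measurable_funB. Qed.

Lemma measurable_EFin_comp (f : T -> R) : measurable_fun setT f ->
  measurable_fun setT (fun t => (f t)%:E).
Proof. by move/measurable_EFinP. Qed.

End measurability_rV.

Section measurability_proj.
Context d1 d2 d3 (T1 : measurableType d1) (T2 : measurableType d2)
  (T : measurableType d3).
Lemma measurable_fst_comp (f : T -> T1 * T2) : measurable_fun setT f ->
  measurable_fun setT (fun t => (f t).1).
Proof. by move=> mf; apply: (measurableT_comp measurable_fst). Qed.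
Lemma measurable_snd_comp (f : T -> T1 * T2) : measurable_fun setT f ->
  measurable_fun setT (fun t => (f t).2).
Proof. by move=> mf; apply: (measurableT_comp measurable_snd). Qed.
End measurability_proj.

Ltac meas := lazymatch goal with
  | |- measurable_fun _ (fun _ => ?c) => exact: measurable_cst
  | |- measurable_fun _ (fun t => t) => exact: measurable_id
  | |- measurable_fun _ (fun t => EFin (@?F t)) =>
      apply: measurable_EFin_comp; meas
  | |- measurable_fun _ (fun t => GRing.mul (@?F t) (@?G t)) =>
      apply: measurable_mulr; meas
  | |- measurable_fun _ (fun t => GRing.exp (@?F t) _) =>
      apply: measurable_funXn; meas
  | |- measurable_fun _ (fun t => powR (@?F t) _) =>
      apply: measurable_powR_comp; meas
  | |- measurable_fun _ (fun t => enorm (@?F t)) =>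
      apply: measurable_enorm_comp; meas
  | |- measurable_fun _ (fun t => fst (@?F t)) =>
      apply: measurable_fst_comp; meas
  | |- measurable_fun _ (fun t => snd (@?F t)) =>
      apply: measurable_snd_comp; meas
  | |- measurable_fun _ (fun t => Algebra.natmul _ (nat_of_bool (Order.lt (@?F t) (@?G t)))) =>
      apply: measurable_ltr_ind; meas
  | |- measurable_fun _ (fun t => Algebra.natmul _ (nat_of_bool (Order.le (@?F t) (@?G t)))) =>
      apply: measurable_ler_ind; meas
  | |- measurable_fun _ (fun t => Algebra.opp (@?F t)) =>
      apply: measurable_opprV; meas
  | |- measurable_fun _ (fun t => Algebra.add (@?F t) (Algebra.opp (@?G t))) =>
      first [apply: measurable_subr; meas
            |apply: measurable_addrV; [meas|apply: measurable_opprV; meas]]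
  | |- measurable_fun _ (fun t => Algebra.add (@?F t) (@?G t)) =>
      first [apply: measurable_addr; meas|apply: measurable_addrV; meas]
  | mu : measurable_fun _ ?u |- measurable_fun _ (fun t => ?u (@?F t)) =>
      apply: (measurable_comp_rV mu); meas
  | |- measurable_fun _ _ => first [assumption | exact: measurable_fst
                                   | exact: measurable_snd]
  end.

Ltac pos := rewrite ?lee_fin; repeat first
  [ assumption
  | exact: sqr_ge0
  | exact: ler0n
  | exact: enorm_ge0
  | exact: powR_ge0
  | (apply: ltW; assumption)
  | exact: ltW (ball_volume_gt0 _ _)
  | apply: exprn_ge0
  | rewrite invr_ge0
  | apply: mulr_ge0
  | apply: addr_ge0 ].

Section iterated_integrals.
Variables (R : realType) (d : nat).
Local Notation V := 'rV[R]_d.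
Local Notation lam := (lebesgue_rV R d).
Local Open Scope ereal_scope.
Variable sigma : {sigma_finite_measure set V -> \bar R}.

Lemma measurable_int_last dT (T : measurableType dT) (g : T * V -> \bar R) :
  measurable_fun setT g -> (forall t, 0 <= g t) ->
  measurable_fun setT (fun t => \int[lam]_y g (t, y)).
Proof. by move=> mg g0; exact: (measurable_fun_fubini_tonelli_F g). Qed.

Lemma tonelli3 (g : (V * V) * V -> \bar R) :
  measurable_fun setT g -> (forall t, 0 <= g t) ->
  \int[sigma]_z \int[lam]_x \int[lam]_y g ((z, x), y) =
  \int[lam]_x \int[lam]_y \int[sigma]_z g ((z, x), y).
Proof.
move=> mg g0.
pose F (p : V * V) := \int[lam]_y g (p, y).
have mF : measurable_fun setT F by exact: measurable_int_last.
rewrite (fubini_tonelli F)//; last by move=> p; exact: integral_ge0.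
apply: eq_integral => x _.
pose G (p : V * V) := g ((p.1, x), p.2).
have mG : measurable_fun setT G.
  apply: (measurableT_comp mg); apply: measurable_fun_pair => /=; last exact: measurable_snd.
  by apply: measurable_fun_pair => /=; [exact: measurable_fst|exact: measurable_cst].
by apply: (fubini_tonelli G) => // p; exact: g0.
Qed.

End iterated_integrals.

Section ball_integrals.
Variables (R : realType) (d : nat).
Local Notation V := 'rV[R]_d.
Local Notation lam := (lebesgue_rV R d).
Local Open Scope ereal_scope.

Lemma int_ball_ind (x : V) (r : R) : (0 < r)%R ->
  \int[lam]_y ((enorm (y - x) < r)%R%:R)%:E = (ball_volume R d * r ^+ d)%:E.
Proof.
move=> r0; rewrite -(lebesgue_eball x r0) -[eball x r]setIT.
rewrite -(integral_indic _ measurableT); last exact: measurable_eball.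
apply: eq_integral => y _; rewrite indicE.
have -> // : (y \in eball x r) = (enorm (y - x) < r)%R.
by apply/idP/idP => [/set_mem//|H]; exact/mem_set.
Qed.

(** P stands for the indicator of a region containing the ball of radius r at w; the pointwise bound
    on the region is integrated over this ball only. *)
Lemma ball_average (w : V) (r k : R) (P : V -> R) (g : V -> R) :
  (0 < r)%R -> (0 <= k)%R ->
  (forall p, (0 <= P p)%R) -> (forall p, (0 <= g p)%R) ->
  (forall p, (enorm (p - w) < r)%R -> P p = 1%R) ->
  (forall p, P p != 0%R -> (k <= g p)%R) ->
  (ball_volume R d * r ^+ d * k)%:E <= \int[lam]_p (P p * g p)%:E.
Proof.
move=> r0 k0 P0 g0 P1 kg.
rewrite mulrC EFinM -(int_ball_ind w r0) -ge0_integralZl//; last by meas.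
apply: ge0_le_integral_pointwise => p _; first by rewrite -EFinM lee_fin mulr_ge0.
rewrite -EFinM lee_fin; case: ltP => pw; last by rewrite mulr0 mulr_ge0.
by rewrite mulr1 P1// mul1r kg// P1// oner_neq0.
Qed.

End ball_integrals.

(** * The upper bound *)

Lemma sqrB_le2 (R : realFieldType) (p q r : R) :
  (r - p) ^+ 2 <= 2 * (q - p) ^+ 2 + 2 * (r - q) ^+ 2.
Proof.
rewrite -subr_ge0 (_ : _ - _ = ((q - p) - (r - q)) ^+ 2); first exact: sqr_ge0.
by ring.
Qed.

Section ball_geometry.
Variables (R : realType) (d : nat) (x0 : 'rV[R]_d) (rho : R).
Implicit Types x y z p : 'rV[R]_d.

Lemma enorm_midpoint x z r : enorm (x - x0) < r -> enorm (x + z - x0) < r ->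
  enorm (x + 2^-1 *: z - x0) < r.
Proof.
move=> h1 h2.
have -> : x + 2^-1 *: z - x0 = 2^-1 *: (x - x0) + 2^-1 *: (x + z - x0).
  rewrite -scalerDr; apply: (@scalerI _ _ (2 : R)); first by rewrite pnatr_eq0.
  by apply/rowP => i; rewrite !mxE; field.
rewrite (le_lt_trans (enormD _ _))// !enormZ ger0_norm ?invr_ge0//; lra.
Qed.

(* A point at depth e lies within e / 2 * 3 of every point of the ball of
   radius rho: move towards the centre. *)
Lemma ball_inner_point x e p : 0 < e -> e * 3 <= rho * 2 -> enorm (x - x0) < rho ->
  enorm (p - (x + (e * 3 / (rho * 2)) *: (x0 - x))) < e / 2 ->
  enorm (p - x) < 2 * e /\ enorm (p - x0) < rho - e.
Proof.
move=> e0 e3 xr; have rho0 : 0 < rho by exact: le_lt_trans (enorm_ge0 _) xr.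
set t := e * 3 / (rho * 2); set w := x + _ => pw.
have t0 : 0 <= t by rewrite divr_ge0 ?mulr_ge0// ltW.
have t1 : t <= 1 by rewrite ler_pdivrMr ?mul1r// mulr_gt0.
have trho : t * rho = e * 3 / 2 by rewrite /t; field; exact: lt0r_neq0.
have wx : enorm (w - x) <= t * rho.
  rewrite /w addrC addKr enormZ ger0_norm// ler_wpM2l// enormC; exact: ltW.
have wx0 : enorm (w - x0) <= rho - t * rho.
  have -> : w - x0 = (1 - t) *: (x - x0).
    by apply/rowP => i; rewrite !mxE; ring.
  have -> : rho - t * rho = (1 - t) * rho by ring.
  rewrite enormZ ger0_norm ?subr_ge0//.
  by rewrite ler_wpM2l ?subr_ge0// ltW.
split.
- by rewrite (le_lt_trans (enorm_triangle w _ _))//; lra.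
- by rewrite (le_lt_trans (enorm_triangle w _ _))//; lra.
Qed.

(** Take the midpoint of the chord and move it towards the centre by at most |z|/4: the ball of
    radius |z|/4 around the new point stays in D and within |z|/2 of the midpoint, hence within |z|
    of both ends. *)
Lemma ball_chord_point x z : z != 0 -> enorm (x - x0) < rho ->
  enorm (x + z - x0) < rho ->
  exists w, forall p, enorm (p - w) < enorm z / 4 ->
    [/\ enorm (p - x0) < rho, enorm (p - x) < enorm z &
        enorm (p - (x + z)) < enorm z].
Proof.
move=> z0 xr xzr; have rho0 : 0 < rho by exact: le_lt_trans (enorm_ge0 _) xr.
set r := enorm z; have r0 : 0 < r by rewrite enorm_gt0.
have r2 : r < rho * 2.
  have zE : z = (x + z - x0) - (x - x0) by rewrite opprB addrA subrK addrC addKr.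
  have := enormD (x + z - x0) (- (x - x0)); rewrite -zE enormN -/r; lra.
pose m := x + 2^-1 *: z; have mr := enorm_midpoint xr xzr.
exists (m + (r / (rho * 4)) *: (x0 - m)); set t := r / _; set w := m + _ => p pw.
have t0 : 0 <= t by rewrite divr_ge0 ?mulr_ge0// ltW.
have t1 : t <= 1 by rewrite ler_pdivrMr ?mul1r ?mulr_gt0//; lra.
have trho : t * rho = r / 4 by rewrite /t; field; exact: lt0r_neq0.
have wm : enorm (w - m) <= t * rho.
  rewrite /w addrC addKr enormZ ger0_norm// ler_wpM2l// enormC; exact: ltW.
have wx0 : enorm (w - x0) <= rho - t * rho.
  have -> : w - x0 = (1 - t) *: (m - x0).
    by apply/rowP => i; rewrite !mxE; ring.
  have -> : rho - t * rho = (1 - t) * rho by ring.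
  rewrite enormZ ger0_norm ?subr_ge0//.
  by rewrite ler_wpM2l ?subr_ge0// ltW.
have mx : enorm (m - x) = r / 2.
  by rewrite /m addrC addKr enormZ ger0_norm ?invr_ge0// mulrC.
have mxz : enorm (m - (x + z)) = r / 2.
  have -> : m - (x + z) = - (2^-1 *: z).
    by apply/rowP => i; rewrite /m !mxE; field.
  by rewrite enormN enormZ ger0_norm ?invr_ge0// mulrC.
have pm : enorm (p - m) < r / 2.
  by rewrite (le_lt_trans (enorm_triangle w _ _))//; lra.
split.
- by rewrite (le_lt_trans (enorm_triangle w _ _))//; lra.
- by rewrite (le_lt_trans (enorm_triangle m _ _))//; lra.
- by rewrite (le_lt_trans (enorm_triangle m _ _))//; lra.
Qed.

End ball_geometry.

Section upper_energy.
Variables (R : realType) (d : nat) (x0 : 'rV[R]_d) (rho : R) (u : 'rV[R]_d -> R).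
Local Notation V := 'rV[R]_d.
Local Notation lam := (lebesgue_rV R d).
Local Notation bl r x := ((enorm (x - x0) < r)%R%:R).
Local Notation nr r x y := ((enorm (y - x) < r)%R%:R).
Hypothesis mu_ : measurable_fun setT u.
Hypothesis rho01 : 0 < rho < 1.
Hypothesis d_gt0 : (0 < d)%N.
Local Open Scope ereal_scope.

Let psi (r : R) (x : V) :=
  \int[lam]_p (bl rho x * bl rho p * nr r x p * (u p - u x) ^+ 2)%:E.

Let measurable_psi r : measurable_fun setT (psi r).
Proof.
apply: (@measurable_int_last R d _ V (fun t : V * V =>
  (bl rho t.1 * bl rho t.2 * nr r t.1 t.2 * (u t.2 - u t.1) ^+ 2)%:E)).
  by meas.
by move=> t; pos.
Qed.

Let psi_ge0 r x : 0 <= psi r x.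
Proof. by apply: integral_ge0 => p _; pos. Qed.

(** Each increment is split at intermediate points p and averaged over them. The halves from x and
    from x + z have the same integral by translation invariance, so the two factors 2 add up to
    4. *)
Let chord_energy_le (z : V) : z != 0%R ->
  \int[lam]_x (bl rho x * bl rho (x + z) * (u (x + z) - u x) ^+ 2)%:E <=
  ((ball_volume R d * (enorm z / 4) ^+ d)^-1 * 4)%:E * \int[lam]_x psi (enorm z) x.
Proof.
move=> z0; set r := enorm z; have r0 : (0 < r)%R by rewrite enorm_gt0.
set b : R := (ball_volume R d * (r / 4) ^+ d)%R.
have b0 : (0 < b)%R by rewrite mulr_gt0 ?ball_volume_gt0// exprn_gt0// divr_gt0.
rewrite EFinM -muleA lee_pdivlMl//.
rewrite -ge0_integralZl//; last 3 first.
- by meas.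
- by move=> x _; pos.
- by rewrite lee_fin ltW.
have int4 : 4%:E * \int[lam]_x psi r x =
    \int[lam]_x (2%:E * psi r x + 2%:E * psi r (x + z)%R).
  have m2 : measurable_fun setT (fun x : V => psi r (x + z)%R).
    by apply: (measurableT_comp (measurable_psi r)); meas.
  rewrite [RHS]ge0_integralD//; last 4 first.
  - by move=> x _; apply: mule_ge0.
  - exact: measurable_funeM.
  - by move=> x _; apply: mule_ge0.
  - exact: measurable_funeM.
  rewrite !ge0_integralZl// ge0_integral_translate//.
  by rewrite -ge0_muleDl ?lee_fin// -EFinD; congr (_%:E * _); ring.
rewrite int4; apply: ge0_le_integral_pointwise => x _.
  by rewrite -EFinM; pos.
have psi20 y : 0 <= 2%:E * psi r y by rewrite mule_ge0.
case: ltP => [xr|_]; last by rewrite !mul0r mule0 adde_ge0.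
case: ltP => [xzr|_]; last by rewrite mulr0 mul0r mule0 adde_ge0.
rewrite !mul1r -EFinM.
have [w Hw] := ball_chord_point z0 xr xzr.
pose P p : R := (bl rho p * nr r x p * nr r (x + z) p)%R.
pose g p : R := (2 * (u p - u x) ^+ 2 + 2 * (u (x + z) - u p) ^+ 2)%R.
apply: (@le_trans _ _ (\int[lam]_p (P p * g p)%:E)).
  apply: (ball_average (w := w)) => //.
  - by rewrite divr_gt0.
  - exact: sqr_ge0.
  - by move=> p; rewrite /P; pos.
  - by move=> p; rewrite /g; pos.
  - by move=> p /Hw[h1 h2 h3]; rewrite /P h1 h2 h3 !mulr1.
  - by move=> p _; exact: sqrB_le2.
rewrite -!ge0_integralZl//; last 4 first.
- by meas.
- by move=> p _; pos.
- by meas.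
- by move=> p _; pos.
rewrite -ge0_integralD//; last 4 first.
- by move=> p _; rewrite -EFinM; pos.
- by apply: measurable_funeM; meas.
- by move=> p _; rewrite -EFinM; pos.
- by apply: measurable_funeM; meas.
apply: ge0_le_integral_pointwise => p _.
  by pos.
rewrite -!EFinM -EFinD lee_fin /P /g xr xzr !mul1r.
rewrite -(sqrrN (u p - u (x + z)))%R opprB.
case: (enorm (p - x0) < rho)%R; case: (enorm (p - x) < r)%R;
  case: (enorm (p - (x + z)) < r)%R; rewrite ?mul1r ?mul0r ?mulr0 ?addr0 ?add0r//.
all: by pos.
Qed.

(** With the sigma-integral innermost, a pair at distance s sees only the jumps with |z| > s; there
    |z|^-d is at most s^-d, and the tail bound supplies s^-alpha. Only s < 2 occurs, since both
    points lie in a ball of radius below 1. *)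
Lemma jump_energy_le (sigma : {sigma_finite_measure set V -> \bar R}) (C alpha : R) :
  (0 <= C)%R ->
  (forall s : R, (0 < s < 2)%R ->
     sigma [set z | (s < enorm z)%R] <= (C * s `^ (- alpha))%:E) ->
  \int[lam]_x \int[sigma]_z (bl rho x * bl rho (x + z) * (u (x + z) - u x) ^+ 2)%:E
  <= ((ball_volume R d)^-1 * 4 ^+ d.+1 * C)%:E *
   \int[lam]_x \int[lam]_y (bl rho x * bl rho y * (u y - u x) ^+ 2 *
      enorm (y - x) `^ (- d%:R - alpha))%:E.
Proof.
move=> C0 Hs; have /andP[rho0 rho1] := rho01.
set c : R := ((ball_volume R d)^-1 * 4 ^+ d.+1)%R.
have c0 : (0 < c)%R by rewrite mulr_gt0 ?invr_gt0 ?ball_volume_gt0// exprn_gt0.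
have mF : measurable_fun setT (fun t : V * V =>
   (bl rho t.1 * bl rho (t.1 + t.2)%R * (u (t.1 + t.2) - u t.1) ^+ 2)%:E : \bar R).
  by meas.
rewrite (fubini_tonelli (m1 := lam) (m2 := sigma) (fun t : V * V =>
   (bl rho t.1 * bl rho (t.1 + t.2)%R * (u (t.1 + t.2) - u t.1) ^+ 2)%:E))//=;
   last by move=> t; pos.
pose G (t : V * V * V) : R := (c * (enorm t.1.1 ^+ d)^-1 * (bl rho t.1.2 * bl rho t.2 *
  (enorm (t.2 - t.1.2) < enorm t.1.1)%R%:R * (u t.2 - u t.1.2) ^+ 2))%R.
have G0 t : 0 <= (G t)%:E.
  by rewrite /G; pos.
have mG : measurable_fun setT (fun t => (G t)%:E).
  apply: measurable_EFin_comp; apply: measurable_mulr; last by meas.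
  apply: measurable_mulr; first by meas.
  rewrite (_ : (fun t : V * V * V => _) = (fun t => enorm t.1.1 `^ (- d%:R))%R).
    by meas.
  apply/funext => t; rewrite powRN powR_mulrn// enorm_ge0//.
apply: (@le_trans _ _ (\int[sigma]_z \int[lam]_x \int[lam]_y (G (z, x, y))%:E)).
  apply: ge0_le_integral_pointwise => z _.
    by apply: integral_ge0 => x _; pos.
  have [->|z0] := eqVneq z 0%R.
    rewrite integral0_eq; first by apply: integral_ge0 => x _; apply: integral_ge0.
    by move=> x _; rewrite addr0 subrr expr0n mulr0.
  apply: (le_trans (chord_energy_le z0)).
  rewrite -ge0_integralZl//; last first.
    by pos.
  apply: ge0_le_integral_pointwise => x _.
    by apply: mule_ge0 => //; pos.
  rewrite -ge0_integralZl//; last 3 first.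
  - by meas.
  - by move=> p _; pos.
  - by pos.
  rewrite le_eqVlt; apply/orP; left; apply/eqP; apply: eq_integral => p _.
  rewrite -EFinM /G/= /c; congr ((_ * _)%:E).
  have q0 : (4 ^+ d != 0 :> R)%R by rewrite expf_neq0.
  have p0 : (enorm z ^+ d != 0)%R by rewrite expf_neq0// enorm_eq0.
  rewrite expr_div_n [(4 ^+ d.+1)%R]exprS.
  have E (b e q : R) : (b != 0 -> e != 0 -> q != 0 ->
      (b * (e / q))^-1 * 4 = b^-1 * (4 * q) / e)%R.
    by move=> b0 e1 q1; field; rewrite b0 e1 q1.
  by rewrite E// lt0r_neq0// ball_volume_gt0.
rewrite (tonelli3 _ mG G0) -ge0_integralZl//; last 3 first.
- apply: (measurable_int_last (g := fun t : V * V => (bl rho t.1 * bl rho t.2 *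
    (u t.2 - u t.1) ^+ 2 * enorm (t.2 - t.1) `^ (- d%:R - alpha))%:E)).
    by meas.
  by move=> t; pos.
- by move=> x _; apply: integral_ge0 => y _; pos.
- by pos.
apply: ge0_le_integral_pointwise => x _.
  by apply: integral_ge0 => y _; apply: integral_ge0.
rewrite -ge0_integralZl//; last 3 first.
- by meas.
- by move=> p _; pos.
- by pos.
apply: ge0_le_integral_pointwise => y _; first exact: integral_ge0.
set A : R := (bl rho x * bl rho y * (u y - u x) ^+ 2)%R.
have [A0|A0] := eqVneq A 0%R.
  rewrite integral0_eq; first by rewrite A0 mul0r mule0.
  move=> z _; rewrite /G/=.
  have -> : (bl rho x * bl rho y * (enorm (y - x) < enorm z)%R%:R *
      (u y - u x) ^+ 2 = A * (enorm (y - x) < enorm z)%R%:R)%R.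
    by rewrite /A; ring.
  by rewrite A0 mul0r mulr0.
set s := enorm (y - x).
have s0 : (0 < s)%R.
  rewrite enorm_gt0 subr_eq0; apply: contra_neq A0 => yx.
  by rewrite /A yx subrr expr0n mulr0.
have Age0 : (0 <= A)%R by rewrite /A; pos.
have Ac0 : (0 <= A * c)%R by exact: mulr_ge0 Age0 (ltW c0).
have s2 : (s < 2)%R.
  move: A0; rewrite /A; case: ltP => xr; last by rewrite !mul0r eqxx.
  case: ltP => yr; last by rewrite mulr0 mul0r eqxx.
  move=> _; rewrite (le_lt_trans (enorm_triangle x0 _ _))// [X in (_ + X < _)%R]enormC.
  lra.
have mS : measurable [set z : V | (s < enorm z)%R].
  rewrite (_ : [set z | _] = @enorm R d @^-1` `]s, +oo[%classic).
    by rewrite -[X in measurable X]setTI; exact: measurable_enorm.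
  by apply/seteqP; split => z /=; rewrite in_itv/= andbT.
apply: (@le_trans _ _ (\int[sigma]_z
   ((A * c * (s ^+ d)^-1)%:E * (\1_[set z : V | (s < enorm z)%R] z)%:E))).
  apply: ge0_le_integral_pointwise => z _; first exact: G0.
  rewrite -EFinM lee_fin /G/= indicE.
  have -> : (z \in [set z : V | (s < enorm z)%R]) = (s < enorm z)%R.
    by apply/idP/idP => [/set_mem/=|sz]; [|apply: mem_set].
  rewrite -/s; case: (ltP s (enorm z)) => [sz|_]; last by rewrite !(mulr0,mul0r).
  rewrite !mulr1 -/A [leLHS]mulrC mulrA ler_wpM2l//.
  rewrite lef_pV2 ?posrE ?exprn_gt0// ?(lt_trans s0)//.
  by rewrite lerXn2r ?nnegrE ?(ltW s0) ?enorm_ge0// ltW.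
have A'0 : (0 <= A * c * (s ^+ d)^-1)%R.
  by rewrite mulr_ge0// invr_ge0 exprn_ge0// ltW.
rewrite ge0_integralZl//; last exact/measurable_EFinP.
rewrite integral_indic// setIT.
apply: (@le_trans _ _ ((A * c * (s ^+ d)^-1)%:E * (C * s `^ (- alpha))%:E)).
  by apply: lee_wpmul2l => //; apply: Hs; rewrite s0.
rewrite -!EFinM lee_fin powRD ?(lt0r_neq0 s0) ?implybT//.
rewrite [(s `^ (- d%:R))%R]powRN powR_mulrn ?(ltW s0)//.
rewrite le_eqVlt; apply/orP; left; apply/eqP; ring.
Qed.

End upper_energy.

(** * The lower bound *)

Section interior_energy.
Variables (R : realType) (d : nat) (x0 : 'rV[R]_d) (rho : R) (u : 'rV[R]_d -> R).
Local Notation V := 'rV[R]_d.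
Local Notation lam := (lebesgue_rV R d).
Local Notation bl r x := ((enorm (x - x0) < r)%R%:R).
Local Notation nr r x y := ((enorm (y - x) < r)%R%:R).
Local Notation vol := (ball_volume R d).
Hypothesis mu_ : measurable_fun setT u.
Local Open Scope ereal_scope.

(** The two variables have separate radii because they are pushed inwards one at a time. *)
Definition near_energy (r1 r2 r : R) : \bar R := \int[lam]_x \int[lam]_y
  (bl r1 x * bl r2 y * nr r x y * (u y - u x) ^+ 2)%:E.

(** Only the starting point is confined. Displacements can then be concatenated, each one merely
    enlarging the radius for the next. *)
Definition increment_energy (r : R) (h : V) : \bar R :=
  \int[lam]_x (bl r x * (u (x + h) - u x) ^+ 2)%:E.

Definition chord_energy (r : R) (h : V) : \bar R :=
  \int[lam]_x (bl r x * bl r (x + h)%R * (u (x + h) - u x) ^+ 2)%:E.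

Lemma increment_energy_ge0 r h : 0 <= increment_energy r h.
Proof. by apply: integral_ge0 => x _; pos. Qed.

Lemma chord_energy_ge0 r h : 0 <= chord_energy r h.
Proof. by apply: integral_ge0 => x _; pos. Qed.

Lemma near_energy_ge0 r1 r2 r : 0 <= near_energy r1 r2 r.
Proof. by apply: integral_ge0 => x _; apply: integral_ge0 => y _; pos. Qed.

Lemma measurable_chord_energy r : measurable_fun setT (chord_energy r).
Proof.
apply: (@measurable_int_last R d _ V (fun t : V * V =>
  (bl r t.2 * bl r (t.2 + t.1)%R * (u (t.2 + t.1) - u t.2) ^+ 2)%:E)).
  by meas.
by move=> t; pos.
Qed.

Lemma int_ball_ind_sym (p : V) (r : R) : (0 < r)%R ->
  \int[lam]_x (nr r x p)%:E = (vol * r ^+ d)%:E.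
Proof.
move=> r0; rewrite -(int_ball_ind p r0).
by apply: eq_integral => x _; rewrite enormC.
Qed.

Lemma near_energy_mono (r1 r2 r s1 s2 s : R) :
  (r1 <= s1)%R -> (r2 <= s2)%R -> (r <= s)%R ->
  near_energy r1 r2 r <= near_energy s1 s2 s.
Proof.
move=> h1 h2 h; apply: ge0_le_integral_pointwise => x _.
  by apply: integral_ge0 => y _; pos.
apply: ge0_le_integral_pointwise => y _; first by pos.
rewrite lee_fin ler_wpM2r ?sqr_ge0//.
have B (t t1 t2 : R) : (t1 <= t2)%R -> ((t < t1)%R%:R <= (t < t2)%R%:R :> R)%R.
  by move=> t12; case: (ltP t t1) => // tt1; rewrite (lt_le_trans tt1 t12).
by rewrite ler_pM ?ler_pM ?mulr_ge0// B.
Qed.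

(* Average over points p near x at depth at least e: the increment from x to p
   is short, and the one from p to y starts in the interior. *)
Lemma near_energy_push (e r r2 : R) : (0 < e)%R -> (e * 3 <= rho * 2)%R ->
  (0 < r)%R -> (r2 <= rho)%R ->
  (vol * (e / 2) ^+ d)%:E * near_energy rho r2 r <=
  (2 * (vol * r ^+ d))%:E * near_energy rho rho (2 * e) +
  (2 * (vol * (2 * e) ^+ d))%:E * near_energy r2 (rho - e) (r + 2 * e).
Proof.
move=> e0 e3 r0 r2rho; set b : R := (vol * (e / 2) ^+ d)%R.
have e20 : (0 < 2 * e)%R by rewrite mulr_gt0.
have b0 : (0 <= b)%R by rewrite /b; pos; rewrite divr_ge0// ltW.
pose psi x := \int[lam]_p (bl rho x * bl rho p * nr (2 * e) x p * (u p - u x) ^+ 2)%:E.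
have psi0 x : 0 <= psi x by apply: integral_ge0 => p _; pos.
have mpsi : measurable_fun setT psi.
  apply: (@measurable_int_last R d _ V (fun t : V * V =>
    (bl rho t.1 * bl rho t.2 * nr (2 * e) t.1 t.2 * (u t.2 - u t.1) ^+ 2)%:E)).
    by meas.
  by move=> t; pos.
pose g2 (t : V * V * V) : \bar R := (2 * (bl r2 t.1.2 * bl (rho - e)%R t.2 *
  nr (r + 2 * e)%R t.1.2 t.2 * (u t.2 - u t.1.2) ^+ 2 * nr (2 * e) t.1.1 t.2))%:E.
have g20 t : 0 <= g2 t by rewrite /g2; pos.
have mg2 : measurable_fun setT g2 by rewrite /g2; meas.
(* In T1 the variable y enters only through the indicator of |y - x| < r, in T2 the variable x only
   through that of |p - x| < 2e; integrating them out gives the volumes of balls of radii r and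
   2e. *)
pose T1 x (y : V) := 2%:E * psi x * (nr r x y)%:E.
have T10 x y : 0 <= T1 x y by rewrite /T1 !mule_ge0// lee_fin.
pose T2 x y := \int[lam]_p g2 ((x, y), p).
have T20 x y : 0 <= T2 x y by apply: integral_ge0.
have mT2 : measurable_fun setT (fun t : V * V => T2 t.1 t.2).
  rewrite (_ : (fun t : V * V => _) = (fun t => \int[lam]_p g2 (t, p))).
    exact: measurable_int_last.
  by apply/funext => -[].
have pointwise x y : b%:E * (bl rho x * bl r2 y * nr r x y * (u y - u x) ^+ 2)%:E <=
    T1 x y + T2 x y.
  case: (ltP (enorm (x - x0)) rho) => xr; last first.
    by rewrite !mul0r mule0 adde_ge0.
  case: (ltP (enorm (y - x0)) r2) => yr; last first.
    by rewrite mulr0 !mul0r mule0 adde_ge0.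
  case: (ltP (enorm (y - x)) r) => xy; last first.
    by rewrite mulr0 !mul0r mule0 adde_ge0.
  rewrite /T1 xy !mul1r mule1 -EFinM.
  pose P p : R := (nr (2 * e) x p * bl (rho - e)%R p)%R.
  pose g p : R := (2 * (u p - u x) ^+ 2 + 2 * (u y - u p) ^+ 2)%R.
  apply: (@le_trans _ _ (\int[lam]_p (P p * g p)%:E)).
    apply: (ball_average (w := (x + (e * 3 / (rho * 2)) *: (x0 - x))%R)).
    - by rewrite divr_gt0.
    - exact: sqr_ge0.
    - by move=> p; rewrite /P; pos.
    - by move=> p; rewrite /g; pos.
    - by move=> p /(ball_inner_point e0 e3 xr)[h1 h2]; rewrite /P h1 h2 mulr1.
    - by move=> p _; exact: sqrB_le2.
  rewrite /T2 /psi -ge0_integralZl//; last 2 first.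
  - by meas.
  - by move=> p _; pos.
  rewrite -ge0_integralD//; last 3 first.
  - by move=> p _; rewrite -EFinM; pos.
  - by apply: measurable_funeM; meas.
  - apply: (measurableT_comp mg2); exact: pair1_measurable.
  apply: ge0_le_integral_pointwise => p _; first by rewrite /P /g; pos.
  rewrite -EFinM -EFinD lee_fin /P /g xr yr !mul1r /=.
  case: (ltP (enorm (p - x)) (2 * e)%R) => px; last by rewrite !(mul0r,mulr0,addr0).
  case: (ltP (enorm (p - x0)) (rho - e)%R) => pr; last first.
    by rewrite !(mul0r,mulr0,mul1r,addr0,mulr1); pos.
  have -> : (enorm (p - x0) < rho)%R by rewrite (lt_trans pr)// ltrBlDr ltrDl.
  have -> : (enorm (p - y) < r + 2 * e)%R.
    by rewrite (le_lt_trans (enorm_triangle x _ _))// addrC ltrD// enormC.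
  by rewrite !(mul1r, mulr1) -(sqrrN (u p - u y))%R opprB.
rewrite /near_energy -ge0_integralZl//; last 2 first.
- apply: (measurable_int_last (g := fun t : V * V => (bl rho t.1 * bl r2 t.2 *
    nr r t.1 t.2 * (u t.2 - u t.1) ^+ 2)%:E)); first by meas.
  by move=> t; pos.
- by move=> x _; apply: integral_ge0 => y _; pos.
apply: (@le_trans _ _ (\int[lam]_x \int[lam]_y (T1 x y + T2 x y))).
  apply: ge0_le_integral_pointwise => x _.
    by apply: mule_ge0; [rewrite lee_fin|apply: integral_ge0 => y _; pos].
  rewrite -ge0_integralZl//; last 2 first.
  - by meas.
  - by move=> p _; pos.
  apply: ge0_le_integral_pointwise => y _; first by rewrite -EFinM; pos.
  exact: pointwise.
have mT1 x : measurable_fun setT (T1 x).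
  by apply: measurable_funeM; meas.
have mT2x x : measurable_fun setT (T2 x).
  by apply: (measurableT_comp mT2); exact: pair1_measurable.
have intT1 x : \int[lam]_y T1 x y = (2 * (vol * r ^+ d))%:E * psi x.
  transitivity (2%:E * psi x * \int[lam]_y (nr r x y)%:E).
    apply: ge0_integralZl => //; first by meas.
    by apply: mule_ge0.
  by rewrite int_ball_ind// muleAC -EFinM.
rewrite (eq_integral (fun x => (2 * (vol * r ^+ d))%:E * psi x + \int[lam]_y T2 x y)); last first.
  by move=> x _; rewrite [LHS]ge0_integralD// intT1.
have c1 : (0 <= 2 * (vol * r ^+ d))%R by pos.
have c2 : (0 <= 2 * (vol * (2 * e) ^+ d))%R by pos.
rewrite ge0_integralD//; last 4 first.
- by move=> x _; apply: mule_ge0.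
- exact: measurable_funeM.
- by move=> x _; apply: integral_ge0.
- exact: (measurable_int_last (g := fun t => T2 t.1 t.2)).
apply: leeD; first by rewrite ge0_integralZl.
rewrite (tonelli3 _ mg2 g20) le_eqVlt; apply/orP; left; apply/eqP.
rewrite -ge0_integralZl//; last 2 first.
- apply: (measurable_int_last (g := fun t : V * V => (bl r2 t.1 * bl (rho - e)%R t.2 *
    nr (r + 2 * e)%R t.1 t.2 * (u t.2 - u t.1) ^+ 2)%:E)); first by meas.
  by move=> t; pos.
- by move=> x _; apply: integral_ge0 => y _; pos.
apply: eq_integral => y _; rewrite -ge0_integralZl//; last 2 first.
- by meas.
- by move=> p _; pos.
apply: eq_integral => p _; rewrite /g2/=.
set W := (_ * _ * _ * _)%R.
have W0 : (0 <= W)%R by rewrite /W; pos.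
have -> : \int[lam]_x (2 * (W * nr (2 * e) x p))%:E =
    (2 * W)%:E * \int[lam]_x (nr (2 * e) x p)%:E.
  under eq_integral do rewrite mulrA EFinM.
  apply: ge0_integralZl => //; first by meas.
  by pos.
by rewrite int_ball_ind_sym// -!EFinM; congr EFin; ring.
Qed.

Lemma near_energy_le_chord (rk r : R) (M : \bar R) : (0 < r)%R -> 0 <= M ->
  (forall h, (enorm h < r)%R -> chord_energy rk h <= M) ->
  near_energy rk rk r <= (vol * r ^+ d)%:E * M.
Proof.
move=> r0 M0 HM.
pose g (t : V * V) : \bar R := (bl rk t.1 * bl rk (t.1 + t.2)%R *
  (enorm t.2 < r)%R%:R * (u (t.1 + t.2) - u t.1) ^+ 2)%:E.
have mg : measurable_fun setT g by rewrite /g; meas.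
have g0 t : 0 <= g t by rewrite /g; pos.
have -> : near_energy rk rk r = \int[lam]_x \int[lam]_h g (x, h).
  apply: eq_integral => x _; rewrite /g/=.
  rewrite -(@ge0_integral_translate _ _ x); last 2 first.
  - by meas.
  - by move=> y; pos.
  by apply: eq_integral => h _; rewrite addrK [(x + h)%R]addrC.
rewrite (fubini_tonelli g)//.
have -> : (vol * r ^+ d)%:E * M = \int[lam]_(h in [set: V]) (M * (nr r (0 : V) h)%:E).
  rewrite ge0_integralZl//; last by meas.
  by rewrite int_ball_ind// muleC.
apply: ge0_le_integral_pointwise => h _; first by apply: integral_ge0.
rewrite subr0; case: (ltP (enorm h) r) => hr; last first.
  by rewrite mule0 integral0_eq// => x _; rewrite /g/= (le_gtF hr) mulr0 mul0r.
rewrite mule1; apply: le_trans (HM h hr).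
apply: ge0_le_integral_pointwise => x _; first exact: g0.
by rewrite /g/= hr mulr1.
Qed.

(** The midpoint of a chord stays in the ball by convexity, so halving a displacement loses no
    depth, in contrast with concatenation of arbitrary displacements. *)
Lemma chord_energy_half (rk : R) (h : V) :
  chord_energy rk h <= 4%:E * chord_energy rk (2^-1 *: h)%R.
Proof.
pose k := (2^-1 *: h)%R.
have hk : h = (k + k)%R.
  by rewrite /k -scalerDl (_ : (2^-1 + 2^-1 = 1 :> R)%R) ?scale1r//; field.
pose G (x : V) : R := (bl rk x * bl rk (x + k)%R * (u (x + k) - u x) ^+ 2)%R.
have mG : measurable_fun setT (fun x => (G x)%:E) by rewrite /G; meas.
have G0 x : 0 <= (G x)%:E by rewrite /G; pos.
have mGk : measurable_fun setT (fun x : V => (G (x + k)%R)%:E) by rewrite /G; meas.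
have -> : 4%:E * chord_energy rk k =
   \int[lam]_(x in [set: V]) (2%:E * (G x)%:E + 2%:E * (G (x + k)%R)%:E).
  rewrite [RHS]ge0_integralD//; last 4 first.
  - by move=> x _; apply: mule_ge0.
  - exact: measurable_funeM.
  - by move=> x _; apply: mule_ge0.
  - exact: measurable_funeM.
  rewrite !ge0_integralZl//.
  rewrite (@ge0_integral_translate _ _ k (fun x => (G x)%:E))//.
  by rewrite -ge0_muleDl ?lee_fin// -EFinD; congr (_%:E * _); ring.
apply: ge0_le_integral_pointwise => x _; first by pos.
rewrite -!EFinM -EFinD lee_fin /G -[(x + k + k)%R]addrA -hk.
case: (ltP (enorm (x - x0)) rk) => xr; last by rewrite !mul0r; pos.
case: (ltP (enorm (x + h - x0)) rk) => xhr; last by rewrite mulr0 mul0r; pos.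
by rewrite (enorm_midpoint xr xhr) !mul1r; exact: sqrB_le2.
Qed.

Lemma chord_energy_pow2 (rk : R) (j : nat) (h : V) :
  chord_energy rk h <= (4 ^+ j)%:E * chord_energy rk (2 ^- j *: h)%R.
Proof.
elim: j h => [|j ih] h; first by rewrite expr0 invr1 scale1r mul1e.
apply: (le_trans (ih h)); rewrite exprSr EFinM -muleA.
apply: lee_wpmul2l; first by rewrite lee_fin exprn_ge0.
apply: (le_trans (chord_energy_half _ _)).
by rewrite scalerA -invfM -exprS.
Qed.

Lemma chord_le_increment (rk : R) (h : V) :
  chord_energy rk h <= increment_energy rk h.
Proof.
apply: ge0_le_integral_pointwise => x _; first by pos.
rewrite lee_fin ler_wpM2r ?sqr_ge0// ler_piMr//.
by case: (_ < _)%R.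
Qed.

Lemma increment_energy_mono (r s : R) (h : V) : (r <= s)%R ->
  increment_energy r h <= increment_energy s h.
Proof.
move=> rs; apply: ge0_le_integral_pointwise => x _; first by pos.
rewrite lee_fin ler_wpM2r ?sqr_ge0//.
by case: (ltP _ r) => // xr; rewrite (lt_le_trans xr rs).
Qed.

Lemma increment_energyD (r e : R) (h k : V) : (enorm h <= e)%R ->
  increment_energy r (h + k)%R <=
  2%:E * increment_energy r h + 2%:E * increment_energy (r + e) k.
Proof.
move=> he.
pose F (x : V) : R := (bl r x * (u (x + h) - u x) ^+ 2)%R.
pose G (x : V) : R := (bl (r + e)%R x * (u (x + k) - u x) ^+ 2)%R.
have mF : measurable_fun setT (fun x => (F x)%:E) by rewrite /F; meas.
have mG : measurable_fun setT (fun x => (G x)%:E) by rewrite /G; meas.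
have F0 x : 0 <= (F x)%:E by rewrite /F; pos.
have G0 x : 0 <= (G x)%:E by rewrite /G; pos.
have mGh : measurable_fun setT (fun x : V => (G (x + h)%R)%:E) by rewrite /G; meas.
have -> : 2%:E * increment_energy r h + 2%:E * increment_energy (r + e) k =
   \int[lam]_(x in [set: V]) (2%:E * (F x)%:E + 2%:E * (G (x + h)%R)%:E).
  rewrite [RHS]ge0_integralD//; last 4 first.
  - by move=> x _; apply: mule_ge0.
  - exact: measurable_funeM.
  - by move=> x _; apply: mule_ge0.
  - exact: measurable_funeM.
  rewrite !ge0_integralZl//.
  by rewrite (@ge0_integral_translate _ _ h (fun x => (G x)%:E)).
apply: ge0_le_integral_pointwise => x _; first by pos.
rewrite -!EFinM -EFinD lee_fin /F /G.
case: (ltP (enorm (x - x0)) r) => xr; last by rewrite !mul0r; pos.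
have -> : (enorm (x + h - x0) < r + e)%R.
  rewrite -addrA [(h - x0)%R]addrC addrA.
  by rewrite (le_lt_trans (enormD _ _))// ltr_leD.
by rewrite !mul1r addrA; exact: sqrB_le2.
Qed.

Lemma increment_energy0 (r : R) : increment_energy r 0%R = 0.
Proof. by apply: integral0_eq => x _; rewrite addr0 subrr expr0n mulr0. Qed.

(** The coefficient solves c' = 2 + 2c with c = 0 for the empty sum, and each summand uses up e of
    the radius. *)
Lemma increment_energy_sum (r e rmax : R) (M : \bar R) (hs : seq V) :
  0 <= M -> (0 <= e)%R -> (forall h, h \in hs -> (enorm h <= e)%R) ->
  (r + (size hs)%:R * e <= rmax)%R ->
  (forall h, h \in hs -> increment_energy rmax h <= M) ->
  increment_energy r (\sum_(h <- hs) h)%R <= (2 ^+ (size hs).+1 - 2)%:E * M.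
Proof.
move=> M0 e0; elim: hs r => [|h hs ih] r he re HM.
  by rewrite big_nil increment_energy0 expr1 subrr mul0e.
have hsr : (r + e + (size hs)%:R * e <= rmax)%R.
  by apply: le_trans re; rewrite /= -natr1; lra.
rewrite big_cons; apply: (le_trans (@increment_energyD r e _ _ _)).
  by apply: he; rewrite mem_head.
have h1 : increment_energy r h <= M.
  apply: le_trans (HM h (mem_head _ _)); apply: increment_energy_mono.
  by apply: le_trans re; rewrite lerDl mulr_ge0.
have h2 : increment_energy (r + e) (\sum_(h <- hs) h)%R <=
    (2 ^+ (size hs).+1 - 2)%:E * M.
  by apply: ih => // k khs; [apply: he|apply: HM]; rewrite inE khs orbT.
apply: (@le_trans _ _ (2%:E * M + 2%:E * ((2 ^+ (size hs).+1 - 2)%:E * M))).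
  by apply: leeD; apply: lee_wpmul2l.
have q0 : (0 <= 2 ^+ (size hs).+1 - 2 :> R)%R.
  by rewrite subr_ge0 exprS ler_peMr// exprn_ege1// ler1n.
rewrite muleA -EFinM -ge0_muleDl ?lee_fin ?mulr_ge0// -EFinD.
rewrite le_eqVlt; apply/orP; left; apply/eqP; congr (_%:E * _).
by rewrite /= [in RHS]exprS; ring.
Qed.

End interior_energy.

Section geometric_sums.
Variables (R : realType) (a b X : R).
Hypotheses (a1 : 1 < a) (ab : a <= b).

(** A geometric sum is comparable to its last term. The factor depends on a only, which gives
    uniformity in alpha when b = a^(d + alpha). *)
Lemma sum_geometric_le N : \sum_(0 <= n < N.+1) b ^+ n <= b ^+ N * (a / (a - 1)).
Proof.
have a10 : 0 < a - 1 by rewrite subr_gt0.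
have b0 : 0 < b by rewrite (lt_le_trans _ ab)// (lt_trans _ a1).
elim: N => [|N ih].
  by rewrite big_nat1 !expr0 mul1r ler_pdivlMr// mul1r gerBl.
rewrite big_nat_recr//= (le_trans (lerD ih (lexx _)))//.
rewrite -subr_ge0 (_ : _ - _ = b ^+ N * (b - a) / (a - 1)).
  by rewrite divr_ge0 ?(ltW a10)// mulr_ge0 ?subr_ge0// exprn_ge0// ltW.
by rewrite exprS; field; exact: lt0r_neq0.
Qed.

Lemma sum_geometric_truncated_le (M : R) N : 0 <= M ->
  (forall n, a ^+ n < X -> b ^+ n <= M) ->
  \sum_(0 <= n < N) b ^+ n * (a ^+ n < X)%R%:R <= M * (a / (a - 1)).
Proof.
move=> M0 HM; have a10 : 0 < a - 1 by rewrite subr_gt0.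
have a0 : 0 < a by exact: lt_trans a1.
have b0 : 0 < b by exact: lt_le_trans ab.
have q0 : 0 <= a / (a - 1) by rewrite divr_ge0// ltW.
elim: N => [|N ih]; first by rewrite big_nil mulr_ge0.
(* Terms with a^N >= X vanish and are dropped; at the last remaining index the full geometric sum is
   bounded through its last term. *)
have [aX|aX] := ltP (a ^+ N) X; last first.
  by rewrite big_nat_recr//= ltNge aX/= mulr0 addr0.
apply: (@le_trans _ _ (\sum_(0 <= n < N.+1) b ^+ n)).
  apply: ler_sum => n _; rewrite ler_piMr ?exprn_ge0 ?(ltW b0)//.
  by case: (_ < _).
by rewrite (le_trans (sum_geometric_le N))// ler_wpM2r// HM.
Qed.

End geometric_sums.

(** The conclusion of [directional_lower_bound], with a free growth rate b: it is a^alpha0 for the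
    original measure and becomes a^alpha after interpolation. *)
Definition directional (R : realType) (d : nat) (sigma : set 'rV[R]_d -> \bar R)
    (a s r c b : R) (E : {vspace 'rV[R]_d}) : Prop :=
  forall n (h : 'rV[R]_d) (k : \bar R) (g : 'rV[R]_d -> \bar R),
    h \in E -> enorm h < r * a ^- n -> (0 <= k)%E ->
    measurable_fun setT g -> (forall z, 0 <= g z)%E ->
    (forall z, enorm z < s * a ^- n -> enorm (z - h) < s * a ^- n ->
      (k <= g z + g (z - h)%R)%E) ->
    ((c * b ^+ n)%:E * k <= \int[sigma]_(z in shell a s n) g z)%E.

Section directional_increments.
Variables (R : realType) (d : nat) (x0 : 'rV[R]_d) (rho : R) (u : 'rV[R]_d -> R).
Local Notation V := 'rV[R]_d.
Local Notation lam := (lebesgue_rV R d).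
Local Notation bl r x := ((enorm (x - x0) < r)%R%:R).
Hypothesis mu_ : measurable_fun setT u.
Variable a : R.
Hypothesis a1 : 1 < a.
Local Open Scope ereal_scope.

Let ian0 n : (0 < a ^- n)%R.
Proof. by rewrite invr_gt0 exprn_gt0// (lt_trans _ a1). Qed.

(** The jumps z from x and z - h from x + h end at the same point, so u (x + h) - u x is a
    difference of two increments along jumps. Depth 2 a^-n keeps x, x + h and x + z in the ball. In
    dimension 0 only h = 0 occurs. *)
Lemma increment_energy_directional (sigma : {measure set V -> \bar R})
    (s r c b : R) (E : {vspace V}) n (h : V) :
  (0 < s <= 1)%R -> (r <= 1)%R -> (0 <= c)%R -> (0 <= b)%R ->
  ((0 < \dim E)%N -> directional sigma a s r c b E) ->
  h \in E -> (enorm h < r * a ^- n)%R ->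
  (c * b ^+ n)%:E * increment_energy x0 u (rho - 2 * a ^- n)%R h <=
  2%:E * \int[sigma]_(z in shell a s n) chord_energy x0 u rho z.
Proof.
move=> /andP[s0 s1] r1 c0 b0 dirE hE hr.
have mchord := measurable_chord_energy x0 mu_ rho.
have [E0|E0] := posnP (\dim E).
  move: hE; have -> : E = 0%VS by apply/eqP; rewrite -dimv_eq0 E0.
  rewrite memv0 => /eqP ->; rewrite increment_energy0 mule0 mule_ge0//.
  by apply: integral_ge0 => z _; exact: chord_energy_ge0.
rewrite -[leRHS]ge0_integralZl//; last 3 first.
- exact: measurable_shell.
- exact: measurable_funTS.
- by move=> z _; exact: chord_energy_ge0.
apply: (dirE E0 n h) => //.
- exact: increment_energy_ge0.
- exact: measurable_funeM.
- by move=> z; apply: mule_ge0 => //; exact: chord_energy_ge0.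
move=> z zs zhs.
have zr : (enorm z < a ^- n)%R by rewrite (lt_le_trans zs)// ler_piMl// ltW.
have ha : (enorm h < a ^- n)%R by rewrite (lt_le_trans hr)// ler_piMl// ltW.
pose F (x : V) : R := (bl rho x * bl rho (x + z)%R * (u (x + z) - u x) ^+ 2)%R.
pose G (x : V) : R := (bl rho x * bl rho (x + (z - h))%R * (u (x + (z - h)) - u x) ^+ 2)%R.
have mF : measurable_fun setT (fun x => (F x)%:E) by rewrite /F; meas.
have mG : measurable_fun setT (fun x => (G x)%:E) by rewrite /G; meas.
have F0 x : 0 <= (F x)%:E by rewrite /F; pos.
have G0 x : 0 <= (G x)%:E by rewrite /G; pos.
have mGh : measurable_fun setT (fun x : V => (G (x + h)%R)%:E) by rewrite /G; meas.
have -> : 2%:E * chord_energy x0 u rho z + 2%:E * chord_energy x0 u rho (z - h)%R =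
   \int[lam]_(x in [set: V]) (2%:E * (F x)%:E + 2%:E * (G (x + h)%R)%:E).
  rewrite [RHS]ge0_integralD//; last 4 first.
  - by move=> x _; apply: mule_ge0.
  - exact: measurable_funeM.
  - by move=> x _; apply: mule_ge0.
  - exact: measurable_funeM.
  rewrite !ge0_integralZl//.
  by rewrite (@ge0_integral_translate _ _ h (fun x => (G x)%:E)).
apply: ge0_le_integral_pointwise => x _; first by pos.
rewrite -!EFinM -EFinD lee_fin /F /G.
case: (ltP (enorm (x - x0)) (rho - 2 * a ^- n)%R) => xr; last by rewrite !mul0r; pos.
have xhz : (x + h + (z - h) = x + z)%R by rewrite addrACA subrr addr0.
rewrite xhz.
have an0 := ian0 n.
have -> : (enorm (x - x0) < rho)%R by rewrite (lt_trans xr)// ltrBlDr ltrDl mulr_gt0.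
have -> : (enorm (x + z - x0) < rho)%R.
  have := enormD (x - x0) z; rewrite addrAC => /le_lt_trans; apply.
  move: xr zr an0; set q := a ^- n; lra.
have -> : (enorm (x + h - x0) < rho)%R.
  have := enormD (x - x0) h; rewrite addrAC => /le_lt_trans; apply.
  move: xr ha an0; set q := a ^- n; lra.
rewrite !mul1r -(sqrrN (u (x + z) - u (x + h)))%R opprB; exact: sqrB_le2.
Qed.

End directional_increments.

Section all_increments.
Variables (R : realType) (d : nat) (a : R).
Local Notation V := 'rV[R]_d.
Hypothesis a1 : 1 < a.
Local Open Scope ereal_scope.

(** A small h is the sum of m components in the [E k], each shorter than r a^-n. The depth m + 2
    pays a^-n for each component, plus the 2 a^-n at which increments along [E k] are controlled. *)
Lemma increment_energy_all m (E : 'I_m -> {vspace V}) (r : R) :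
  (\sum_(k < m) E k)%VS = fullv -> (0 < r <= 1)%R ->
  exists2 r1 : R, (0 < r1)%R & forall (x0 : V) (rho : R) (u : V -> R),
   measurable_fun setT u -> forall n (h : V) (q : R) (J : \bar R),
   (0 < q)%R -> 0 <= J ->
   (forall k h, h \in E k -> (enorm h < r * a ^- n)%R ->
     q%:E * increment_energy x0 u (rho - 2 * a ^- n)%R h <= J) ->
   (enorm h < r1 * a ^- n)%R ->
   q%:E * increment_energy x0 u (rho - (m.+2)%:R * a ^- n)%R h <= (2 ^+ m.+1)%:E * J.
Proof.
move=> sumE /andP[r0 r1].
(* The sum of the [E k] need not be direct; a linear choice of decomposition is fixed, whose
   components are bounded operators. *)
pose pi k := sumv_pi_for (esym sumE) k.
have /choice[C HC] : forall k, exists C : R, (0 <= C)%R /\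
    forall x : V, (enorm (pi k x) <= C * enorm x)%R.
  by move=> k; have [C C0 HC] := endo_bounded (pi k); exists C.
pose C0 : R := (\sum_k C k)%R.
have C00 : (0 <= C0)%R by rewrite sumr_ge0// => k _; have [] := HC k.
have CC0 k : (C k <= C0)%R.
  by rewrite /C0 (bigD1 k)//= lerDl sumr_ge0// => i _; have [] := HC i.
exists (r / (C0 + 1))%R; first by rewrite divr_gt0// ltr_wpDl.
move=> x0 rho u mu_ n h q J q0 J0 HJ hr.
have an0 : (0 < a ^- n)%R by rewrite invr_gt0 exprn_gt0// (lt_trans _ a1).
have pih k : (enorm (pi k h) < r * a ^- n)%R.
  have [_ /(_ h) Hk] := HC k; apply: (le_lt_trans Hk).
  apply: (@le_lt_trans _ _ (C0 * enorm h)%R).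
    by rewrite ler_wpM2r ?enorm_ge0.
  apply: (@le_lt_trans _ _ (C0 * (r / (C0 + 1) * a ^- n))%R).
    by rewrite ler_wpM2l// ltW.
  have -> : (C0 * (r / (C0 + 1) * a ^- n) = r * a ^- n * (C0 / (C0 + 1)))%R by ring.
  rewrite gtr_pMr ?mulr_gt0// ltr_pdivrMr ?ltr_wpDl//.
  by rewrite mul1r ltrDl.
have hE : h = (\sum_(g <- [seq pi k h | k <- index_enum 'I_m]) g)%R.
  by rewrite big_map sumv_pi_sum// memvf.
have sz : size [seq pi k h | k <- index_enum 'I_m] = m.
  by rewrite size_map -[in RHS](card_ord m) cardE enumT.
pose M : \bar R := (q^-1)%:E * J.
have M0 : 0 <= M by rewrite mule_ge0// lee_fin invr_ge0 ltW.
have incM : increment_energy x0 u (rho - (m.+2)%:R * a ^- n)%R h <= (2 ^+ m.+1 - 2)%:E * M.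
  rewrite [in leLHS]hE -[in leRHS]sz.
  apply: (@increment_energy_sum _ _ _ _ mu_ _ (a ^- n) (rho - 2 * a ^- n)%R) => //.
  - exact: ltW.
  - move=> g /mapP[k _ ->]; apply: (le_trans (ltW (pih k))).
    by rewrite ler_piMl// ltW.
  - by rewrite sz -(natr1 m.+1) -(natr1 m); move: (a ^- n) => t; lra.
  - move=> g /mapP[k _ ->]; rewrite /M lee_pdivlMl//; apply: HJ => //.
    exact: memv_sum_pi.
rewrite -lee_pdivlMl// (le_trans incM)// /M.
rewrite muleA -EFinM muleA -EFinM; apply: lee_wpmul2r => //.
by rewrite lee_fin mulrC ler_wpM2l ?invr_ge0 ?(ltW q0)// lerBlDr lerDl.
Qed.

End all_increments.

Lemma nneseries_le_bound (R : realType) (f : (\bar R)^nat) (M : \bar R) :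
  (forall n, 0 <= f n)%E -> (forall N, \sum_(0 <= n < N) f n <= M)%E ->
  (\sum_(n <oo) f n <= M)%E.
Proof.
move=> f0 fM; apply: lime_le; first by apply: is_cvg_nneseries.
by apply: nearW => N; exact: fM.
Qed.

Lemma nneseries_ge_term (R : realType) (f : (\bar R)^nat) n :
  (forall n, 0 <= f n)%E -> (f n <= \sum_(n <oo) f n)%E.
Proof.
move=> f0; rewrite (nneseries_split 0 n.+1)//.
rewrite add0n big_nat_recr//= -addeA addeCA leeDl// adde_ge0//.
  exact: sume_ge0.
exact: nneseries_ge0.
Qed.

(** * Splitting the fractional energy according to distance *)

Section fractional_energy_shells.
Variables (R : realType) (d : nat) (x0 : 'rV[R]_d) (rho : R) (u : 'rV[R]_d -> R).
Local Notation V := 'rV[R]_d.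
Local Notation lam := (lebesgue_rV R d).
Local Notation bl r x := ((enorm (x - x0) < r)%R%:R).
Local Notation vol := (ball_volume R d).
Hypothesis mu_ : measurable_fun setT u.
Hypothesis rho01 : 0 < rho < 1.
Variables (a alpha : R).
Hypothesis a1 : 1 < a.
Hypothesis alpha_gt0 : 0 < alpha.
Hypothesis d_gt0 : (0 < d)%N.
Local Open Scope ereal_scope.

Let a0 : (0 < a)%R. Proof. exact: lt_trans a1. Qed.
Let ian0 n : (0 < a ^- n)%R. Proof. by rewrite invr_gt0 exprn_gt0. Qed.

Definition fractional_energy : \bar R := \int[lam]_x \int[lam]_y
  (bl rho x * bl rho y * (u y - u x) ^+ 2 * enorm (y - x) `^ (- d%:R - alpha))%:E.

Definition shell_energy n : \bar R := \int[lam]_x \int[lam]_y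
  (bl rho x * bl rho y * (u y - u x) ^+ 2 *
   ((2 * a ^- n.+1 <= enorm (y - x))%R%:R * (enorm (y - x) < 2 * a ^- n)%R%:R))%:E.

(** The kernel at the inner radius, hence its maximum over the shell. The radii are 2 a^-n because
    points of a ball of radius below 1 are at distance below 2. *)
Definition shell_kernel n : R := ((2 * a ^- n.+1) `^ (- d%:R - alpha))%R.

Let pair_bound x y : (bl rho x * bl rho y * (u y - u x) ^+ 2)%R != 0%R :> R ->
  (0 < enorm (y - x) < 2 * rho)%R.
Proof.
case: (ltP (enorm (x - x0)) rho) => xr; last by rewrite !mul0r eqxx.
case: (ltP (enorm (y - x0)) rho) => yr; last by rewrite mulr0 mul0r eqxx.
rewrite !mul1r => W0; apply/andP; split.
  rewrite enorm_gt0 subr_eq0; apply: contra_neq W0 => ->.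
  by rewrite subrr expr0n.
rewrite (le_lt_trans (enorm_triangle x0 _ _))// [X in (_ + X < _)%R]enormC.
by rewrite mulrC mulr_natr mulr2n ltrD.
Qed.

Lemma fractional_energy_le_shells :
  fractional_energy <= \sum_(n <oo) (shell_kernel n)%:E * shell_energy n.
Proof.
have rho2 : (2 * rho < 2)%R by case/andP: rho01 => _ r1; rewrite gtr_pMr.
pose q n (t : V * V) : R := (shell_kernel n * (bl rho t.1 * bl rho t.2 * (u t.2 - u t.1) ^+ 2 *
   ((2 * a ^- n.+1 <= enorm (t.2 - t.1))%R%:R * (enorm (t.2 - t.1) < 2 * a ^- n)%R%:R)))%R.
have kn0 n : (0 <= shell_kernel n)%R by exact: powR_ge0.
have q0 n t : 0 <= (q n t)%:E by rewrite /q; pos.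
have mq n : measurable_fun setT (fun t => (q n t)%:E) by rewrite /q; meas.
have mqx n x : measurable_fun setT (fun y => (q n (x, y))%:E).
  by apply: (measurableT_comp (mq n)); exact: pair1_measurable.
have miq n : measurable_fun setT (fun x => \int[lam]_y (q n (x, y))%:E).
  exact: measurable_int_last (mq n) (q0 n).
have iq0 n x : 0 <= \int[lam]_y (q n (x, y))%:E by exact: integral_ge0.
have -> : \sum_(n <oo) (shell_kernel n)%:E * shell_energy n =
    \sum_(n <oo) \int[lam]_x \int[lam]_y (q n (x, y))%:E.
  apply: eq_eseriesr => n _.
  pose p0 (t : V * V) := (bl rho t.1 * bl rho t.2 *
      (u t.2 - u t.1) ^+ 2 * ((2 * a ^- n.+1 <= enorm (t.2 - t.1))%R%:R *
      (enorm (t.2 - t.1) < 2 * a ^- n)%R%:R))%R.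
  have p00 t : 0 <= (p0 t)%:E by rewrite /p0; pos.
  have mp0 : measurable_fun setT (fun t => (p0 t)%:E) by rewrite /p0; meas.
  have -> : shell_energy n = \int[lam]_x \int[lam]_y (p0 (x, y))%:E by [].
  rewrite -[LHS]ge0_integralZl//.
  - apply: eq_integral => x _; rewrite -[LHS]ge0_integralZl//.
    + by apply: (measurableT_comp mp0); exact: pair1_measurable.
    + by rewrite lee_fin.
  - exact: measurable_int_last mp0 p00.
  - by move=> x _; exact: integral_ge0.
  - by rewrite lee_fin.
rewrite -(integral_nneseries lam measurableT miq); last by move=> n x _; exact: iq0.
apply: ge0_le_integral_pointwise => x _.
  by apply: integral_ge0 => y _; pos.
rewrite -(integral_nneseries lam measurableT (fun n => mqx n x)); last by move=> n y _; exact: q0.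
apply: ge0_le_integral_pointwise => y _; first by pos.
set W : R := (bl rho x * bl rho y * (u y - u x) ^+ 2)%R.
have W0 : (0 <= W)%R by rewrite /W; pos.
have [->|Wn0] := eqVneq W 0%R; first by rewrite mul0r; exact: nneseries_ge0.
have /andP[s0 s2] := pair_bound Wn0; set s := enorm (y - x) in s0 s2 *.
have [n /andP[n1 n2]] : exists n : nat, (a ^- n.+1 <= s / 2 < a ^- n)%R.
  apply: exists_shell => //; rewrite divr_gt0//= ltr_pdivrMr// mul1r.
  exact: lt_trans rho2.
have n1' : (2 * a ^- n.+1 <= s)%R by rewrite mulrC -ler_pdivlMr.
have n2' : (s < 2 * a ^- n)%R by rewrite mulrC -ltr_pdivrMr.
apply: le_trans (nneseries_ge_term n (fun n => q0 n (x, y))).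
rewrite lee_fin /q/= -/s -/W n1' n2' !mulr1 mulrC ler_wpM2r// /shell_kernel.
rewrite -opprD !powRN lef_pV2 ?posrE ?powR_gt0 ?mulr_gt0//.
by apply: ge0_ler_powR; rewrite ?nnegrE ?addr_ge0 ?mulr_ge0 ?(ltW alpha_gt0) ?(ltW s0)// ltW.
Qed.

(** Two pushes to depth e, one for each end of the pair. Each produces short increments, collected
    in the first term, and enlarges the distance by 2e, which is at most r/2. *)
Lemma shell_energy_le (eta : R) n : (0 < eta)%R -> (eta * (4 * a) <= 1)%R ->
  shell_energy n <= (6 * (16 / eta) ^+ d)%:E * near_energy x0 u rho rho (2 * (eta * (2 * a ^- n))) +
   (4 * 16 ^+ d)%:E * near_energy x0 u (rho - eta * (2 * a ^- n)) (rho - eta * (2 * a ^- n))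
     (2 * (2 * a ^- n)).
Proof.
move=> eta0 eta1; set r := (2 * a ^- n)%R; set e := (eta * r)%R.
have r0 : (0 < r)%R by rewrite mulr_gt0.
have e0 : (0 < e)%R by rewrite mulr_gt0.
have eta4 : (eta * 4 <= 1)%R.
  apply: le_trans eta1; rewrite ler_wpM2l ?(ltW eta0)//.
  by rewrite ler_peMr// ltW.
have er : (e * 4 <= r)%R by rewrite /e mulrAC ler_piMl// ltW.
have rhs0 : 0 <= (6 * (16 / eta) ^+ d)%:E * near_energy x0 u rho rho (2 * e) +
   (4 * 16 ^+ d)%:E * near_energy x0 u (rho - e) (rho - e) (2 * r).
  have q16 : (0 <= 16 / eta)%R by rewrite divr_ge0// ltW.
  by rewrite adde_ge0// mule_ge0 ?near_energy_ge0//; pos.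
(* If the inner radius of the shell reaches 2 rho, no pair of points of D lies in the shell;
   otherwise r < 2 a rho, and [eta1] makes e at most rho/2, so that D has points at that depth. *)
have [rl|rl] := leP (2 * rho)%R (2 * a ^- n.+1)%R.
  rewrite /shell_energy integral0_eq// => x _; rewrite integral0_eq// => y _.
  set W : R := (bl rho x * bl rho y * (u y - u x) ^+ 2)%R.
  have [->|/pair_bound/andP[_ s2]] := eqVneq W 0%R; first by rewrite mul0r.
  by rewrite (lt_geF (lt_le_trans s2 rl)) mul0r mulr0.
have rlt : (r < 2 * a * rho)%R.
  move: rl; rewrite exprS invfM mulrCA [(_^-1 * _)%R]mulrC ltr_pdivrMr//.
  by rewrite /r => /lt_le_trans; apply; rewrite mulrAC.
have e3 : (e * 3 <= rho * 2)%R.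
  have rho0 : (0 < rho)%R by case/andP: rho01.
  have : (e <= eta * (2 * a * rho))%R by rewrite ler_wpM2l ?(ltW eta0)// ltW.
  have : (eta * (2 * a * rho) <= rho / 2)%R.
    rewrite (_ : eta * _ = eta * (4 * a) * (rho / 2))%R; last by field.
    by rewrite ler_piMl// divr_ge0// ltW.
  lra.
have Qr : shell_energy n <= near_energy x0 u rho rho r.
  apply: ge0_le_integral_pointwise => x _.
    by apply: integral_ge0 => y _; pos.
  apply: ge0_le_integral_pointwise => y _; first by pos.
  rewrite lee_fin mulrAC ler_wpM2r ?sqr_ge0// ler_wpM2l ?mulr_ge0//.
  by rewrite -/r ler_piMl// lern1 leq_b1.
apply: (le_trans Qr).
(* The volume of the averaging ball of radius e/2 serves as unit: a ball of radius k e/2 has volume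
   b k^d, and b cancels from both sides. *)
pose b : R := (vol * (e / 2) ^+ d)%R.
have b0 : (0 < b)%R by rewrite mulr_gt0 ?ball_volume_gt0// exprn_gt0// divr_gt0.
have volE (t k : R) : (0 < k)%R -> t = (k * (e / 2))%R -> (vol * t ^+ d = b * k ^+ d)%R.
  by move=> k0 ->; rewrite /b exprMn; ring.
set P := near_energy x0 u rho rho (2 * e).
have P0 : 0 <= P by exact: near_energy_ge0.
have push (t k : R) (r2 : R) : (0 < t)%R -> (0 < k)%R -> (r2 <= rho)%R ->
    t = (k * (e / 2))%R ->
  near_energy x0 u rho r2 t <= (2 * k ^+ d)%:E * P +
     (2 * 4 ^+ d)%:E * near_energy x0 u r2 (rho - e) (t + 2 * e).
  move=> t0 k0 r2rho tk.
  have := near_energy_push x0 mu_ e0 e3 t0 r2rho.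
  have e4 : (vol * (2 * e) ^+ d = b * 4 ^+ d)%R.
    by apply: volE; [exact: ltr0n|field].
  rewrite [(vol * t ^+ d)%R](volE t k k0 tk) e4.
  rewrite -/b -/P !(mulrCA 2%R b) !(EFinM b) -!(muleA b%:E).
  rewrite -ge0_muleDr; last 2 first.
  - by rewrite mule_ge0//; pos.
  - by rewrite mule_ge0 ?near_energy_ge0//; pos.
  by rewrite lee_pmul2l// lte_fin.
have reta : r = (2 / eta * (e / 2))%R by rewrite /e; field; exact: lt0r_neq0.
have re2 : (r + 2 * e = (2 / eta + 4) * (e / 2))%R.
  by rewrite {1}reta; field; exact: lt0r_neq0.
set M := near_energy x0 u (rho - e) (rho - e) (2 * r).
have M0 : 0 <= M by exact: near_energy_ge0.
have h2 : (0 < 2 / eta)%R by exact: divr_gt0.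
have h4 : (0 < 2 / eta + 4)%R by rewrite addr_gt0.
have h44 : (2 / eta + 4 <= 4 / eta)%R.
  have : (4 <= eta^-1)%R by rewrite -[(eta^-1)%R]mul1r ler_pdivlMr// mulrC.
  move: (eta^-1)%R => q; lra.
have M1 : near_energy x0 u rho (rho - e) (r + 2 * e) <=
   (2 * (4 / eta) ^+ d)%:E * P + (2 * 4 ^+ d)%:E * M.
  apply: (le_trans (push _ _ (rho - e)%R _ h4 _ re2)).
  - by rewrite addr_gt0// mulr_gt0.
  - by rewrite gerBl ltW.
  have h44d : ((2 / eta + 4) ^+ d <= (4 / eta) ^+ d)%R.
    by rewrite lerXn2r ?nnegrE ?divr_ge0 ?(ltW h4) ?(ltW eta0).
  apply: leeD; [apply: lee_wpmul2r|apply: lee_wpmul2l].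
  - exact: P0.
  - by rewrite lee_fin; apply: ler_wpM2l.
  - by rewrite lee_fin; pos.
  by apply: near_energy_mono; [exact: lexx|exact: lexx|lra].
apply: (le_trans (push r _ rho r0 h2 (lexx _) reta)).
apply: (@le_trans _ _ ((2 * (2 / eta) ^+ d)%:E * P + (2 * 4 ^+ d)%:E *
    ((2 * (4 / eta) ^+ d)%:E * P + (2 * 4 ^+ d)%:E * M))).
  by apply: leeD => //; apply: lee_wpmul2l => //; rewrite lee_fin; pos.
have q0 (t : R) : (0 <= t)%R -> 0 <= t%:E by rewrite lee_fin.
have p4 : (0 <= 2 / eta)%R by exact: ltW.
have p5 : (0 <= 4 / eta)%R by rewrite divr_ge0// ltW.
clear push M1; clearbody P M.
rewrite ge0_muleDr; last 2 first.
- by rewrite mule_ge0//; apply: q0; pos.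
- by rewrite mule_ge0//; apply: q0; pos.
rewrite addeA !muleA -!EFinM -ge0_muleDl; last 2 first.
- by apply: q0; pos.
- by apply: q0; pos.
rewrite -EFinD; apply: leeD; apply: lee_wpmul2r => //; rewrite lee_fin.
  have -> : (16 / eta = 4 * (4 / eta))%R by field; exact: lt0r_neq0.
  have : ((2 / eta) ^+ d <= (4 * (4 / eta)) ^+ d)%R.
    by rewrite lerXn2r ?nnegrE//; [pos|move: p5; lra].
  rewrite [((4 * _) ^+ d)%R]exprMn.
  move: ((2 / eta) ^+ d)%R ((4 / eta) ^+ d)%R (4 ^+ d)%R => p1 p2 p3; lra.
have -> : (16 = 4 * 4 :> R)%R by lra.
by rewrite exprMn; move: (4 ^+ d)%R => p3; lra.
Qed.

End fractional_energy_shells.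

Lemma powR_invl (R : realType) (x b : R) : 0 <= x -> x^-1 `^ b = x `^ (- b).
Proof. by move=> x0; rewrite -[x^-1]powR_inv1// -powRrM mulN1r. Qed.

Lemma powR_expr (R : realType) (x b : R) n : 0 <= x -> (x ^+ n) `^ b = (x `^ b) ^+ n.
Proof. by move=> x0; rewrite -!powR_mulrn ?powR_ge0// -!powRrM mulrC. Qed.

(** * Summation over the scales *)

Section kernel_sum.
Variables (R : realType) (d : nat) (x0 : 'rV[R]_d) (rho : R) (u : 'rV[R]_d -> R).
Local Notation V := 'rV[R]_d.
Local Notation lam := (lebesgue_rV R d).
Local Notation bl r x := ((enorm (x - x0) < r)%R%:R).
Hypothesis mu_ : measurable_fun setT u.
Variables (a alpha : R).
Hypothesis a1 : 1 < a.
Hypothesis alpha_gt0 : 0 < alpha.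
Hypothesis d_gt0 : (0 < d)%N.
Local Open Scope ereal_scope.

Let a0 : (0 < a)%R. Proof. exact: lt_trans a1. Qed.
Let beta : R := (d%:R + alpha)%R.
Let beta1 : (1 <= beta)%R.
Proof. by rewrite /beta ler_wpDr ?ler1n// ltW. Qed.

Lemma shell_kernelE n :
  shell_kernel d a alpha n = ((a / 2) `^ (d%:R + alpha) * ((a `^ (d%:R + alpha)) ^+ n))%R.
Proof.
rewrite /shell_kernel -opprD -/beta -powR_invl; last first.
  by rewrite mulr_ge0// invr_ge0 exprn_ge0// ltW.
rewrite -powR_expr ?(ltW a0)// -powRM ?exprn_ge0 ?divr_ge0 ?(ltW a0)//.
congr (_ `^ _)%R; rewrite exprS; field.
by rewrite expf_neq0 ?(lt0r_neq0 a0)// lt0r_neq0.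
Qed.

(** A pair at distance s is counted only at scales with a^n < 4 eta / s, and the kernels there form
    a geometric sum dominated by its largest term. The resulting eta^(d + alpha) outweighs the
    eta^-d of [shell_energy_le]. *)
Lemma near_energy_kernel_sum (eta : R) : (0 < eta)%R ->
  \sum_(n <oo) (shell_kernel d a alpha n)%:E *
    near_energy x0 u rho rho (2 * (eta * (2 * a ^- n))) <=
  ((2 * a * eta) `^ (d%:R + alpha) * (a / (a - 1)))%:E *
    fractional_energy x0 rho u alpha.
Proof.
move=> eta0; rewrite -/beta.
have kn0 n : (0 <= shell_kernel d a alpha n)%R by exact: powR_ge0.
set C : R := ((2 * a * eta) `^ beta * (a / (a - 1)))%R.
have C0 : (0 <= C)%R by rewrite mulr_ge0 ?powR_ge0// divr_ge0 ?subr_ge0// ltW.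
pose p n (t : V * V) : R := (bl rho t.1 * bl rho t.2 *
   (enorm (t.2 - t.1) < 2 * (eta * (2 * a ^- n)))%R%:R * (u t.2 - u t.1) ^+ 2)%R.
have p0 n t : 0 <= (p n t)%:E by rewrite /p; pos.
have mp n : measurable_fun setT (fun t => (p n t)%:E) by rewrite /p; meas.
pose q n (t : V * V) : \bar R := (shell_kernel d a alpha n)%:E * (p n t)%:E.
have q0 n t : 0 <= q n t by apply: mule_ge0; [rewrite lee_fin|]; auto.
have mq n : measurable_fun setT (q n) by exact: measurable_funeM.
pose w (t : V * V) : R := (bl rho t.1 * bl rho t.2 * (u t.2 - u t.1) ^+ 2 *
  enorm (t.2 - t.1) `^ (- d%:R - alpha))%R.
have w0 t : 0 <= (w t)%:E by rewrite /w; pos.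
have mw : measurable_fun setT (fun t => (w t)%:E) by rewrite /w; meas.
have sec (g : V * V -> \bar R) x : measurable_fun setT g ->
    measurable_fun setT (fun y => g (x, y)).
  by move=> mg; apply: (measurableT_comp mg); exact: pair1_measurable.
have -> : \sum_(n <oo) (shell_kernel d a alpha n)%:E *
    near_energy x0 u rho rho (2 * (eta * (2 * a ^- n))) =
    \sum_(n <oo) \int[lam]_x \int[lam]_y q n (x, y).
  apply: eq_eseriesr => n _.
  have -> : near_energy x0 u rho rho (2 * (eta * (2 * a ^- n))) =
    \int[lam]_x \int[lam]_y (p n (x, y))%:E by [].
  rewrite -[LHS]ge0_integralZl//.
  - apply: eq_integral => x _; rewrite -[LHS]ge0_integralZl//.
    + exact: (sec (fun t => (p n t)%:E)).
    + by rewrite lee_fin.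
  - exact: measurable_int_last (mp n) (p0 n).
  - by move=> x _; exact: integral_ge0.
  - by rewrite lee_fin.
have miq n : measurable_fun setT (fun x => \int[lam]_y q n (x, y)).
  exact: measurable_int_last (mq n) (q0 n).
have iq0 n x : 0 <= \int[lam]_y q n (x, y) by exact: integral_ge0.
rewrite -(integral_nneseries lam measurableT miq); last by move=> n x _; exact: iq0.
have -> : fractional_energy x0 rho u alpha =
    \int[lam]_x \int[lam]_y (w (x, y))%:E by [].
rewrite -[leRHS]ge0_integralZl//; last 2 first.
- exact: measurable_int_last mw w0.
- by move=> x _; exact: integral_ge0.
apply: ge0_le_integral_pointwise => x _; first exact: nneseries_ge0.
rewrite -(integral_nneseries lam measurableT (fun n => sec _ x (mq n))); last first.
  by move=> n y _; exact: q0.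
rewrite -[leRHS]ge0_integralZl//; last first.
  exact: (sec (fun t => (w t)%:E)).
apply: ge0_le_integral_pointwise => y _; first exact: nneseries_ge0.
set W : R := (bl rho x * bl rho y * (u y - u x) ^+ 2)%R.
have W0 : (0 <= W)%R by rewrite /W; pos.
set s := enorm (y - x).
have pE n : p n (x, y) = (W * (s < 2 * (eta * (2 * a ^- n)))%R%:R)%R.
  by rewrite /p/= -/s mulrAC.
have wE : w (x, y) = (W * s `^ (- d%:R - alpha))%R by [].
have [s00|s0] := eqVneq s 0%R.
  have xy : y = x by apply/eqP; rewrite -subr_eq0 -enorm_eq0 -/s s00.
  have W00 : W = 0%R by rewrite /W xy subrr expr0n mulr0.
  rewrite wE W00 mul0r mule0 eseries0// => n _ _.
  by rewrite /q pE W00 mul0r mule0.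
have {}s0 : (0 < s)%R by rewrite lt0r s0 enorm_ge0.
apply: nneseries_le_bound => // N.
have X0 : (0 < 4 * eta / s)%R by rewrite divr_gt0// mulr_gt0.
have eqn n : (s < 2 * (eta * (2 * a ^- n)))%R = (a ^+ n < 4 * eta / s)%R.
  have an0 : (0 < a ^+ n)%R by rewrite exprn_gt0.
  rewrite (_ : 2 * _ = 4 * eta / a ^+ n)%R; last by field; exact: lt0r_neq0.
  by rewrite !ltr_pdivlMr// mulrC.
have -> : (\sum_(0 <= n < N) q n (x, y))%E = (W * (a / 2) `^ beta *
    \sum_(0 <= n < N) (a `^ beta) ^+ n * (a ^+ n < 4 * eta / s)%R%:R)%:E.
  rewrite big_distrr/= -sumEFin; apply: eq_bigr => n _.
  rewrite /q pE -EFinM eqn shell_kernelE -/beta; congr _%:E; ring.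
have ab : (a <= a `^ beta)%R by rewrite -[leLHS]powRr1 ?(ltW a0)// ler_powR// ltW.
have S := @sum_geometric_truncated_le _ _ _ (4 * eta / s)%R a1 ab ((4 * eta / s) `^ beta)%R N.
rewrite -EFinM lee_fin wE /C.
apply: (@le_trans _ _ (W * (a / 2) `^ beta * ((4 * eta / s) `^ beta * (a / (a - 1))))%R).
  apply: ler_wpM2l; first by rewrite mulr_ge0 ?powR_ge0.
  apply: S => [|n anX]; first exact: powR_ge0.
  rewrite -powR_expr ?(ltW a0)//.
  rewrite ge0_ler_powR ?nnegrE ?(ltW X0) ?(ltW anX) ?exprn_ge0 ?(ltW a0)//.
  exact: le_trans beta1.
have -> : (s `^ (- d%:R - alpha) = s^-1 `^ beta)%R.
  by rewrite -opprD powR_invl// ltW.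
have si0 : (0 <= s^-1)%R by rewrite invr_ge0 ltW.
have -> : ((2 * a * eta) `^ beta = (a / 2) `^ beta * ((4 * eta) `^ beta))%R.
  rewrite -powRM ?divr_ge0 ?mulr_ge0 ?(ltW a0) ?(ltW eta0)//.
  by congr (_ `^ _)%R; field.
rewrite [((4 * eta / s) `^ _)%R]powRM ?mulr_ge0 ?(ltW eta0)//.
rewrite le_eqVlt; apply/orP; left; apply/eqP; ring.
Qed.

End kernel_sum.

Lemma sume_le_const (R : realType) m (f : 'I_m -> \bar R) (I : \bar R) :
  (0 <= I -> (forall k, f k <= I) -> \sum_(k < m) f k <= m%:R%:E * I)%E.
Proof.
move=> I0; elim: m f => [|m ih] f fI; first by rewrite big_ord0 mul0e.
rewrite big_ord_recr/= -natr1 EFinD ge0_muleDl// mul1e.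
by apply: leeD => //; exact: ih.
Qed.

Lemma trivIset_shell (R : realType) d (a s : R) : 1 < a -> 0 < s ->
  trivIset setT (@shell R d a s).
Proof.
move=> a1 s0; have a0 : 0 < a by exact: lt_trans a1.
have shell_lt i j (z : 'rV[R]_d) : (i < j)%N -> shell a s i z -> shell a s j z -> False.
  move=> ij /andP[z1 _] /andP[_ z2].
  have := le_lt_trans z1 z2; rewrite ltr_pM2l// ltf_pV2 ?posrE ?exprn_gt0//.
  by rewrite ltr_eXn2l// ltnS leqNgt ij.
apply/trivIsetP => i j _ _ ij; apply/seteqP; split => // z [zi zj].
by case: (ltngtP i j) ij => // ij _; [exact: (shell_lt i j z)|exact: (shell_lt j i z)].
Qed.

Section jump_sums.
Variables (R : realType) (d : nat) (x0 : 'rV[R]_d) (rho : R) (u : 'rV[R]_d -> R).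
Local Notation V := 'rV[R]_d.
Local Notation vol := (ball_volume R d).
Hypothesis mu_ : measurable_fun setT u.
Variables (a alpha : R).
Hypothesis a1 : 1 < a.
Hypothesis alpha02 : 0 < alpha < 2.
Local Open Scope ereal_scope.

Let a0 : (0 < a)%R. Proof. exact: lt_trans a1. Qed.

(** Increments are known at scale n + j0. There the depth L a^-(n + j0) is below the available depth
    2 eta a^-n, and a displacement shorter than 4 a^-n becomes admissible after j halvings, at the
    cost of 4^j. *)
Lemma near_energy_le_jumps (c b r1 eta : R) (L j j0 n : nat) (J : \bar R) :
  (0 < c)%R -> (0 < b)%R -> 0 <= J ->
  (forall h, (enorm h < r1 * a ^- (n + j0))%R ->
    (c * b ^+ (n + j0))%:E *
      increment_energy x0 u (rho - L%:R * a ^- (n + j0))%R h <= J) ->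
  (L%:R * a ^- j0 <= 2 * eta)%R -> (4 * 2 ^- j <= r1 * a ^- j0)%R ->
  (c * b ^+ (n + j0))%:E * near_energy x0 u (rho - eta * (2 * a ^- n))
    (rho - eta * (2 * a ^- n)) (2 * (2 * a ^- n)) <=
  (vol * (2 * (2 * a ^- n)) ^+ d * 4 ^+ j)%:E * J.
Proof.
move=> c0 b0 J0 HJ Hj0 Hj.
set q : R := (c * b ^+ (n + j0))%R.
have q0 : (0 < q)%R by rewrite mulr_gt0// exprn_gt0.
have ian : (0 < a ^- n)%R by rewrite invr_gt0 exprn_gt0.
have anD : (a ^- (n + j0) = a ^- j0 * a ^- n)%R by rewrite exprD invfM mulrC.
rewrite -lee_pdivlMl//.
apply: le_trans (near_energy_le_chord (M := (q^-1 * 4 ^+ j)%:E * J) _ _ _ _) _ => //.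
- by rewrite !mulr_gt0.
- by rewrite mule_ge0// lee_fin mulr_ge0 ?exprn_ge0// invr_ge0 ltW.
- move=> h hr; apply: (le_trans (chord_energy_pow2 _ mu_ _ j _)).
  rewrite [(q^-1 * _)%R]mulrC EFinM -muleA; apply: lee_wpmul2l; first by rewrite lee_fin exprn_ge0.
  apply: (le_trans (chord_le_increment _ _ _ _)).
  rewrite lee_pdivlMl//; apply: le_trans (HJ (2 ^- j *: h)%R _).
    apply: lee_wpmul2l; first by rewrite lee_fin ltW.
    apply: increment_energy_mono; rewrite lerD2l lerN2 anD mulrA mulrCA.
    by rewrite mulrA ler_wpM2r// ltW.
  rewrite enormZ ger0_norm ?invr_ge0 ?exprn_ge0// anD mulrA.
  apply: (@lt_le_trans _ _ (2 ^- j * (2 * (2 * a ^- n)))%R).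
    by rewrite ltr_pM2l// invr_gt0 exprn_gt0.
  rewrite (_ : 2 ^- j * _ = 4 * 2 ^- j * a ^- n)%R; last by ring.
  by apply: ler_wpM2r => //; exact: ltW.
- rewrite !muleA -!EFinM; apply: lee_wpmul2r => //.
  by rewrite lee_fin le_eqVlt; apply/orP; left; apply/eqP; ring.
Qed.

Lemma near_energy_kernel_le_jumps (c r1 eta : R) (L j j0 n : nat) (J : \bar R) :
  (0 < c)%R -> 0 <= J ->
  (forall h, (enorm h < r1 * a ^- (n + j0))%R ->
    (c * (a `^ alpha) ^+ (n + j0))%:E *
      increment_energy x0 u (rho - L%:R * a ^- (n + j0))%R h <= J) ->
  (L%:R * a ^- j0 <= 2 * eta)%R -> (4 * 2 ^- j <= r1 * a ^- j0)%R ->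
  c%:E * ((shell_kernel d a alpha n)%:E *
    near_energy x0 u (rho - eta * (2 * a ^- n))
    (rho - eta * (2 * a ^- n)) (2 * (2 * a ^- n))) <=
  (a ^+ d.+2 * vol * 4 ^+ d * 4 ^+ j)%:E * J.
Proof.
move=> c0 J0 HJ Hj0 Hj; have /andP[al0 al2] := alpha02.
set b : R := (a `^ alpha)%R in HJ *.
have b0 : (0 < b)%R by rewrite powR_gt0.
have b1 : (1 <= b)%R by rewrite -[leLHS](powRr0 a) ler_powR ?ltW.
have H := near_energy_le_jumps c0 b0 J0 HJ Hj0 Hj.
have bn0 : (0 < b ^+ n)%R by rewrite exprn_gt0.
have bj0 : (0 < b ^+ j0)%R by rewrite exprn_gt0.
have an0 : (0 < a ^+ n)%R by rewrite exprn_gt0.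
set P := near_energy _ _ _ _ _ in H *.
have P0 : 0 <= P by exact: near_energy_ge0.
clearbody P.
have knE : (shell_kernel d a alpha n = (a / 2) `^ (d%:R + alpha) * (a ^+ n) ^+ d * b ^+ n)%R.
  rewrite shell_kernelE// [(a `^ (_ + _))%R]powRD ?(lt0r_neq0 a0) ?implybT// powR_mulrn ?ltW//.
  by rewrite exprMn -/b -!exprM mulnC mulrA.
pose t : R := (shell_kernel d a alpha n / b ^+ (n + j0))%R.
have t0 : (0 <= t)%R by rewrite divr_ge0 ?powR_ge0// exprn_ge0// ltW.
have -> : c%:E * ((shell_kernel d a alpha n)%:E * P) = t%:E * ((c * b ^+ (n + j0))%:E * P).
  rewrite !muleA -!EFinM; congr (_%:E * _); rewrite /t exprD; field.
  by rewrite !lt0r_neq0.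
apply: le_trans.
  by apply: lee_wpmul2l H; rewrite lee_fin.
rewrite muleA -EFinM; apply: lee_wpmul2r => //; rewrite lee_fin.
have v0 : (0 < vol)%R by exact: ball_volume_gt0.
have -> : (t * (vol * (2 * (2 * a ^- n)) ^+ d * 4 ^+ j) =
   (a / 2) `^ (d%:R + alpha) / b ^+ j0 * (vol * 4 ^+ d * 4 ^+ j))%R.
  rewrite /t knE (_ : 2 * (2 * a ^- n) = 4 * (a ^+ n)^-1)%R; last by rewrite mulrA -natrM.
  rewrite exprMn exprVn exprD.
  have and0 : ((a ^+ n) ^+ d != 0)%R by rewrite lt0r_neq0// exprn_gt0.
  move: and0; move: ((a ^+ n) ^+ d)%R (4 ^+ d)%R (4 ^+ j)%R => p1 p2 p3 and0; field.
  by rewrite and0 !lt0r_neq0.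
have -> : (a ^+ d.+2 * vol * 4 ^+ d * 4 ^+ j = a ^+ d.+2 * (vol * 4 ^+ d * 4 ^+ j))%R.
  by rewrite !mulrA.
apply: ler_wpM2r; first by rewrite !mulr_ge0 ?exprn_ge0// ltW.
apply: (@le_trans _ _ ((a / 2) `^ (d%:R + alpha))%R).
  by rewrite ler_pdivrMr// ler_peMr ?powR_ge0// exprn_ege1.
apply: (@le_trans _ _ (a `^ (d%:R + alpha))%R).
  apply: ge0_ler_powR; rewrite ?nnegrE ?divr_ge0 ?(ltW a0)//.
    by rewrite addr_ge0// ltW.
  by rewrite ler_pdivrMr// ler_peMr ?(ltW a0)// ler1n.
rewrite -powR_mulrn ?(ltW a0)//; apply: ler_powR; first exact: ltW.
by rewrite -addn2 natrD lerD2l ltW.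
Qed.

(** For fixed k the shells are disjoint, so each jump is counted at most m times. *)
Lemma shell_jumps_sum (sigma : {measure set V -> \bar R}) m (s : 'I_m -> R) :
  (forall k, 0 < s k)%R ->
  \sum_(n <oo) \sum_(k < m)
     \int[sigma]_(z in shell a (s k) n) chord_energy x0 u rho z <=
  m%:R%:E * \int[sigma]_z chord_energy x0 u rho z.
Proof.
move=> s0.
have mchord := measurable_chord_energy x0 mu_ rho.
have c0 z : 0 <= chord_energy x0 u rho z by exact: chord_energy_ge0.
rewrite nneseries_sum; last by by move=> k n _; exact: integral_ge0.
apply: sume_le_const; first exact: integral_ge0.
move=> k; rewrite -(@ge0_integral_bigcup _ _ _ sigma (shell a (s k))).
- apply: ge0_subset_integral => //.
  by apply: bigcupT_measurable => n; exact: measurable_shell.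
- by move=> n; exact: measurable_shell.
- exact: measurable_funTS.
- by [].
- exact: trivIset_shell.
Qed.

End jump_sums.

Lemma nneseries_shift_le (R : realType) (f : (\bar R)^nat) k :
  (forall n, 0 <= f n)%E -> (\sum_(n <oo) f (n + k)%N <= \sum_(n <oo) f n)%E.
Proof.
move=> f0; rewrite (nneseries_addn k f0) (nneseries_split 0 k)//.
by rewrite add0n leeDr// sume_ge0.
Qed.

(* Witness for the absorption argument: the part of the energy coming from pairs at
   distance at most 2 eta r_n is at most half of the energy, for every exponent
   alpha >= alpha0. *)
Lemma exists_absorbing_scale (R : realType) (a alpha0 : R) (d : nat) :
  1 < a -> 0 < alpha0 ->
  exists eta : R, [/\ 0 < eta, eta * (4 * a) <= 1 &
    forall alpha, alpha0 <= alpha ->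
      6 * (16 / eta) ^+ d * ((2 * a * eta) `^ (d%:R + alpha) * (a / (a - 1))) <= 2^-1].
Proof.
move=> a1 al0; have a0 : 0 < a by exact: lt_trans a1.
have a10 : 0 < a - 1 by rewrite subr_gt0.
set G := (32 * a) ^+ d * (a / (a - 1)).
have G1 : 1 <= G.
  rewrite -[leLHS]mulr1; apply: ler_pM => //.
    by apply: exprn_ege1; rewrite (le_trans (ltW a1))// ler_peMl ?(ltW a0)// ler1n.
  by rewrite ler_pdivlMr// mul1r gerBl.
have G0 : 0 < G by exact: lt_le_trans G1.
(* Chosen so that 6 G k = 1/2. With t^alpha0 <= k and t < 1, t^alpha is at most k for every alpha >=
   alpha0; the extra division of t by 2 gives the constraint on eta * (4 * a). *)
pose k := (12 * G)^-1.
have G12 : 0 < 12 * G by exact: mulr_gt0.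
have k0 : 0 < k by rewrite invr_gt0.
have k1 : k <= 1.
  by rewrite /k invf_le1//; move: (G) G1 => g; lra.
pose t := k `^ alpha0^-1 / 2.
have t0 : 0 < t by rewrite divr_gt0// powR_gt0.
have t1 : 2 * t <= 1.
  rewrite /t mulrC divfK// [leRHS](_ : 1 = 1 `^ alpha0^-1); last by rewrite powR1.
  apply: ge0_ler_powR => //.
  - by rewrite invr_ge0 ltW.
  - by rewrite nnegrE ltW.
  - by rewrite nnegrE.
exists (t / (2 * a)); split.
- by rewrite divr_gt0// mulr_gt0.
- by rewrite (_ : _ * _ = 2 * t)//; field; exact: lt0r_neq0.
move=> alpha al.
have -> : 2 * a * (t / (2 * a)) = t by field; exact: lt0r_neq0.
have -> : 16 / (t / (2 * a)) = 32 * a / t by field; rewrite !lt0r_neq0.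
rewrite powRD ?(lt0r_neq0 t0) ?implybT// powR_mulrn ?(ltW t0)//.
have td0 : t ^+ d != 0 by rewrite expf_neq0// lt0r_neq0.
have -> : 6 * (32 * a / t) ^+ d * (t ^+ d * t `^ alpha * (a / (a - 1))) =
    6 * G * t `^ alpha.
  rewrite exprMn exprVn /G; move: td0 ((32 * a) ^+ d) (t `^ alpha) (a / (a - 1)).
  by move: (t ^+ d) => p p0 q1 q2 q3; field.
have -> : 2^-1 = 6 * G * k by rewrite /k; field; exact: lt0r_neq0.
apply: ler_wpM2l; first by rewrite mulr_ge0// ltW.
apply: (@le_trans _ _ (t `^ alpha0)).
  by apply: ger_powR => //; rewrite t0/=; move: t1 t0; lra.
rewrite -[leRHS]powRr1 ?(ltW k0)// -(mulVf (lt0r_neq0 al0)) powRrM.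
apply: ge0_ler_powR; rewrite ?nnegrE ?powR_ge0 ?(ltW al0) ?(ltW t0)//.
by rewrite /t ler_pdivrMr// ler_peMr ?powR_ge0// ler1n.
Qed.

Section lower_energy.
Variables (R : realType) (d : nat) (a alpha0 : R).
Local Notation V := 'rV[R]_d.
Local Notation lam := (lebesgue_rV R d).
Hypothesis a1 : 1 < a.
Hypothesis alpha0_gt0 : 0 < alpha0.
Hypothesis d_gt0 : (0 < d)%N.
Local Open Scope ereal_scope.

Theorem fractional_energy_le m (E : 'I_m -> {vspace V}) (r : R) :
  (\sum_(k < m) E k)%VS = fullv -> (0 < r <= 1)%R ->
  exists2 C : R, (0 <= C)%R &
    forall (alpha : R) (s : 'I_m -> R) (c : R) (sigma : {sigma_finite_measure set V -> \bar R}),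
      (alpha0 <= alpha < 2)%R -> (forall k, 0 < s k <= 1)%R -> (0 < c)%R ->
      (forall k, (0 < \dim (E k))%N ->
        directional sigma a (s k) r c (a `^ alpha) (E k)) ->
    forall (x0 : V) (rho : R) (u : V -> R), (0 < rho < 1)%R -> measurable_fun setT u ->
      fractional_energy x0 rho u alpha < +oo ->
      c%:E * fractional_energy x0 rho u alpha <=
      C%:E * \int[lam]_x \int[sigma]_z ((enorm (x - x0) < rho)%R%:R *
        (enorm (x + z - x0) < rho)%R%:R * (u (x + z) - u x) ^+ 2)%:E.
Proof.
move=> sumE r01.
have a0 : (0 < a)%R by exact: lt_trans a1.
have [r1 r10 Hr1] := increment_energy_all a1 sumE r01.
have [eta [eta0 eta1 Heta]] := exists_absorbing_scale d a1 alpha0_gt0.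
(* The order of choices matters: eta from the absorption, then j0 so that the depth lost at the
   finer scale is below eta, then j so that enough halvings reach that scale. *)
have [j0 Hj0] := exists_expr_gt a1 ((m.+2)%:R / (2 * eta))%R.
have lt12 : (1 < 2 :> R)%R by rewrite ltr1n.
have [j Hj] := exists_expr_gt lt12 (4 / (r1 * a ^- j0))%R.
have ij0 : (0 < a ^+ j0)%R by rewrite exprn_gt0.
have {}Hj0 : ((m.+2)%:R * a ^- j0 <= 2 * eta)%R.
  rewrite ler_pdivrMr//; move/ltW: Hj0; rewrite ler_pdivrMr ?mulr_gt0//.
  by rewrite mulrC.
have {}Hj : (4 * 2 ^- j <= r1 * a ^- j0)%R.
  rewrite ler_pdivrMr ?exprn_gt0//; move/ltW: Hj.
  by rewrite ler_pdivrMr ?divr_gt0// mulrC.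
pose K : R := (a ^+ d.+2 * ball_volume R d * 4 ^+ d * 4 ^+ j)%R.
have K0 : (0 <= K)%R.
  have v0 : (0 < ball_volume R d)%R by exact: ball_volume_gt0.
  by rewrite mulr_ge0 ?exprn_ge0// mulr_ge0 ?exprn_ge0// mulr_ge0 ?exprn_ge0// ltW.
pose D : R := (4 * 16 ^+ d)%R.
have D0 : (0 <= D)%R by rewrite mulr_ge0// exprn_ge0.
(* The power of 2 comes from adding up components along the [E k], the last factor 2 from comparing
   the jumps z and z - h. *)
pose F : R := (2 ^+ m.+1 * 2)%R.
have F0 : (0 <= F)%R by rewrite mulr_ge0// exprn_ge0.
have DKF0 : (0 <= D * K * F)%R by apply: mulr_ge0 => //; exact: mulr_ge0.
have DKFm0 : (0 <= D * K * (F * m%:R))%R by rewrite mulrA; exact: mulr_ge0.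
exists (2 * (D * K * (F * m%:R)))%R; first exact: mulr_ge0.
move=> alpha s c sigma /andP[al0 al2] s01 c0 Hdir x0 rho u rho01 mu_ Efin.
have alpha_gt0 : (0 < alpha)%R by exact: lt_le_trans al0.
have alpha02 : (0 < alpha < 2)%R by rewrite alpha_gt0.
set b : R := (a `^ alpha)%R in Hdir.
have b0 : (0 < b)%R by rewrite powR_gt0.
have mchord := measurable_chord_energy x0 mu_ rho.
pose J n := \sum_(k < m) \int[sigma]_(z in shell a (s k) n) chord_energy x0 u rho z.
have chord0 z : 0 <= chord_energy x0 u rho z by exact: chord_energy_ge0.
have J0 n : 0 <= J n by apply: sume_ge0 => k _; exact: integral_ge0.
have Jk n k : \int[sigma]_(z in shell a (s k) n) chord_energy x0 u rho z <= J n.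
  rewrite /J (bigD1 k)//= leeDl// sume_ge0// => i _; exact: integral_ge0.
have Hinc n h : (enorm h < r1 * a ^- n)%R ->
    (c * b ^+ n)%:E * increment_energy x0 u (rho - (m.+2)%:R * a ^- n)%R h <= F%:E * J n.
  move=> hr; rewrite /F [(_ * 2)%:E]EFinM -[leRHS]muleA; apply: Hr1 => //.
  - by rewrite mulr_gt0// exprn_gt0.
  - by rewrite mule_ge0.
  move=> k g gE gr; apply: le_trans.
    apply: (increment_energy_directional x0 rho mu_ a1 (s01 k) _ (ltW c0) (ltW b0) _ gE gr).
      by case/andP: r01.
    exact: Hdir.
  by apply: lee_wpmul2l.
pose A : R := (6 * (16 / eta) ^+ d)%R.
have A0 : (0 <= A)%R by rewrite mulr_ge0// exprn_ge0// divr_ge0// ltW.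
pose P n := near_energy x0 u rho rho (2 * (eta * (2 * a ^- n))).
have P0 n : 0 <= P n by exact: near_energy_ge0.
pose kn n := shell_kernel d a alpha n.
have kn0 n : (0 <= kn n)%R by exact: powR_ge0.
have Hn n : c%:E * ((kn n)%:E * shell_energy x0 rho u a n) <=
    (c * A)%:E * ((kn n)%:E * P n) + (D * K * F)%:E * J (n + j0)%N.
  pose M := near_energy x0 u (rho - eta * (2 * a ^- n)) (rho - eta * (2 * a ^- n))
     (2 * (2 * a ^- n)).
  have M0 : 0 <= M by exact: near_energy_ge0.
  have HM : c%:E * ((kn n)%:E * M) <= K%:E * (F%:E * J (n + j0)%N).
    apply: (near_energy_kernel_le_jumps mu_ a1 alpha02 c0 _ _ Hj0 Hj).
      exact: mule_ge0.
    exact: Hinc.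
  have HQ : shell_energy x0 rho u a n <= A%:E * P n + D%:E * M.
    exact: shell_energy_le.
  clearbody M.
  apply: (@le_trans _ _ (c%:E * ((kn n)%:E * (A%:E * P n + D%:E * M)))).
    by apply: lee_wpmul2l; [rewrite lee_fin ltW|apply: lee_wpmul2l => //; rewrite lee_fin].
  have AP0 : 0 <= A%:E * P n by exact: mule_ge0.
  have DM0 : 0 <= D%:E * M by exact: mule_ge0.
  rewrite ge0_muleDr// ge0_muleDr ?mule_ge0 ?lee_fin//.
  apply: leeD.
    by rewrite !muleA -!EFinM le_eqVlt; apply/orP; left; apply/eqP; congr (_%:E * _); ring.
  rewrite (_ : c%:E * _ = D%:E * (c%:E * ((kn n)%:E * M))); last first.
    by rewrite !muleA -!EFinM; congr (_%:E * _); ring.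
  rewrite (_ : (D * K * F)%:E * _ = D%:E * (K%:E * (F%:E * J (n + j0)%N))); last first.
    by rewrite !muleA -!EFinM.
  by apply: lee_wpmul2l; rewrite ?lee_fin.
set E' := fractional_energy x0 rho u alpha in Efin *.
have E'0 : 0 <= E'.
  by apply: integral_ge0 => x _; apply: integral_ge0 => y _; pos.
set X := \int[lam]_x \int[sigma]_z _.
have XE : \int[sigma]_z chord_energy x0 u rho z = X.
  apply: (@fubini_tonelli _ _ _ _ _ sigma lam (fun t : V * V =>
    ((enorm (t.2 - x0) < rho)%R%:R * (enorm (t.2 + t.1 - x0) < rho)%R%:R *
      (u (t.2 + t.1) - u t.2) ^+ 2)%:E)).
    by meas.
  by move=> t; pos.
have SE : E' <= \sum_(n <oo) (kn n)%:E * shell_energy x0 rho u a n.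
  exact: fractional_energy_le_shells.
have SP : \sum_(n <oo) (kn n)%:E * P n <=
    ((2 * a * eta) `^ (d%:R + alpha) * (a / (a - 1)))%:E * E'.
  exact: near_energy_kernel_sum.
have SJ : \sum_(n <oo) J (n + j0)%N <= m%:R%:E * X.
  apply: (le_trans (nneseries_shift_le j0 J0)); rewrite -XE.
  by apply: shell_jumps_sum => // k; case/andP: (s01 k).
have X0 : 0 <= X by rewrite -XE; exact: integral_ge0.
have Q0 n : 0 <= (kn n)%:E * shell_energy x0 rho u a n.
  rewrite mule_ge0 ?lee_fin//.
  by apply: integral_ge0 => x _; apply: integral_ge0 => y _; pos.
(* Sum over all scales: the short increments return at most half of the fractional energy, by the
   choice of eta, and the other terms add up to the jump energy X. *)
have main : c%:E * E' <= (c / 2)%:E * E' + (D * K * (F * m%:R))%:E * X.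
  apply: (@le_trans _ _ (\sum_(n <oo) c%:E * ((kn n)%:E * shell_energy x0 rho u a n))).
    by rewrite nneseriesZl//; apply: lee_wpmul2l => //; rewrite lee_fin ltW.
  apply: (@le_trans _ _ (\sum_(n <oo)
      ((c * A)%:E * ((kn n)%:E * P n) + (D * K * F)%:E * J (n + j0)%N))).
    by apply: lee_nneseries => // n _ _; rewrite mule_ge0 ?lee_fin// ltW.
  have cA0 : (0 <= c * A)%R by rewrite mulr_ge0// ltW.
  rewrite nneseriesD; last 2 first.
  - by move=> n _ _; rewrite !mule_ge0 ?lee_fin.
  - by move=> n _ _; rewrite !mule_ge0 ?lee_fin.
  rewrite nneseriesZl; last by move=> n _; rewrite !mule_ge0 ?lee_fin.
  rewrite nneseriesZl//; apply: leeD.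
    apply: (@le_trans _ _ ((c * A)%:E * (((2 * a * eta) `^ (d%:R + alpha) *
       (a / (a - 1)))%:E * E'))).
      by apply: lee_wpmul2l; rewrite ?lee_fin.
    rewrite muleA -EFinM; apply: lee_wpmul2r => //; rewrite lee_fin -[(c * A * _)%R]mulrA.
    by apply: ler_wpM2l; [exact: ltW|exact: Heta].
  apply: (@le_trans _ _ ((D * K * F)%:E * (m%:R%:E * X))).
    by apply: lee_wpmul2l; rewrite ?lee_fin.
  by rewrite muleA -EFinM !mulrA.
have Efn : E' \is a fin_num by rewrite ge0_fin_numE.
move: main; rewrite -(fineK Efn); set e := fine E'.
(* If X is infinite the claim is trivial unless its coefficient is 0, since 0 * +oo = 0; in that
   case absorption alone forces e <= 0. *)
have [->|Xoo] := eqVneq X +oo.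
  have [->|p0] := eqVneq (D * K * (F * m%:R))%R 0%R.
    rewrite mulr0 !mul0e adde0 -!EFinM !lee_fin; lra.
  move=> _; rewrite gt0_muley ?leey// lte_fin; apply: mulr_gt0 => //; rewrite lt0r p0; exact: DKFm0.
have Xfn : X \is a fin_num by rewrite ge0_fin_numE// lt_neqAle Xoo leey.
rewrite -(fineK Xfn) -!EFinM -EFinD !lee_fin; lra.
Qed.

End lower_energy.

(** * Interpolated measures *)

Section interpolated_measure.
Variables (R : realType) (d : nat) (alpha0 alpha : R).
Local Notation V := 'rV[R]_d.
Hypothesis alpha0_gt0 : 0 < alpha0.
Hypothesis alphas : alpha0 <= alpha < 2.
Variable nu : {measure set V -> \bar R}.
Local Open Scope ereal_scope.

Let al02 : (0 < 2 - alpha0)%R.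
Proof. by case/andP: alphas => h1 h2; rewrite subr_gt0 (le_lt_trans h1). Qed.
Let al2 : (0 < 2 - alpha)%R. Proof. by case/andP: alphas => _; rewrite subr_gt0. Qed.
Let al : (0 <= alpha - alpha0)%R. Proof. by case/andP: alphas; rewrite subr_ge0. Qed.
Let kappa : R := ((2 - alpha) / (2 - alpha0))%R.
Let kappa0 : (0 < kappa)%R. Proof. exact: divr_gt0. Qed.

(** It vanishes at the origin, where the density of [interpolated] is +oo for alpha > alpha0.
    Integrands that are 0 at the origin do not see the difference, and a measure without mass there
    can be shown sigma-finite. *)
Definition interpolation_weight (z : V) : R :=
  ((2 - alpha) / (2 - alpha0) * enorm z `^ (alpha0 - alpha) * (0 < enorm z)%R%:R)%R.

Let mweight : measurable_fun setT (fun z => (interpolation_weight z)%:E).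
Proof.
rewrite /interpolation_weight; have menorm := @measurable_enorm R d.
apply/measurable_EFinP; apply: measurable_funM.
  by apply: measurable_funM => //; exact: measurable_powR_comp.
exact: measurable_ltr_ind.
Qed.

Let weight0 z : 0 <= (interpolation_weight z)%:E.
Proof.
rewrite lee_fin; apply: mulr_ge0; last exact: ler0n.
by apply: mulr_ge0; [exact: ltW|exact: powR_ge0].
Qed.

Let sigma : {measure set V -> \bar R} := density_measure nu mweight weight0.

Let weightE (z : V) : (0 < enorm z)%R ->
  interpolation_weight z = (kappa * (enorm z)^-1 `^ (alpha - alpha0))%R.
Proof.
by move=> z0; rewrite /interpolation_weight z0 mulr1 powR_invl ?ltW// opprB.
Qed.

Let weight_le (s : R) (z : V) : (0 < s < enorm z)%R ->
  (interpolation_weight z <= kappa * s^-1 `^ (alpha - alpha0))%R.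
Proof.
move=> /andP[s0 sz]; have z0 := lt_trans s0 sz.
rewrite weightE// ler_wpM2l ?(ltW kappa0)//; apply: ge0_ler_powR => //.
- by rewrite nnegrE invr_ge0 ltW.
- by rewrite nnegrE invr_ge0 ltW.
- by rewrite lef_pV2// ltW.
Qed.

Let weight_ge (s : R) (z : V) : (0 < enorm z <= s)%R ->
  (kappa * s^-1 `^ (alpha - alpha0) <= interpolation_weight z)%R.
Proof.
move=> /andP[z0 zs]; have s0 := lt_le_trans z0 zs.
rewrite weightE// ler_wpM2l ?(ltW kappa0)//; apply: ge0_ler_powR => //.
- by rewrite nnegrE invr_ge0 ltW.
- by rewrite nnegrE invr_ge0 ltW.
- by rewrite lef_pV2.
Qed.

Let measurable_tail (s : R) : measurable [set z : V | (s < enorm z)%R].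
Proof.
rewrite (_ : [set z | _] = @enorm R d @^-1` `]s, +oo[%classic).
  by rewrite -[X in measurable X]setTI; exact: measurable_enorm.
by apply/seteqP; split => z /=; rewrite in_itv/= andbT.
Qed.

Let integral_sigma D (f : V -> \bar R) : measurable D -> measurable_fun setT f ->
  (forall z, 0 <= f z) ->
  \int[sigma]_(z in D) f z = \int[nu]_(z in D) ((interpolation_weight z)%:E * f z).
Proof.
move=> mD mf f0.
by rewrite -(ge0_integral_with_density nu mweight weight0)//; exact: measurable_funTS.
Qed.

Lemma integral_interpolated (f : V -> \bar R) :
  measurable_fun setT f -> (forall z, 0 <= f z) -> f 0%R = 0 ->
  \int[interpolated alpha0 alpha nu]_z f z = \int[sigma]_z f z.
Proof.
move=> mf f0 f00; rewrite [RHS]integral_sigma// /interpolated.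
case: eqVneq => [aa|_].
  apply: eq_integral => z _; have [->|z0] := eqVneq z 0%R; first by rewrite f00 mule0.
  rewrite weightE ?enorm_gt0// /kappa aa subrr powRr0 mulr1 divff ?mul1e//.
  by rewrite lt0r_neq0// -aa.
have mz0 : measurable_fun setT (fun z : V => z == 0%R).
  rewrite (_ : (fun z => _) = (fun z : V => (enorm z <= 0)%R)).
    by apply: measurable_fun_ler => //; exact: measurable_enorm.
  apply/funext => z; have [->|z0] := eqVneq z 0%R; first by rewrite enorm0 lexx.
  by apply/esym/negbTE; rewrite -ltNge enorm_gt0.
rewrite [LHS]ge0_integral_with_density//.
- apply: eq_integral => z _; have [->|z0] := eqVneq z 0%R; first by rewrite f00 !mule0.
  by rewrite /interpolation_weight enorm_gt0 z0 mulr1.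
- apply: measurable_fun_ifT => //.
  apply/measurable_EFinP; apply: measurable_funM => //.
  exact: measurable_powR_comp (@measurable_enorm R d).
- move=> z; case: ifPn => // _; rewrite lee_fin mulr_ge0 ?powR_ge0//.
  exact: ltW.
Qed.

Section upper_bound.
Variable C : R.
Hypothesis C0 : (0 < C)%R.
Hypothesis nuC : upper_bound alpha0 C nu.

Let nu_tail_le1 (s : R) : (0 < s <= 1)%R ->
  nu [set z | (s < enorm z)%R] <= (C * s `^ (- alpha0))%:E.
Proof.
move=> /andP[s0 s1].
have H : (s ^+ 2)%:E * nu [set z | (s < enorm z)%R] <= (C * s `^ (2 - alpha0))%:E.
  apply: le_trans (nuC _); last by rewrite s0.
  rewrite -(integral_cst nu (measurable_tail s) (s ^+ 2)%:E).
  rewrite integral_mkcond; apply: ge0_le_integral_pointwise => z _.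
    by rewrite /patch; case: ifP => // _; rewrite lee_fin sqr_ge0.
  rewrite /patch; case: ifPn => [|_]; last by rewrite lee_fin sqr_ge0.
  by rewrite inE/= => sz; rewrite min_l ?lexx// ltW.
move: H; rewrite -lee_pdivlMl ?exprn_gt0// => /le_trans; apply.
rewrite -EFinM lee_fin mulrCA ler_wpM2l ?(ltW C0)//.
rewrite powRD ?(lt0r_neq0 s0) ?implybT//.
by rewrite powR_mulrn ?(ltW s0)// mulrA mulVf ?mul1r// expf_neq0 ?lt0r_neq0.
Qed.

(** Distances up to 2 occur in a unit ball, beyond the range of [upper_bound]. For s > 1 the tail at
    1 is used, and 4 absorbs s^-alpha0 >= 1/4. *)
Let nu_tail (s : R) : (0 < s < 2)%R ->
  nu [set z | (s < enorm z)%R] <= (4 * C * s `^ (- alpha0))%:E.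
Proof.
move=> /andP[s0 s2]; have [s1|s1] := leP s 1%R.
  rewrite (le_trans (nu_tail_le1 _)) ?s0//.
  by rewrite lee_fin -mulrA ler_peMl ?mulr_ge0 ?powR_ge0 ?(ltW C0)// ler1n.
apply: (@le_trans _ _ (nu [set z | (1 < enorm z)%R])).
  apply: le_measure; rewrite ?inE; [exact: measurable_tail|exact: measurable_tail|].
  by move=> z /=; exact: lt_trans.
have /nu_tail_le1/le_trans : (0 < (1 : R) <= 1)%R by rewrite ltr01 lexx.
apply; rewrite lee_fin powR1 mulr1 mulrAC ler_peMl ?(ltW C0)//.
have : ((2^-1) ^+ 2 <= s `^ (- alpha0))%R.
  rewrite -powR_invl ?(ltW s0)//.
  apply: (@le_trans _ _ ((2^-1) `^ alpha0)%R).
    rewrite -powR_mulrn//; apply: ger_powR.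
      by rewrite invr_gt0 ltr0n/= invf_le1// ler1n.
    by rewrite -subr_ge0 ltW.
  apply: ge0_ler_powR.
  - exact: ltW.
  - by rewrite nnegrE invr_ge0.
  - by rewrite nnegrE invr_ge0 ltW.
  - by rewrite lef_pV2 ?posrE// ltW.
lra.
Qed.

Let sigma_tail_nu (s : R) : (0 < s)%R ->
  sigma [set z | (s < enorm z)%R] <=
  (kappa * s^-1 `^ (alpha - alpha0))%:E * nu [set z | (s < enorm z)%R].
Proof.
move=> s0; rewrite -(integral_cst nu (measurable_tail s)).
apply: ge0_le_integral_pointwise => z sz; first exact: weight0.
by rewrite lee_fin weight_le// s0.
Qed.

(** The weight decreases with |z|, so on the tail it is at most its value at s, which turns
    s^-alpha0 into s^-alpha; the factor 2 - alpha is kept explicit. *)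
Lemma interpolated_tail (s : R) : (0 < s < 2)%R ->
  sigma [set z | (s < enorm z)%R] <=
  (4 * C / (2 - alpha0) * (2 - alpha) * s `^ (- alpha))%:E.
Proof.
move=> s02; have /andP[s0 s2] := s02; apply: (le_trans (sigma_tail_nu s0)).
apply: le_trans.
  by apply: lee_wpmul2l (nu_tail s02); rewrite lee_fin mulr_ge0 ?powR_ge0// ltW.
rewrite -EFinM lee_fin powR_invl ?(ltW s0)//.
have -> : (- alpha = - (alpha - alpha0) + - alpha0)%R by ring.
rewrite [in leRHS]powRD ?(lt0r_neq0 s0) ?implybT//.
rewrite le_eqVlt /kappa; apply/orP; left; apply/eqP; ring.
Qed.

(** The complements of balls around 0 have finite mass by the tail bound, and the origin has
    none. *)
Lemma interpolated_sigma_finite : sigma_finite setT sigma.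
Proof.
exists (fun n => [set 0%R] `|` [set z | (n.+1%:R^-1 < enorm z)%R]).
  apply/esym; rewrite -subTset => z _; have [->|z0] := eqVneq z 0%R.
    by exists 0%N => //; left.
  have ez : (0 < enorm z)%R by rewrite enorm_gt0.
  have /= [N _ HN] := @near_infty_natSinv_lt R (PosNum ez).
  by exists N => //; right; exact: HN N (leqnn N).
move=> n; have n0 : (0 < n.+1%:R^-1 :> R)%R by rewrite invr_gt0.
have m0 : measurable [set (0 : V)%R].
  apply: measurable_closed_rV; apply: compact_closed; last exact: compact_set1.
  exact: norm_hausdorff.
split; first by apply: measurableU => //; exact: measurable_tail.
apply: (@le_lt_trans _ _ (sigma [set 0%R] + sigma [set z | (n.+1%:R^-1 < enorm z)%R])).
  apply: measureU2 => //; exact: measurable_tail.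
have -> : sigma [set 0%R] = 0.
  apply: integral0_eq => z ->; by rewrite /interpolation_weight enorm0 ltxx mulr0.
rewrite add0e; apply: (le_lt_trans (interpolated_tail _)); last by rewrite ltry.
by rewrite n0 (@le_lt_trans _ _ 1%R)// ?ltr1n// invf_le1// ler1n.
Qed.

End upper_bound.

(** On the shell |z| < a^-n, so the weight is at least its value at a^-n; this supplies the missing
    factor a^(n (alpha - alpha0)) in the growth rate. *)
Lemma directional_interpolated (a s r c r' c' : R) (E : {vspace V}) : (1 < a)%R ->
  (0 < s <= 1)%R -> (r' <= r)%R -> (0 <= c')%R -> (c' <= c)%R ->
  directional nu a s r c (a `^ alpha0) E ->
  directional sigma a s r' (c' * ((2 - alpha) / (2 - alpha0))) (a `^ alpha) E.
Proof.
move=> a1 /andP[s0 s1] rr c0 cc dir n h k g hE hr k0 mg g0 Hg.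
have a0 : (0 < a)%R by exact: lt_trans a1.
have an0 : (0 < a ^- n)%R by rewrite invr_gt0 exprn_gt0.
have mshell := @measurable_shell R d a s n.
have hr' : (enorm h < r * a ^- n)%R by rewrite (lt_le_trans hr)// ler_wpM2r// ltW.
have := dir n h k g hE hr' k0 mg g0 Hg.
set I := \int[nu]_(z in _) _ => HI.
have I0 : 0 <= I by exact: integral_ge0.
pose w : R := (kappa * (a ^- n)^-1 `^ (alpha - alpha0))%R.
have w0 : (0 <= w)%R by rewrite mulr_ge0 ?powR_ge0// ltW.
apply: (@le_trans _ _ (w%:E * I)).
  apply: (@le_trans _ _ (w%:E * ((c * (a `^ alpha0) ^+ n)%:E * k))).
    rewrite muleA -EFinM; apply: lee_wpmul2r => //; rewrite lee_fin.
    have -> : (a `^ alpha = a `^ alpha0 * a `^ (alpha - alpha0))%R.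
      by rewrite -powRD ?(lt0r_neq0 a0) ?implybT// addrC subrK.
    rewrite exprMn /w invrK powR_expr ?(ltW a0)// -/kappa.
    set p := ((a `^ alpha0) ^+ n)%R; set q := ((a `^ _) ^+ n)%R.
    have p0 : (0 <= p)%R by rewrite exprn_ge0// powR_ge0.
    have q0 : (0 <= q)%R by rewrite exprn_ge0// powR_ge0.
    have -> : (c' * kappa * (p * q) = kappa * q * (c' * p))%R by ring.
    apply: ler_wpM2l; last exact: ler_wpM2r.
    by apply: mulr_ge0 => //; exact: ltW.
  by apply: lee_wpmul2l; rewrite ?lee_fin.
rewrite [leRHS]integral_sigma// -[leLHS]ge0_integralZl//; last exact: measurable_funTS.
apply: ge0_le_integral_pointwise => z /andP[z1 z2]; first by rewrite mule_ge0.
apply: lee_wpmul2r => //; rewrite lee_fin weight_ge//.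
rewrite (lt_le_trans _ z1) ?mulr_gt0 ?invr_gt0 ?exprn_gt0//=.
by rewrite (le_trans (ltW z2))// ler_piMl// ltW.
Qed.

End interpolated_measure.

Lemma integral_eball (R : realType) d (m : {measure set 'rV[R]_d -> \bar R})
    (x0 : 'rV[R]_d) (rho : R) (F : 'rV[R]_d -> \bar R) :
  (\int[m]_(x in eball x0 rho) F x =
   \int[m]_x (if (enorm (x - x0) < rho)%R then F x else 0))%E.
Proof.
rewrite integral_mkcond; congr (integral _ _ _); apply/funext => x.
rewrite /patch; case: ifPn => [/set_mem|xn]; first by rewrite /eball/= => ->.
by case: ifPn => // xr; case/negP: xn; apply/mem_set.
Qed.

Section local_energies.
Variables (R : realType) (d : nat) (x0 : 'rV[R]_d) (rho : R) (v : 'rV[R]_d -> R).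
Local Notation V := 'rV[R]_d.
Local Notation lam := (lebesgue_rV R d).
Local Notation bl x := ((enorm (x - x0) < rho)%R%:R).
Hypothesis mv : measurable_fun (eball x0 rho) v.
Local Open Scope ereal_scope.

(** The function v is measurable on the ball only; its extension by 0 is measurable everywhere, and
    the energies of the ball do not see the difference. *)
Definition ball_restriction (x : V) : R := if (enorm (x - x0) < rho)%R then v x else 0%R.
Local Notation u := ball_restriction.

Let mball : measurable (eball x0 rho). Proof. exact: measurable_eball. Qed.

Lemma measurable_ball_restriction : measurable_fun setT u.
Proof.
rewrite (_ : u = v \_ (eball x0 rho)); first by apply: (measurable_restrictT _ mball).1.
apply/funext => x; rewrite /u /patch; case: ifPn => xr.
  by case: ifPn => // /negP[]; exact/mem_set.
by case: ifPn => // /set_mem; rewrite /eball/= (negbTE xr).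
Qed.

Lemma energy_kernelE (mu : R.-ker V ~> V) :
  energy (fun x => mu x) (eball x0 rho) v =
  \int[lam]_x \int[mu x]_y (bl x * bl y * (u y - u x) ^+ 2)%:E.
Proof.
rewrite /energy integral_eball; congr (integral _ _ _); apply/funext => x.
case: ifPn => xr; last by rewrite integral0_eq// => y _; rewrite mul0r mul0r.
rewrite integral_eball; congr (integral _ _ _); apply/funext => y.
rewrite /u xr; case: ifPn => yr; last by rewrite mulr0 mul0r.
by rewrite !mul1r.
Qed.

Lemma energy_fracE (alpha : R) : (alpha < 2)%R ->
  energy (mu_frac alpha) (eball x0 rho) v =
  (2 - alpha)%:E * fractional_energy x0 rho u alpha.
Proof.
move=> al2; have al0 : (0 <= 2 - alpha)%R by rewrite subr_ge0 ltW.
have mu_ := measurable_ball_restriction.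
pose w (t : V * V) : R := (bl t.1 * bl t.2 * (u t.2 - u t.1) ^+ 2 *
  enorm (t.2 - t.1) `^ (- d%:R - alpha))%R.
have w0 t : 0 <= (w t)%:E by rewrite /w; pos.
have mw : measurable_fun setT (fun t => (w t)%:E).
  by rewrite /w; move: mu_; move: (u) => u' mu'; meas.
have -> : fractional_energy x0 rho u alpha = \int[lam]_x \int[lam]_y (w (x, y))%:E by [].
rewrite -[RHS]ge0_integralZl//; last 2 first.
- exact: measurable_int_last mw w0.
- by move=> x _; exact: integral_ge0.
rewrite /energy integral_eball; congr (integral _ _ _); apply/funext => x.
rewrite -[RHS]ge0_integralZl//; last first.
  by apply: (measurableT_comp mw); exact: pair1_measurable.
case: ifPn => xr; last first.
  by rewrite integral0_eq// => y _; rewrite /w/= (negbTE xr) !mul0r mule0.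
rewrite ge0_integral_with_density//; last 4 first.
- by meas.
- by move=> y; pos.
- apply/measurable_EFinP; apply: measurable_funX.
  exact: measurable_funB.
- by move=> y _; rewrite lee_fin sqr_ge0.
rewrite integral_eball; congr (integral _ _ _); apply/funext => y.
case: ifPn => yr; last by rewrite /w/= (negbTE yr) mulr0 !mul0r mule0.
rewrite -!EFinM /w/= /u xr yr !mul1r enormC.
by congr _%:E; ring.
Qed.

End local_energies.

Lemma finite_lower_bound (R : realType) n (t : 'I_n -> R) :
  (forall k, 0 < t k) -> exists2 r : R, 0 < r <= 1 & forall k, r <= t k.
Proof.
move=> t0; have S0 : 0 <= \sum_(k < n) (t k)^-1.
  by apply: sumr_ge0 => k _; rewrite invr_ge0 ltW.
have S1 : 0 < 1 + \sum_(k < n) (t k)^-1 by rewrite ltr_pwDl.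
exists (1 + \sum_(k < n) (t k)^-1)^-1.
  by rewrite invr_gt0 S1 invf_le1// lerDl.
move=> k; rewrite -[leRHS]invrK lef_pV2 ?posrE ?invr_gt0//.
rewrite (bigD1 k)//= addrCA lerDl addr_ge0// sumr_ge0// => i _.
by rewrite invr_ge0 ltW.
Qed.

(** * Comparability of the two energies, uniformly in alpha *)

Section comparability.
Variables (R : realType) (d : nat) (alpha0 C_U a : R).
Local Notation V := 'rV[R]_d.
Local Notation lam := (lebesgue_rV R d).
Variable nu_lo : {measure set V -> \bar R}.
Hypothesis alpha0_02 : 0 < alpha0 < 2.
Hypothesis C_U0 : 0 < C_U.
Hypothesis a1 : 1 < a.
Hypothesis nu_lo_up : upper_bound alpha0 C_U nu_lo.
Hypothesis d_gt0 : (0 < d)%N.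
Variables (n : nat) (E : 'I_n -> {vspace V}) (f : 'I_n -> V -> \bar R).
Hypothesis mf : forall k, measurable_fun setT (f k) /\ (forall x, (0 <= f k x)%E).
Hypothesis nu_loE : forall S, measurable S ->
  nu_lo S = (\sum_(k < n) with_density (hausdorff_on (E k)) (f k) S)%E.
Hypothesis sumE : (\sum_(k < n) E k)%VS = fullv.
Hypothesis f_pos : forall k,
  (0 < \int[hausdorff_on (E k)]_(x in eball 0 1) f k x)%E /\
  scaling alpha0 a (with_density (hausdorff_on (E k)) (f k)).
Local Open Scope ereal_scope.

Let al0 : (0 < alpha0)%R. Proof. by case/andP: alpha0_02. Qed.
Let al02 : (0 < 2 - alpha0)%R. Proof. by case/andP: alpha0_02 => _; rewrite subr_gt0. Qed.

Let directional_nu_lo : exists (s t c : 'I_n -> R),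
  [/\ forall k, (0 < s k <= 1)%R, forall k, (0 < t k)%R, forall k, (0 < c k)%R &
   forall k, (0 < \dim (E k))%N ->
     directional nu_lo a (s k) (t k) (c k) (a `^ alpha0) (E k)].
Proof.
have /choice[t Ht] : forall k, exists t : R * R * R,
    [/\ (0 < t.1.1 <= 1)%R, (0 < t.1.2)%R, (0 < t.2)%R &
     ((0 < \dim (E k))%N -> directional nu_lo a t.1.1 t.1.2 t.2 (a `^ alpha0) (E k))].
  (* A zero-dimensional [E k] carries no direction to control, so arbitrary constants serve. *)
  move=> k; have [dE|dE] := posnP (\dim (E k)).
    by exists (1, 1, 1)%R; split => //=; rewrite ?ltr01 ?lexx.
  have [mfk fk0] := mf k; have [fkp fks] := f_pos k.
  have le_nu S : measurable S -> with_density (hausdorff_on (E k)) (f k) S <= nu_lo S.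
    move=> mS; rewrite (nu_loE mS) (bigD1 k)//=; apply: leeDl.
    apply: sume_ge0 => i _; apply: integral_ge0 => x _.
    exact: (mf i).2 x.
  have [s [r [c [s01 r0 c0 H]]]] :=
    directional_lower_bound a1 mfk fk0 le_nu fks fkp dE.
  by exists (s, r, c); split.
exists (fun k => (t k).1.1), (fun k => (t k).1.2), (fun k => (t k).2).
by split => k; have [] := Ht k.
Qed.

Lemma interpolated_comparability : exists A : R, (1 <= A)%R /\
  forall nu_up : {measure set V -> \bar R}, upper_bound alpha0 C_U nu_up ->
  forall (alpha : R) (mu : R.-ker V ~> V), (alpha0 <= alpha < 2)%R ->
    sandwiched (interpolated alpha0 alpha nu_lo) (interpolated alpha0 alpha nu_up) mu ->
    local_comparability mu alpha A.
Proof.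
have [s [q [c [s01 q0 c0 dir]]]] := directional_nu_lo.
have [r r01 rq] := finite_lower_bound q0.
have [e /andP[e0 e1] ec] := finite_lower_bound c0.
have [C Cge0 HC] := fractional_energy_le a1 al0 d_gt0 sumE r01.
have v0 : (0 < ball_volume R d)%R by exact: ball_volume_gt0.
(* A1 serves the lower bound and A2 the upper bound. Neither involves alpha: the factor 2 - alpha of
   the jump measures cancels against that of the fractional energy. *)
pose A1 : R := ((2 - alpha0) * C / e)%R.
pose A2 : R := ((ball_volume R d)^-1 * 4 ^+ d.+1 * (4 * C_U / (2 - alpha0)))%R.
have A10 : (0 <= A1)%R.
  by apply: divr_ge0; [apply: mulr_ge0 => //|]; exact: ltW.
have A20 : (0 <= A2)%R.
  apply: mulr_ge0; first by rewrite mulr_ge0 ?exprn_ge0// invr_ge0 ltW.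
  by apply: divr_ge0; [apply: mulr_ge0 => //|]; exact: ltW.
exists (1 + A1 + A2)%R; split; first by rewrite -addrA lerDl addr_ge0.
move=> nu_up nu_upC alpha mu alphas mu_sandwich rho x0 rho01 _ v [mv _ vfin].
have /andP[al1 al2] := alphas.
have al2' : (0 < 2 - alpha)%R by rewrite subr_gt0.
set A : R := (1 + A1 + A2)%R.
have A0 : (0 < A)%R by rewrite /A -addrA ltr_pwDl// addr_ge0.
rewrite energy_fracE// in vfin *.
rewrite energy_kernelE.
have mu_ := measurable_ball_restriction mv.
move: mu_ vfin; set u := ball_restriction _ _ _; clearbody u => mu_ vfin.
set F := fractional_energy x0 rho u alpha in vfin *.
have F0 : 0 <= F.
  by apply: integral_ge0 => x _; apply: integral_ge0 => y _; pos.
set X := \int[lam]_x \int[mu x]_y _.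
pose p (x y : V) : R := ((enorm (x - x0) < rho)%R%:R * (enorm (y - x0) < rho)%R%:R *
  (u y - u x) ^+ 2)%R.
pose g (t : V * V) : \bar R := (p t.1 t.2)%:E.
have mg : measurable_fun setT g by rewrite /g /p; meas.
have g0 t : 0 <= g t by rewrite /g /p; pos.
have mgx x : measurable_fun setT (fun z : V => g (x, (x + z)%R)).
  apply: (measurableT_comp mg); apply: measurable_fun_pair => /=.
    exact: measurable_cst.
  by apply: measurable_addrV; [exact: measurable_cst|exact: measurable_id].
have g00 x : g (x, (x + 0)%R) = 0 by rewrite /g /p/= addr0 subrr expr0n mulr0.
have Hsand x := mu_sandwich g mg g0 x.
have sandE (nu : {measure set V -> \bar R}) x :
    \int[interpolated alpha0 alpha nu]_z g (x, (x + z)%R) = _ :=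
  integral_interpolated alphas nu (mgx x) (fun z => g0 (x, (x + z)%R)) (g00 x).
have X0 : 0 <= X.
  by apply: integral_ge0 => x _; apply: integral_ge0 => y _; pos.
have up : X <= (A2 * (2 - alpha))%:E * F.
  pose sigma := sigma_finite_pack (interpolated_sigma_finite al0 alphas C_U0 nu_upC).
  have C0 : (0 <= 4 * C_U / (2 - alpha0) * (2 - alpha))%R.
    apply: mulr_ge0; last exact: ltW.
    by apply: divr_ge0; [apply: mulr_ge0 => //|]; exact: ltW.
  have H := @jump_energy_le _ _ x0 rho u mu_ rho01 sigma _ alpha C0
    (fun s s02 => interpolated_tail al0 alphas C_U0 nu_upC s02).
  rewrite /A2 -[(_ * (2 - alpha))%R]mulrA.
  apply: le_trans H; apply: ge0_le_integral_pointwise => x _.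
    by apply: integral_ge0 => y _; pos.
  by have [_] := Hsand x; rewrite sandE.
have lo : (e * ((2 - alpha) / (2 - alpha0)))%:E * F <= C%:E * X.
  pose sigma := sigma_finite_pack (interpolated_sigma_finite al0 alphas C_U0 nu_lo_up).
  have c1 : (0 < e * ((2 - alpha) / (2 - alpha0)))%R.
    by apply: mulr_gt0 => //; exact: divr_gt0.
  (* Finiteness, which the absorption needs, is the energy part of [H_frac] divided by the positive
     factor 2 - alpha. *)
  have Ffin : F < +oo.
    rewrite ltNge leye_eq; apply/negP => /eqP FE.
    by move: vfin; rewrite FE gt0_muley ?lte_fin// ltxx.
  have H := HC alpha s _ sigma alphas s01 c1 _ x0 rho u rho01 mu_ Ffin.
  apply: le_trans (H _) _ => [k dk|].
    exact: (directional_interpolated alphas a1 (s01 k) (rq k) (ltW e0) (ec k) (dir k dk)).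
  apply: lee_wpmul2l; first by rewrite lee_fin.
  apply: ge0_le_integral_pointwise => x _.
    by apply: integral_ge0 => y _; pos.
  by have [+ _] := Hsand x; rewrite sandE.
clearbody X F.
split.
- rewrite lee_pdivrMl//; apply: (le_trans up).
  rewrite muleA -EFinM; apply: lee_wpmul2r => //; rewrite lee_fin.
  by apply: ler_wpM2r; [exact: ltW|rewrite /A lerDr addr_ge0].
- have -> : (2 - alpha)%:E * F =
      ((2 - alpha0) / e)%:E * ((e * ((2 - alpha) / (2 - alpha0)))%:E * F).
    by rewrite muleA -EFinM; congr (_%:E * _); field; rewrite !lt0r_neq0.
  apply: le_trans.
    by apply: lee_wpmul2l lo; rewrite lee_fin divr_ge0// ltW.
  rewrite muleA -EFinM; apply: lee_wpmul2r => //; rewrite lee_fin mulrAC.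
  by rewrite -/A1 /A -addrA addrCA lerDl addr_ge0.
Qed.

End comparability.

(** * Cut-off functions *)

Section cutoff_functions.
Variables (R : realType) (d : nat).
Local Notation V := 'rV[R]_d.

Definition clamp (t : R) : R := Num.max 0 (Num.min 1 t).

Lemma clamp_ge0 t : 0 <= clamp t. Proof. by rewrite /clamp le_max lexx. Qed.

Lemma clamp_le1 t : clamp t <= 1.
Proof. by rewrite /clamp ge_max ler01 ge_min lexx. Qed.

Lemma clamp_ge1 t : 1 <= t -> clamp t = 1.
Proof. by move=> t1; rewrite /clamp (min_l t1) max_r. Qed.

Lemma clamp_neq0 t : clamp t != 0 -> 0 < t.
Proof.
apply: contra_neqT; rewrite -leNgt => t0.
by rewrite /clamp min_r ?max_l// (le_trans t0).
Qed.

Lemma clamp_lipschitz s t : `|clamp s - clamp t| <= `|s - t|.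
Proof.
wlog ts : s t / t <= s.
  by move=> H; have [/H//|/ltW/H] := leP t s; rewrite distrC [leRHS]distrC.
have clampE x : clamp x = if x <= 0 then 0 else if x <= 1 then x else 1.
  rewrite /clamp; have [x0|x0] := leP x 0; first by rewrite min_r ?max_l// (le_trans x0).
  by have [x1|x1] := leP x 1; rewrite max_r// ltW.
rewrite [leRHS]ger0_norm ?subr_ge0// !clampE ler_norml.
by case: (leP s 0) => s0; case: (leP t 0) => t0; case: (leP s 1) => s1;
  case: (leP t 1) => t1; lra.
Qed.

(** The function tau falls linearly from 1 to 0 across an annulus of width rho, so (tau y - tau x)^2
    is at most rho^-2 times the integrand of [upper_bound] at radius rho; the supremum is then at
    most C rho^-alpha0. *)
Lemma upper_bound_cutoff (alpha0 C B : R) (nu_lo : set V -> \bar R)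
    (nu_up : {measure set V -> \bar R}) (mu : R.-ker V ~> V) :
  C <= B -> upper_bound alpha0 C nu_up -> sandwiched nu_lo nu_up mu ->
  cutoff mu alpha0 B.
Proof.
move=> CB nuC mu_sandwich rho r x0 rho0 rhor r1 _.
have rho1 : rho <= 1 by exact: le_trans r1.
pose tau (x : V) := clamp (1 + (r - enorm (x - x0)) / rho).
have mtau : measurable_fun setT tau.
  rewrite /tau /clamp; apply: measurable_maxr; first exact: measurable_cst.
  apply: measurable_minr; first exact: measurable_cst.
  by meas.
exists tau; split.
- by split => // x; exact: clamp_ge0.
- apply: closureS => x /= /clamp_neq0; rewrite /eball/=.
  rewrite -[X in _ < X + _](divff (lt0r_neq0 rho0)) -mulrDl pmulr_lgt0 ?invr_gt0//.
  by rewrite addrA subr_gt0 addrC.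
- move=> x; rewrite /eball/= => xr; apply: clamp_ge1.
  by rewrite lerDl divr_ge0 ?(ltW rho0)// subr_ge0 ltW.
- by move=> x; rewrite ger0_norm ?clamp_ge0// clamp_le1.
apply: ub_ereal_sup => _ [x _ <-].
have tau_le y : (tau y - tau x) ^+ 2 <= rho ^- 2 * Num.min rho (enorm (y - x)) ^+ 2.
  rewrite -exprVn -exprMn -real_normK ?num_real// lerXn2r ?nnegrE//.
    by rewrite mulr_ge0 ?invr_ge0 ?(ltW rho0)// le_min (ltW rho0) enorm_ge0.
  rewrite mulrC ler_pdivlMr// le_min; apply/andP; split.
    rewrite ler_piMl ?(ltW rho0)// ler_norml.
    have := clamp_ge0 (1 + (r - enorm (x - x0)) / rho).
    have := clamp_le1 (1 + (r - enorm (x - x0)) / rho).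
    have := clamp_ge0 (1 + (r - enorm (y - x0)) / rho).
    have := clamp_le1 (1 + (r - enorm (y - x0)) / rho).
    rewrite -/(tau x) -/(tau y) => *; apply/andP; split; lra.
  rewrite -ler_pdivlMr//; apply: (le_trans (clamp_lipschitz _ _)).
  rewrite (_ : _ - _ = (enorm (x - x0) - enorm (y - x0)) / rho); last by ring.
  rewrite normrM [X in _ * X]ger0_norm ?invr_ge0 ?(ltW rho0)// ler_wpM2r ?invr_ge0 ?(ltW rho0)//.
  have h1 := enorm_triangle x y x0; have h2 := enorm_triangle y x x0.
  move: h2; rewrite [enorm (x - y)]enormC => h2.
  rewrite ler_norml; apply/andP; split; lra.
pose g (t : V * V) : \bar R := ((tau t.2 - tau t.1) ^+ 2)%:E.
have mg : measurable_fun setT g.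
  by rewrite /g; move: mtau; move: (tau) => tau' mtau'; meas.
have g0 t : (0 <= g t)%E by rewrite lee_fin sqr_ge0.
have [_ H] := mu_sandwich g mg g0 x; apply: (le_trans H).
apply: (@le_trans _ _ (\int[nu_up]_z ((rho ^- 2)%:E * (Num.min rho (enorm z) ^+ 2)%:E))%E).
  apply: ge0_le_integral_pointwise => z _; first exact: g0.
  rewrite -EFinM lee_fin; have := tau_le (x + z).
  by rewrite addrAC subrr add0r.
have mmin : measurable_fun setT (fun z : V => (Num.min rho (enorm z) ^+ 2)%:E).
  apply/measurable_EFinP; apply: measurable_funX.
  by apply: measurable_minr; [exact: measurable_cst|exact: measurable_enorm].
rewrite ge0_integralZl//; last 2 first.
- by move=> z _; rewrite lee_fin sqr_ge0.
- by rewrite lee_fin invr_ge0 sqr_ge0.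
have rho01 : 0 < rho <= 1 by rewrite rho0.
apply: le_trans.
  by apply: lee_wpmul2l (nuC _ rho01); rewrite lee_fin invr_ge0 sqr_ge0.
rewrite -EFinM lee_fin mulrCA powRD ?(lt0r_neq0 rho0) ?implybT// powR_mulrn ?(ltW rho0)//.
rewrite [rho ^- 2 * _]mulrA mulVf ?mul1r ?expf_neq0 ?lt0r_neq0//.
by rewrite ler_wpM2r ?powR_ge0.
Qed.

End cutoff_functions.

Theorem theorem1p5 (R : realType) (d : nat) (alpha0 C_U a : R)
    (nu_lo : {measure set 'rV[R]_d -> \bar R}) :
  0 < alpha0 < 2 -> 0 < C_U -> 1 < a ->
  upper_bound alpha0 C_U nu_lo ->
  (exists (n : nat) (E : 'I_n -> {vspace 'rV[R]_d})
      (f : 'I_n -> 'rV[R]_d -> \bar R),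
    [/\ (1 <= n <= d)%N,
        forall k, measurable_fun setT (f k) /\ (forall x, 0 <= f k x)%E,
        forall S, measurable S ->
          nu_lo S = (\sum_(k < n) with_density (hausdorff_on (E k)) (f k) S)%E,
        (\sum_(k < n) E k)%VS = fullv &
        forall k,
          (0 < \int[hausdorff_on (E k)]_(x in eball 0 1) f k x)%E /\
          scaling alpha0 a (with_density (hausdorff_on (E k)) (f k))]) ->
  (exists A B : R, [/\ 1 <= A, 1 <= B &
    forall (nu_up : {measure set 'rV[R]_d -> \bar R})
        (mu : R.-ker 'rV[R]_d ~> 'rV[R]_d),
      upper_bound alpha0 C_U nu_up ->
      symmetric_family mu ->
      sandwiched nu_lo nu_up mu ->
      [/\ local_comparability mu alpha0 A,
          cutoff mu alpha0 B &
          cutoff mu alpha0 (4 * C_U)]]) /\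
  (exists A : R, 1 <= A /\
    forall (nu_up : {measure set 'rV[R]_d -> \bar R}),
      upper_bound alpha0 C_U nu_up ->
    forall (alpha : R) (mu_alpha : R.-ker 'rV[R]_d ~> 'rV[R]_d),
      alpha0 <= alpha < 2 ->
      symmetric_family mu_alpha ->
      sandwiched (interpolated alpha0 alpha nu_lo)
        (interpolated alpha0 alpha nu_up) mu_alpha ->
      local_comparability mu_alpha alpha A).
Proof.
move=> alpha0_02 C0 a1 lo_up [n [E [f [n1d mf nuE sumE fE]]]].
have d_gt0 : (0 < d)%N by case/andP: n1d => n1 /(leq_trans n1).
have [A [A1 HA]] :=
  interpolated_comparability alpha0_02 C0 a1 lo_up d_gt0 mf nuE sumE fE.
split; last first.
  exists A; split => // nu_up up_up alpha mu alphas _ mu_sandwich.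
  exact: HA up_up _ _ alphas mu_sandwich.
(* The cut-off estimate holds with [C_U] itself; the maximum enforces 1 <= B, and the last conjunct
   follows since [C_U] is at most [4 * C_U]. *)
exists A, (Num.max 1 C_U); split => //; first by rewrite le_max lexx.
move=> nu_up mu up_up _ mu_sandwich; split.
(* At alpha = alpha0 the interpolated measures are the original ones, so this is the left endpoint
   of the robust statement. *)
- have alphas : alpha0 <= alpha0 < 2 by rewrite lexx; case/andP: alpha0_02.
  by apply: (HA nu_up up_up alpha0 mu alphas); rewrite /interpolated eqxx.
- by apply: upper_bound_cutoff up_up mu_sandwich; rewrite le_max lexx orbT.
- apply: upper_bound_cutoff up_up mu_sandwich.
  by rewrite ler_peMl ?(ltW C0)// ler1n.
Qed.
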